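(* Let $k\in\mathbb Z$, $s\in(0,\pi)$, and for $\alpha\in(0,1)\cup(1,2)$ put $$S_{k}^{\alpha}(s)=\frac{c_\alpha\sin^{\alpha-1}(s)}{2\tan(\alpha\frac\pi2)}\sum_{l=-\infty}^\infty e^{i2ls}\big((1-\alpha)k^2-2kl\big)\frac{\Gamma\left(\frac{-1+\alpha}{2}+|l|\right)\Gamma\left(\frac{-1-\alpha}{2}+|k-l|\right)}{\Gamma\left(\frac{3-\alpha}{2}+|l|\right)\Gamma\left(\frac{3+\alpha}{2}+|k-l|\right)}.$$ If $\alpha\in(0,1)$, then $$\mathcal D^\alpha[\lambda_k](\cot(s))=e^{-i\,\mathrm{sgn}(k)\alpha\frac\pi2}S_k^\alpha(s),\qquad \overline{\mathcal D^\alpha}[\lambda_k](\cot(s))=-e^{i\,\mathrm{sgn}(k)\alpha\frac\pi2}S_k^\alpha(s).$$ If $\alpha\in(1,2)$, then $$\partial_x\mathcal D^{\alpha-1}[\lambda_k](\cot(s))=e^{-i\,\mathrm{sgn}(k)\alpha\frac\pi2}S_k^\alpha(s),\qquad \partial_x\overline{\mathcal D^{\alpha-1}}[\lambda_k](\cot(s))=e^{i\,\mathrm{sgn}(k)\alpha\frac\pi2}S_k^\alpha(s).$$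
   Context: For $k\in\mathbb Z$, the complex Higgins functions are $\lambda_k(x)=\left(\frac{ix-1}{ix+1}\right)^k=\frac{(x+i)^{2k}}{(1+x^2)^k}$, $x\in\mathbb R$. For $\beta\in(0,1)$, $$\mathcal D^{\beta}[u](x)=\frac{1}{\Gamma(1-\beta)}\int_0^\infty\frac{u'(x-z)}{z^\beta}\,dz,\qquad \overline{\mathcal D^{\beta}}[u](x)=\frac{1}{\Gamma(1-\beta)}\int_0^\infty\frac{u'(x+z)}{z^\beta}\,dz$$ (the bar is part of the name of the operator, not complex conjugation). For $\alpha\in(1,2)$, $\partial_x\mathcal D^{\alpha-1}[u]$ and $\partial_x\overline{\mathcal D^{\alpha-1}}[u]$ denote the $x$-derivatives of $\mathcal D^{\alpha-1}[u]$ and $\overline{\mathcal D^{\alpha-1}}[u]$. For each of these operators $T$, the notation $T[u](\cot(s))$ means $T[u](x)$ evaluated at $x=\cot(s)$. $c_\alpha=\alpha\frac{2^{\alpha-1}\Gamma(\frac12+\frac\alpha2)}{\sqrt\pi\,\Gamma(1-\frac\alpha2)}$, and $\mathrm{sgn}$ is the sign function. *)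

(* Defs.v *)
From Stdlib Require Import Reals ZArith Lra Lia.
From Coquelicot Require Import Coquelicot.

Open Scope R_scope.

(** * Gamma function on the reals *)

Definition Gamma_integral (x : R) : R :=
  RInt_gen (fun t => Rpower t (x - 1) * exp (- t))
           (at_right 0) (Rbar_locally p_infty).

(** [rising x n = x (x + 1) ... (x + n - 1)] *)
Fixpoint rising (x : R) (n : nat) : R :=
  match n with
  | O => 1
  | S m => rising x m * (x + INR m)
  end.

(** Euler's integral for [x > 0], continued to negative non-integer [x] by
    [Gamma x = Gamma (x + n) / (x (x + 1) ... (x + n - 1))], where [n] is the
    least natural number with [x + n > 0].  The values at the poles
    [0, -1, -2, ...] are meaningless. *)
Definition Gamma (x : R) : R :=
  let n := Z.to_nat (up (- x)) in
  Gamma_integral (x + INR n) / rising x n.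

Lemma Gamma_pos (x : R) : 0 < x -> Gamma x = Gamma_integral x.
Proof.
intros Hx; unfold Gamma.
assert (H : (up (- x) <= 0)%Z).
{ destruct (archimed (- x)) as [_ H].
  assert (H1 : IZR (up (- x)) < IZR 1) by (simpl; lra).
  apply lt_IZR in H1; lia. }
replace (Z.to_nat (up (- x))) with 0%nat by lia.
simpl; rewrite Rplus_0_r; field.
Qed.

(** * Complex-valued functions of a real variable *)

Definition expi (t : R) : C := (cos t, sin t).

Definition Cpowz (z : C) (k : Z) : C :=
  match k with
  | Z0 => RtoC 1
  | Zpos p => Cpow z (Pos.to_nat p)
  | Zneg p => Cinv (Cpow z (Pos.to_nat p))
  end.

Definition RC_derive (u : R -> C) (x : R) : C :=
  (Derive (fun t => Re (u t)) x, Derive (fun t => Im (u t)) x).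

Lemma is_RC_derive_unique (u : R -> C) (x : R) (l : C) :
  is_derive (K := R_AbsRing) (V := C_R_NormedModule) u x l -> RC_derive u x = l.
Proof.
intros H; unfold RC_derive, Re, Im.
rewrite (surjective_pairing l); f_equal; apply is_derive_unique.
- exact (filterdiff_comp (K := R_AbsRing) (V := C_R_NormedModule)
           u fst (fun y => scal y l) fst H
           (filterdiff_linear _ is_linear_fst)).
- exact (filterdiff_comp (K := R_AbsRing) (V := C_R_NormedModule)
           u snd (fun y => scal y l) snd H
           (filterdiff_linear _ is_linear_snd)).
Qed.

(** Series indexed by [Z]: both one-sided series [l >= 0] and [l < 0] are
    required to converge. *)
Definition ex_Zseries (a : Z -> C) : Prop :=
  ex_series (K := R_AbsRing) (V := C_R_NormedModule)
    (fun n => a (Z.of_nat n)) /\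
  ex_series (K := R_AbsRing) (V := C_R_NormedModule)
    (fun n => a (- Z.of_nat (S n))%Z).

Definition CSeries (a : nat -> C) : C :=
  (Series (fun n => Re (a n)), Series (fun n => Im (a n))).

Definition Zseries (a : Z -> C) : C :=
  Cplus (CSeries (fun n => a (Z.of_nat n)))
        (CSeries (fun n => a (- Z.of_nat (S n))%Z)).

(** * Higgins functions and fractional derivatives *)

Definition higgins (k : Z) (x : R) : C :=
  Cpowz ((Ci * RtoC x - RtoC 1) / (Ci * RtoC x + RtoC 1))%C k.

Definition Dfrac_integrand (beta : R) (u : R -> C) (x z : R) : C :=
  (RC_derive u (x - z)%R / RtoC (Rpower z beta))%C.

Definition Dfrac_bar_integrand (beta : R) (u : R -> C) (x z : R) : C :=
  (RC_derive u (x + z)%R / RtoC (Rpower z beta))%C.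

(** Convergence of the improper integrals over [(0, oo)] defining the two
    operators; [RInt_gen] is a total function with unspecified value when the
    integral diverges. *)
Definition ex_Dfrac (beta : R) (u : R -> C) (x : R) : Prop :=
  ex_RInt_gen (V := C_R_NormedModule) (Dfrac_integrand beta u x)
    (at_right 0) (Rbar_locally p_infty).

Definition ex_Dfrac_bar (beta : R) (u : R -> C) (x : R) : Prop :=
  ex_RInt_gen (V := C_R_NormedModule) (Dfrac_bar_integrand beta u x)
    (at_right 0) (Rbar_locally p_infty).

Definition Dfrac (beta : R) (u : R -> C) (x : R) : C :=
  (RtoC (/ Gamma (1 - beta)) *
   RInt_gen (V := C_R_CompleteNormedModule) (Dfrac_integrand beta u x)
     (at_right 0) (Rbar_locally p_infty))%C.

Definition Dfrac_bar (beta : R) (u : R -> C) (x : R) : C :=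
  (RtoC (/ Gamma (1 - beta)) *
   RInt_gen (V := C_R_CompleteNormedModule) (Dfrac_bar_integrand beta u x)
     (at_right 0) (Rbar_locally p_infty))%C.

(** * The series [S_k^alpha(s)] *)

Definition c_const (alpha : R) : R :=
  alpha * (Rpower 2 (alpha - 1) * Gamma (1 / 2 + alpha / 2) /
           (sqrt PI * Gamma (1 - alpha / 2))).

Definition S_term (alpha : R) (k : Z) (s : R) (l : Z) : C :=
  (expi (2 * IZR l * s) *
   RtoC (((1 - alpha) * IZR k ^ 2 - 2 * IZR k * IZR l) *
         ((Gamma ((-1 + alpha) / 2 + Rabs (IZR l)) *
           Gamma ((-1 - alpha) / 2 + Rabs (IZR (k - l)))) /
          (Gamma ((3 - alpha) / 2 + Rabs (IZR l)) *
           Gamma ((3 + alpha) / 2 + Rabs (IZR (k - l)))))))%C.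

Definition S_sum (alpha : R) (k : Z) (s : R) : C :=
  (RtoC (c_const alpha * Rpower (sin s) (alpha - 1) /
         (2 * tan (alpha * (PI / 2)))) *
   Zseries (S_term alpha k s))%C.

Definition cot (s : R) : R := cos s / sin s.

(* Main.v *)
Require Import Defs.
From Stdlib Require Import Reals ZArith Lra Lia.
From Coquelicot Require Import Coquelicot.

Open Scope R_scope.

(** Put w = i - x.  Then lambda_k(x) = (1 - 2i/w)^k, so for k > 0 the function
    lambda_k is a polynomial in 1/w, and its fractional derivative reduces to
    the integrals of z^(-b) (z + w)^(-n-1) over the half line.  Integration by
    parts in z expresses them through the one with n = 0
    ([resolvent_integral_closed]).  That one solves, as a function of x, the
    same linear differential equation as w^(-b), and its behaviour as x tends
    to minus infinity gives the constant, the real Beta integral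
    B(b, 1 - b) = Gamma(b) Gamma(1 - b) ([resolvent_integral_upper],
    [beta_integral_Gamma]).  Hence, with C(k,j) binomial coefficients and (b)_j
    rising factorials,

      D^b[lambda_k](x) = Gamma(b) w^(-b) sum_j C(k,j) (b)_j / (j-1)! (-2i/w)^j.

    Differentiating the right-hand side in x replaces b by b + 1
    ([is_derive_Dfrac_closed]), which is why both ranges of alpha obey one
    formula.  At x = cot s one has -2i/w = e^(2is) - 1 and
    w^(-b) = sin^b(s) e^(-ib(pi - s)).

    For the series, put y_l = (alpha - 1)/2 - l.  The quotient
    Gamma(a + n) / Gamma(1 - a + n) is an even function of the integer n, which
    removes the absolute values and makes the coefficients a rational function
    of l.  The Chu-Vandermonde identity expands this function over the
    functions 1/(y_l)_(j+2), with the coefficients C(k,j) j (j+1) (alpha)_j up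
    to sign ([S_coef_binomial]).  It remains to sum e^(2ils)/(y_l)_m over l.
    These sums satisfy a two-term recurrence in m and, after a modulation, the
    equation U' = (m - 1) cot(s) U on (0, pi); so they are multiples of
    e^(i(alpha - 1)s) (1 - e^(2is))^(m-1), and the constant is read off from the
    mean value over a period ([wave_constant], [fourier_sum_closed]).  The
    factor j (j+1)/(j+1)! = 1/(j-1)! restores the sum above.

    The two constants agree by the duplication and reflection formulas for
    Gamma.  Duplication follows from Gamma(n + x) ~ n^x Gamma(n), itself a
    consequence of the arithmetic-geometric mean inequality.  Reflection
    follows from the complex integral at w = i, whose imaginary part gives
    B(b) sin(pi b) the same value at b and at (1 + b)/2, hence its limit pi at
    b = 1.

    Negative k and the operator with the bar are obtained by complex
    conjugation and by x -> -x, both of which exchange lambda_k and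
    lambda_(-k). *)

(** * Improper integrals over the half line *)

Definition integral {V : NormedModule R_AbsRing} (f : R -> V) (l : V) : Prop :=
  is_RInt_gen f (at_right 0) (Rbar_locally p_infty) l.

Notation CR := C_R_NormedModule (only parsing).
Notation Rintegral := (integral (V := R_NormedModule)) (only parsing).
Notation Cintegral := (integral (V := C_R_NormedModule)) (only parsing).
Notation is_Cderive := (is_derive (K := R_AbsRing) (V := C_R_NormedModule)) (only parsing).
Notation is_Cseries := (is_series (K := R_AbsRing) (V := C_R_NormedModule)) (only parsing).

Notation ends := (filter_prod (at_right 0) (Rbar_locally p_infty)) (only parsing).

Lemma ends_ordered : ends (fun ab => 0 < fst ab < snd ab).
Proof.
exists (fun a => 0 < a < 1) (fun b => 1 < b).
- exists (mkposreal 1 Rlt_0_1); intros y Hy Hy0; split; [exact Hy0|].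
  change (Rabs (y - 0) < 1) in Hy; apply Rabs_def2 in Hy; lra.
- exists 1; auto.
- simpl; intros x y ? ?; lra.
Qed.

Lemma ends_pos (Q : R -> Prop) :
  (forall z, 0 < z -> Q z) ->
  ends (fun ab => forall x, Rmin (fst ab) (snd ab) <= x <= Rmax (fst ab) (snd ab) -> Q x).
Proof.
intros HQ; generalize ends_ordered; apply filter_imp.
intros [a b]; simpl; intros Hab x; rewrite Rmin_left, Rmax_right by lra.
intros Hx; apply HQ; lra.
Qed.

Lemma at_right_pos : at_right 0 (fun z => 0 < z).
Proof. exists (mkposreal 1 Rlt_0_1); auto. Qed.

Lemma integral_unique {V : CompleteNormedModule R_AbsRing} (f : R -> V) l l' :
  integral f l -> integral f l' -> l = l'.
Proof.
intros H H'.
rewrite <- (is_RInt_gen_unique f l H); exact (is_RInt_gen_unique f l' H').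
Qed.

Lemma integral_plus {V : NormedModule R_AbsRing} (f g : R -> V) lf lg :
  integral f lf -> integral g lg -> integral (fun z => plus (f z) (g z)) (plus lf lg).
Proof. exact (is_RInt_gen_plus f g lf lg). Qed.

Lemma integral_minus {V : NormedModule R_AbsRing} (f g : R -> V) lf lg :
  integral f lf -> integral g lg -> integral (fun z => minus (f z) (g z)) (minus lf lg).
Proof. exact (is_RInt_gen_minus f g lf lg). Qed.

Lemma integral_scal {V : NormedModule R_AbsRing} (f : R -> V) (c : R) l :
  integral f l -> integral (fun z => scal c (f z)) (scal c l).
Proof. exact (is_RInt_gen_scal f c l). Qed.

Lemma integral_ext {V : NormedModule R_AbsRing} (f g : R -> V) l :
  (forall z, 0 < z -> f z = g z) -> integral f l -> integral g l.
Proof.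
intros Hfg; apply is_RInt_gen_ext.
generalize ends_ordered; apply filter_imp.
intros [a b]; simpl; intros Hab x; rewrite Rmin_left, Rmax_right by lra.
intros Hx; apply Hfg; lra.
Qed.

Lemma integral_FTC {V : CompleteNormedModule R_AbsRing} (F f : R -> V) A B :
  (forall z, 0 < z -> is_derive F z (f z)) ->
  (forall z, 0 < z -> continuous f z) ->
  filterlim F (at_right 0) (locally A) ->
  filterlim F (Rbar_locally p_infty) (locally B) ->
  integral f (minus B A).
Proof.
intros HF Hf HA HB P HP.
assert (HL : filterlim (fun ab : R * R => minus (F (snd ab)) (F (fst ab))) ends
               (locally (minus B A))).
{ unfold minus.
  apply (filterlim_comp_2 (G := locally B) (H := locally (opp A))
           (fun ab : R * R => F (snd ab)) (fun ab : R * R => opp (F (fst ab))) plus).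
  - exact (filterlim_comp _ _ _ _ _ _ _ _ filterlim_snd HB).
  - apply (filterlim_comp _ _ _ (fun ab : R * R => F (fst ab)) opp _ (locally A)).
    + exact (filterlim_comp _ _ _ _ _ _ _ _ filterlim_fst HA).
    + apply (filterlim_opp (K := R_AbsRing) A).
  - exact (filterlim_plus (K := R_AbsRing) (V := V) B (opp A)). }
assert (HL' : ends (fun ab => P (minus (F (snd ab)) (F (fst ab))))) by exact (HL P HP).
generalize (filter_and _ _ HL' (ends_pos _ (fun z Hz => conj (HF z Hz) (Hf z Hz)))).
unfold filtermapi; apply filter_imp.
intros [a b]; simpl; intros [H1 H2].
exists (minus (F b) (F a)); split; [|exact H1].
apply is_RInt_derive; intros x Hx; apply (H2 x Hx).
Qed.

Lemma integral_comp {V : CompleteNormedModule R_AbsRing} (f : R -> V) l (phi dphi : R -> R) :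
  (forall z, 0 < z -> continuous f z) ->
  (forall z, 0 < z -> 0 < phi z) ->
  (forall z, 0 < z -> is_derive phi z (dphi z)) ->
  (forall z, 0 < z -> continuous dphi z) ->
  filterlim phi (at_right 0) (at_right 0) ->
  filterlim phi (Rbar_locally p_infty) (Rbar_locally p_infty) ->
  integral f l -> integral (fun z => scal (dphi z) (f (phi z))) l.
Proof.
intros Hf Hpos Hd Hc H0 H1 HI P HP.
specialize (HI P HP).
assert (HJ : ends (fun ab => exists y, is_RInt f (phi (fst ab)) (phi (snd ab)) y /\ P y)).
{ destruct HI as [Q S HQ HS HQS].
  exists (fun a => Q (phi a)) (fun b => S (phi b)).
  - apply H0, HQ.
  - apply H1, HS.
  - intros a b Ha Hb; exact (HQS _ _ Ha Hb). }
generalize (filter_and _ _ HJ (ends_pos _ (fun z Hz =>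
  conj (Hf _ (Hpos z Hz)) (conj (Hd z Hz) (Hc z Hz))))).
unfold filtermapi; apply filter_imp.
intros [a b]; simpl; intros [[y [Hy HPy]] H2].
exists y; split; [|exact HPy].
rewrite <- (is_RInt_unique _ _ _ _ Hy).
apply is_RInt_comp; intros x Hx; apply (H2 x Hx).
Qed.

Lemma integral_norm_le {V : CompleteNormedModule R_AbsRing} (f : R -> V) (g : R -> R) lf lg :
  (forall z, 0 < z -> norm (f z) <= g z) ->
  integral f lf -> Rintegral g lg -> norm lf <= lg.
Proof.
intros H; apply RInt_gen_norm.
- generalize ends_ordered; apply filter_imp; intros; lra.
- generalize ends_ordered; apply filter_imp; intros [a b]; simpl; intros Hab x Hx.
  apply H; lra.
Qed.

Lemma integral_le (f g : R -> R) lf lg :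
  (forall z, 0 < z -> f z <= g z) ->
  Rintegral f lf -> Rintegral g lg -> lf <= lg.
Proof.
intros H Hf Hg.
pose proof (integral_minus (V := R_NormedModule) _ _ _ _ Hg Hf) as Hm.
apply Rminus_le_0; fold (minus (G := R_AbelianGroup) lg lf).
apply Rle_trans with (norm (minus (G := R_AbelianGroup) lg lf)); [apply (norm_ge_0 (K := R_AbsRing) (V := R_NormedModule))|].
apply (integral_norm_le (V := R_CompleteNormedModule) _
         (fun y => minus (G := R_AbelianGroup) (g y) (f y)) _ _) with (2 := Hm) (3 := Hm).
intros z Hz; specialize (H z Hz).
unfold norm, minus, plus, opp; simpl; unfold abs; simpl.
rewrite Rabs_pos_eq; lra.
Qed.

Lemma minus_plus_middle {G : AbelianGroup} (y1 y2 u : G) :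
  minus (plus (plus y1 u) y2) u = plus y1 y2.
Proof.
unfold minus.
rewrite <- (plus_assoc y1), (plus_comm u), plus_assoc, <- (plus_assoc _ u), plus_opp_r.
apply plus_zero_r.
Qed.

(** Cauchy criterion: moving the end points changes the integral of f by two
    pieces near 0 and near infinity, each bounded by the difference of two
    integrals of g that are close to its limit. *)
Lemma integral_dominated {V : CompleteNormedModule R_AbsRing} (f : R -> V) (g : R -> R) lg :
  (forall z, 0 < z -> continuous f z) ->
  (forall z, 0 < z -> norm (f z) <= g z) ->
  Rintegral g lg -> exists lf, integral f lf.
Proof.
intros Hf Hfg Hg.
assert (Hex : forall a b, 0 < a -> 0 < b -> ex_RInt f a b).
{ intros a b Ha Hb; apply ex_RInt_continuous; intros z Hz; apply Hf.
  apply Rlt_le_trans with (Rmin a b); [apply Rmin_glb_lt; assumption|apply Hz]. }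
apply (filterlimi_locally_cauchy (U := V)
         (fun ab : R * R => is_RInt f (fst ab) (snd ab))).
{ generalize ends_ordered; apply filter_imp; intros [a b]; simpl; intros Hab; split.
  - apply Hex; lra.
  - intros y1 y2 H1 H2.
    rewrite <- (is_RInt_unique _ _ _ _ H1); exact (is_RInt_unique _ _ _ _ H2). }
intros eps.
assert (He : 0 < eps / 4) by (destruct eps; simpl; lra).
assert (Hball : ends (fun ab => exists y, is_RInt (V := R_NormedModule) g (fst ab) (snd ab) y /\ ball lg (eps / 4) y)).
{ apply (Hg (fun y => ball lg (eps / 4) y)); exists (mkposreal _ He); auto. }
destruct (filter_and _ _ Hball ends_ordered) as [Q S HQ HS HQS]; simpl in HQS.
exists (fun ab => Q (fst ab) /\ S (snd ab)); split; [exists Q S; auto|].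
(* The two pieces, near 0 and then near infinity. *)
assert (Hdiff : forall a a' b b' (y : V), Q a -> Q a' -> S b -> S b' -> a' <= a ->
  is_RInt f a' a y -> norm y < eps / 2).
{ intros a a' b b' y Qa Qa' Sb Sb' Haa Hy.
  destruct (HQS a b Qa Sb) as [[u [Hu1 Hu2]] Hab].
  destruct (HQS a' b Qa' Sb) as [[v [Hv1 Hv2]] Hab'].
  pose proof (is_RInt_Chasles _ _ _ _ _ _ Hv1 (is_RInt_swap _ _ _ _ Hu1)) as Hgi.
  apply Rle_lt_trans with (plus v (opp u)).
  - apply (norm_RInt_le f g a' a); auto.
    intros x Hx; apply Hfg; lra.
  - change (Rabs (u - lg) < eps / 4) in Hu2. change (Rabs (v - lg) < eps / 4) in Hv2.
    apply Rabs_def2 in Hu2; apply Rabs_def2 in Hv2.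
    change (v + - u < eps / 2); lra. }
assert (Hdiff2 : forall a a' b b' (y : V), Q a -> Q a' -> S b -> S b' -> b <= b' ->
  is_RInt f b b' y -> norm y < eps / 2).
{ intros a a' b b' y Qa Qa' Sb Sb' Haa Hy.
  destruct (HQS a b Qa Sb) as [[u [Hu1 Hu2]] Hab].
  destruct (HQS a b' Qa Sb') as [[v [Hv1 Hv2]] Hab'].
  pose proof (is_RInt_Chasles _ _ _ _ _ _ (is_RInt_swap _ _ _ _ Hu1) Hv1) as Hgi.
  apply Rle_lt_trans with (plus (opp u) v).
  - apply (norm_RInt_le f g b b'); auto.
    intros x Hx; apply Hfg; lra.
  - change (Rabs (u - lg) < eps / 4) in Hu2. change (Rabs (v - lg) < eps / 4) in Hv2.
    apply Rabs_def2 in Hu2; apply Rabs_def2 in Hv2.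
    change (- u + v < eps / 2); lra. }
intros [a b] [a' b']; simpl; intros [Qa Sb] [Qa' Sb'] u v Hu Hv.
destruct (HQS a b Qa Sb) as [_ Hab]; destruct (HQS a' b' Qa' Sb') as [_ Hab'].
assert (Hl : exists y, is_RInt f a' a y /\ norm y < eps / 2).
{ destruct (Hex a' a) as [y Hy]; try lra; exists y; split; auto.
  destruct (Rle_dec a' a).
  - apply (Hdiff a a' b b'); auto.
  - rewrite <- norm_opp; apply (Hdiff a' a b b'); auto; [lra|].
    apply is_RInt_swap; auto. }
assert (Hr : exists y, is_RInt f b b' y /\ norm y < eps / 2).
{ destruct (Hex b b') as [y Hy]; try lra; exists y; split; auto.
  destruct (Rle_dec b b').
  - apply (Hdiff2 a a' b b'); auto.
  - rewrite <- norm_opp; apply (Hdiff2 a a' b' b); auto; [lra|].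
    apply is_RInt_swap; auto. }
destruct Hl as [y1 [Hy1 N1]]; destruct Hr as [y2 [Hy2 N2]].
apply (norm_compat1 (K := R_AbsRing) (V := V) u v eps).
assert (E : v = plus (plus y1 u) y2).
{ rewrite <- (is_RInt_unique _ _ _ _ Hv).
  apply (is_RInt_unique (V := V)).
  apply is_RInt_Chasles with b; auto. apply is_RInt_Chasles with a; auto. }
rewrite E.
apply Rle_lt_trans with (norm (plus y1 y2)).
- apply Req_le, (f_equal (norm (K := R_AbsRing) (V := V))), (minus_plus_middle (G := V)).
- apply Rle_lt_trans with (1 := norm_triangle y1 y2); lra.
Qed.

Lemma real_integral_FTC (F f : R -> R) (A B l : R) :
  l = B - A ->
  (forall z, 0 < z -> is_derive F z (f z)) ->
  (forall z, 0 < z -> continuous f z) ->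
  filterlim F (at_right 0) (locally A) ->
  filterlim F (Rbar_locally p_infty) (locally B) ->
  Rintegral f l.
Proof. intros ->; apply (integral_FTC (V := R_CompleteNormedModule)). Qed.

Lemma integral_scale {V : CompleteNormedModule R_AbsRing} (f : R -> V) l (c : R) :
  0 < c -> (forall z, 0 < z -> continuous f z) ->
  integral f l -> integral (fun z => scal c (f (c * z))) l.
Proof.
intros Hc Hf; apply (integral_comp f l (fun t => c * t) (fun _ => c)).
- exact Hf.
- intros t Ht; nra.
- intros t Ht; auto_derive; [auto|ring].
- intros t Ht; apply continuous_const.
- intros P [d Hd]. assert (Hdc : 0 < d / c) by (apply Rdiv_lt_0_compat; [destruct d|]; auto).
  exists (mkposreal _ Hdc); intros t Ht Ht0.
  change (Rabs (t - 0) < d / c) in Ht; apply Rabs_def2 in Ht.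
  apply Hd; [|nra]. change (Rabs (c * t - 0) < d).
  rewrite Rminus_0_r, Rabs_pos_eq by nra.
  destruct Ht as [Ht _]; rewrite Rminus_0_r in Ht; apply Rlt_div_r in Ht; lra.
- intros P [M HM]; exists (M / c); intros t Ht; apply HM.
  apply Rlt_div_l in Ht; lra.
Qed.
(** * Real powers and Euler's integral *)

Lemma exp_monotone (x y : R) : x <= y -> exp x <= exp y.
Proof. intros [H | ->]; [apply Rlt_le, exp_increasing, H | apply Rle_refl]. Qed.

Lemma Rpower_pred (t x : R) : 0 < t -> Rpower t (x - 1) = Rpower t x / t.
Proof.
intros Ht; unfold Rminus; rewrite Rpower_plus, Rpower_Ropp, Rpower_1 by assumption; reflexivity.
Qed.

Lemma Rpower_succ (t x : R) : 0 < t -> Rpower t (x + 1) = t * Rpower t x.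
Proof. intros Ht; rewrite Rpower_plus, Rpower_1 by assumption; ring. Qed.

Lemma Rpower_pos (t x : R) : 0 < Rpower t x.
Proof. apply exp_pos. Qed.

Lemma continuous_of_ex_derive (f : R -> R) (t : R) : ex_derive f t -> continuous f t.
Proof. apply (ex_derive_continuous (K := R_AbsRing) (V := R_NormedModule)). Qed.

Ltac real_continuous := apply continuous_of_ex_derive; unfold Rpower; auto_derive.

Lemma Rpower_1_base (x : R) : Rpower 1 x = 1.
Proof. unfold Rpower; rewrite ln_1, Rmult_0_r; apply exp_0. Qed.

Lemma Rinv_le_1 (x : R) : 1 <= x -> 0 < / x <= 1.
Proof.
intros Hx; split; [apply Rinv_0_lt_compat; lra|].
rewrite <- Rinv_1; apply Rinv_le_contravar; lra.
Qed.

Lemma is_derive_Rpower (t x : R) : 0 < t -> is_derive (fun t => Rpower t x) t (x * Rpower t (x - 1)).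
Proof.
intros Ht; rewrite Rpower_pred by assumption; unfold Rpower.
auto_derive; [assumption | field; lra].
Qed.

Lemma continuous_Rpower (t x : R) : 0 < t -> continuous (fun t => Rpower t x) t.
Proof.
intros Ht; apply (ex_derive_continuous (K := R_AbsRing) (V := R_NormedModule)).
eexists; apply is_derive_Rpower, Ht.
Qed.

Lemma Rpower_lim_0 (x : R) : 0 < x -> filterlim (fun t => Rpower t x) (at_right 0) (locally 0).
Proof.
intros Hx; apply filterlim_locally; intros eps.
assert (Hd : 0 < Rpower eps (/ x)) by apply Rpower_pos.
exists (mkposreal _ Hd); intros t Ht Ht0.
change (Rabs (t - 0) < Rpower eps (/ x)) in Ht; apply Rabs_def2 in Ht.
change (Rabs (Rpower t x - 0) < eps).
rewrite Rminus_0_r, Rabs_pos_eq by (apply Rlt_le, Rpower_pos).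
apply Rlt_le_trans with (Rpower (Rpower eps (/ x)) x).
- apply Rlt_Rpower_l; lra.
- rewrite Rpower_mult, Rinv_l, Rpower_1 by (destruct eps; simpl; lra); lra.
Qed.

Lemma filterlim_infty_bound (F : R -> R) (L C : R) :
  (forall t, 0 < t -> Rabs (F t - L) <= C / (1 + t)) ->
  filterlim F (Rbar_locally p_infty) (locally L).
Proof.
intros H; apply filterlim_locally; intros eps.
exists (Rmax 0 (C / eps)); intros t Ht.
assert (0 < eps) by (destruct eps; auto).
assert (Ht0 : 0 < t) by (eapply Rle_lt_trans; [apply Rmax_l|apply Ht]).
assert (Ht1 : C / eps < t) by (eapply Rle_lt_trans; [apply Rmax_r|apply Ht]).
change (Rabs (F t - L) < eps).
apply Rle_lt_trans with (1 := H t Ht0).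
apply Rlt_div_l; [lra|]. apply Rlt_div_l in Ht1; lra.
Qed.

Lemma filterlim_at_right_continuous (F : R -> R) (l : R) :
  F 0 = l -> continuous F 0 -> filterlim F (at_right 0) (locally l).
Proof.
intros <- HF P HP.
apply (filter_le_within (F := locally 0) (fun u => 0 < u) (fun t => P (F t)) (HF P HP)).
Qed.

Lemma Rpower_lim_infty (x : R) : 0 < x ->
  filterlim (fun t => Rpower (1 + t) (- x)) (Rbar_locally p_infty) (locally 0).
Proof.
intros Hx.
apply (filterlim_ext_loc (F := Rbar_locally p_infty) (fun t => Rpower (/ (1 + t)) x)).
+ exists 0; intros t Ht; unfold Rpower; f_equal; rewrite ln_Rinv by lra; ring.
+ apply (filterlim_comp _ _ _ (fun t => / (1 + t)) (fun u => Rpower u x) _ (at_right 0)); [|apply Rpower_lim_0, Hx].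
  intros P [d Hd]. exists (/ d); intros t Ht.
  assert (0 < / d) by (apply Rinv_0_lt_compat; destruct d; auto).
  assert (0 < / (1 + t)) by (apply Rinv_0_lt_compat; lra).
  apply Hd; [|assumption].
  change (Rabs (/ (1 + t) - 0) < d).
  rewrite Rminus_0_r, Rabs_pos_eq by lra.
  rewrite <- (Rinv_inv d); apply Rinv_lt_contravar; [|lra].
  apply Rmult_lt_0_compat; lra.
Qed.

(** The primitive is (t/(1+t))^x.  The integrand behaves like t^(x-1) at 0 and
    like t^(-2) at infinity, which makes it a convenient dominating function. *)
Lemma integral_Rpower_ratio (x : R) : 0 < x ->
  Rintegral (fun t => x * (Rpower t (x - 1) * Rpower (1 + t) (- x - 1))) 1.
Proof.
intros Hx.
apply (real_integral_FTC (fun t => Rpower t x * Rpower (1 + t) (- x)) _ 0 1); [ring | | | |].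
- intros t Ht; rewrite !Rpower_pred by lra; unfold Rpower.
  auto_derive; [lra|].
  unfold Rpower; field; lra.
- intros t Ht.
  real_continuous; lra.
- apply (filterlim_le_le (F := at_right 0) (fun _ => 0) _ (fun t => Rpower t x) 0).
  + generalize at_right_pos; apply filter_imp; intros t Ht; split.
    * apply Rlt_le, Rmult_lt_0_compat; apply Rpower_pos.
    * rewrite <- (Rmult_1_r (Rpower t x)) at 2; apply Rmult_le_compat_l; [apply Rlt_le, Rpower_pos|].
      apply Rle_trans with (Rpower (1 + t) 0); [apply Rle_Rpower; lra | rewrite Rpower_O; lra].
  + apply filterlim_const.
  + apply Rpower_lim_0, Hx.
- apply (filterlim_ext_loc (F := Rbar_locally p_infty) (fun t => Rpower (t / (1 + t)) x)).
  + exists 0; intros t Ht; rewrite Rpower_Ropp; unfold Rdiv.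
    rewrite <- Rpower_mult_distr, <- Rpower_Ropp by (try apply Rinv_0_lt_compat; lra).
    f_equal; unfold Rpower; f_equal; rewrite ln_Rinv by lra; ring.
  + apply (filterlim_comp _ _ _ (fun t => t / (1 + t)) (fun u => Rpower u x) _ (locally 1)).
    * apply filterlim_infty_bound with 1; intros t Ht.
      replace (t / (1 + t) - 1) with (- (1 / (1 + t))) by (field; lra).
      rewrite Rabs_Ropp, Rabs_pos_eq; [lra|]. apply Rlt_le, Rdiv_lt_0_compat; lra.
    * replace 1 with (Rpower 1 x) at 2 by (now rewrite Rpower_1_base).
      apply continuous_Rpower; lra.
Qed.

Lemma integral_Rpower_tail (x : R) : 0 < x ->
  Rintegral (fun t => x * Rpower (1 + t) (- x - 1)) 1.
Proof.
intros Hx.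
apply (real_integral_FTC (fun t => - Rpower (1 + t) (- x)) _ (-1) 0); [ring | | | |].
- intros t Ht; rewrite !Rpower_pred by lra; unfold Rpower.
  auto_derive; [lra|]. field; lra.
- intros t Ht.
  real_continuous; lra.
- apply filterlim_at_right_continuous.
  + rewrite Rplus_0_r, Rpower_1_base; reflexivity.
  + real_continuous; lra.
- replace 0 with (opp (G := R_AbelianGroup) 0) by (unfold opp; simpl; ring).
  apply (filterlim_comp _ _ _ (fun t => Rpower (1 + t) (- x)) (opp (G := R_AbelianGroup)) _ (locally 0));
    [apply Rpower_lim_infty, Hx | apply (filterlim_opp (K := R_AbsRing) (V := R_NormedModule))].
Qed.

(** This is ln u <= u - 1 at u = (1 + t)/p; the constant is the maximum of
    p ln(1 + t) - t, reached at u = 1. *)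
Lemma exp_dominates_Rpower (p t : R) : 0 < p -> 0 < t ->
  exp (- t) <= exp (p * ln p + 1 - p) * Rpower (1 + t) (- p).
Proof.
intros Hp Ht; unfold Rpower; rewrite <- exp_plus; apply exp_monotone.
assert (H : ln ((1 + t) / p) <= (1 + t) / p - 1).
{ assert (0 < (1 + t) / p) by (apply Rdiv_lt_0_compat; lra).
  pose proof (exp_ineq1_le (ln ((1 + t) / p))) as He; rewrite exp_ln in He; lra. }
unfold Rdiv in H at 1; rewrite ln_mult, ln_Rinv in H by (try apply Rinv_0_lt_compat; lra).
apply (Rmult_le_compat_l p) in H; [|lra].
replace (p * ((1 + t) / p - 1)) with (1 + t - p) in H by (field; lra).
lra.
Qed.

Lemma integral_Gamma (x : R) : 0 < x ->
  Rintegral (fun t => Rpower t (x - 1) * exp (- t)) (Gamma_integral x).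
Proof.
intros Hx.
apply (RInt_gen_correct (V := R_CompleteNormedModule)).
set (C := exp ((x + 1) * ln (x + 1) + 1 - (x + 1)) / x).
apply (integral_dominated (V := R_CompleteNormedModule) _
  (fun t => scal C (x * (Rpower t (x - 1) * Rpower (1 + t) (- x - 1)))) (scal C 1)).
- intros t Ht; real_continuous; lra.
- intros t Ht.
  change (Rabs (Rpower t (x - 1) * exp (- t)) <= C * (x * (Rpower t (x - 1) * Rpower (1 + t) (- x - 1)))).
  pose proof (Rpower_pos t (x - 1)).
  rewrite Rabs_pos_eq by (apply Rlt_le, Rmult_lt_0_compat; [apply Rpower_pos|apply exp_pos]).
  pose proof (exp_dominates_Rpower (x + 1) t ltac:(lra) Ht) as He.
  replace (- (x + 1)) with (- x - 1) in He by ring.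
  replace (C * (x * (Rpower t (x - 1) * Rpower (1 + t) (- x - 1)))) with
    (Rpower t (x - 1) * (C * x * Rpower (1 + t) (- x - 1))) by ring.
  apply Rmult_le_compat_l; [lra|].
  replace (C * x) with (exp ((x + 1) * ln (x + 1) + 1 - (x + 1))) by (unfold C; field; lra).
  exact He.
- apply (integral_scal (V := R_NormedModule)), integral_Rpower_ratio, Hx.
Qed.

Lemma integral_Gamma_scaled (x c : R) : 0 < x -> 0 < c ->
  Rintegral (fun t => Rpower t (x - 1) * exp (- (c * t)))
    (Rpower c (- x) * Gamma_integral x).
Proof.
intros Hx Hc.
apply integral_ext with (f := fun t => scal (Rpower c (- x)) (scal c (Rpower (c * t) (x - 1) * exp (- (c * t))))).
- intros t Ht; unfold scal; simpl; unfold mult; simpl.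
  rewrite <- Rpower_mult_distr by assumption.
  rewrite !(Rpower_pred c) by assumption. rewrite Rpower_Ropp.
  pose proof (Rpower_pos c x); field; lra.
- apply (integral_scal (V := R_NormedModule)).
  apply (integral_scale (V := R_CompleteNormedModule) (fun t => Rpower t (x - 1) * exp (- t)));
    [assumption | | apply integral_Gamma, Hx].
  intros t Ht; real_continuous; lra.
Qed.

Lemma Gamma_integral_succ (x : R) : 0 < x -> Gamma_integral (x + 1) = x * Gamma_integral x.
Proof.
intros Hx.
assert (H0 : Rintegral
   (fun t => Rpower t (x + 1 - 1) * exp (- t) - x * (Rpower t (x - 1) * exp (- t)))
   0).
{ apply (real_integral_FTC (fun t => - (Rpower t x * exp (- t))) _ 0 0); [ring | | | |].
  - intros t Ht; replace (x + 1 - 1) with x by ring; rewrite Rpower_pred by lra; unfold Rpower.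
    auto_derive; [lra|]. field; lra.
  - intros t Ht; real_continuous; lra.
  - apply (filterlim_le_le (F := at_right 0) (fun t => - Rpower t x) _ (fun t => 0) 0).
    + generalize at_right_pos; apply filter_imp; intros t Ht.
      pose proof (Rpower_pos t x); pose proof (exp_pos (- t)).
      assert (exp (- t) <= 1) by (rewrite <- exp_0; apply exp_monotone; lra).
      split; nra.
    + replace (Finite 0) with (Rbar_opp 0) by (simpl; f_equal; ring).
      apply (filterlim_comp _ _ _ (fun t => Rpower t x) Ropp _ (locally 0)).
      * apply Rpower_lim_0, Hx.
      * apply (filterlim_Rbar_opp 0).
    + apply filterlim_const.
  - apply filterlim_infty_bound with (exp ((x + 1) * ln (x + 1) + 1 - (x + 1))).
    intros t Ht; rewrite Rminus_0_r, Rabs_Ropp, Rabs_pos_eq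
      by (apply Rlt_le, Rmult_lt_0_compat; [apply Rpower_pos|apply exp_pos]).
    pose proof (exp_dominates_Rpower (x + 1) t ltac:(lra) Ht) as He.
    replace (- (x + 1)) with (- x - 1) in He by ring.
    rewrite Rpower_pred in He by lra.
    set (K := exp ((x + 1) * ln (x + 1) + 1 - (x + 1))) in *.
    assert (HK : 0 < K) by apply exp_pos.
    apply Rle_trans with (Rpower t x * (K * (Rpower (1 + t) (- x) / (1 + t)))).
    + apply Rmult_le_compat_l; [apply Rlt_le, Rpower_pos|exact He].
    + replace (Rpower t x * (K * (Rpower (1 + t) (- x) / (1 + t)))) with
        (K / (1 + t) * (Rpower t x * Rpower (1 + t) (- x))) by (field; lra).
      rewrite <- (Rmult_1_r (K / (1 + t))) at 2.
      apply Rmult_le_compat_l; [apply Rlt_le, Rdiv_lt_0_compat; lra|].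
      rewrite Rpower_Ropp; apply Rle_div_l; [apply Rpower_pos|].
      rewrite Rmult_1_l; apply Rle_Rpower_l; lra. }
assert (H1 := integral_minus (V := R_NormedModule) _ _ _ _ (integral_Gamma (x + 1) ltac:(lra))
  (integral_scal (V := R_NormedModule) _ x _ (integral_Gamma x Hx))).
pose proof (integral_unique (V := R_CompleteNormedModule) _ _ _ H1 H0) as H.
unfold minus, plus, opp, scal in H; simpl in H; unfold mult in H; simpl in H; lra.
Qed.

Lemma Gamma_integral_1 : Gamma_integral 1 = 1.
Proof.
apply (integral_unique (V := R_CompleteNormedModule) (fun t => Rpower t (1 - 1) * exp (- t)));
  [apply integral_Gamma; lra|].
apply integral_ext with (f := fun t => exp (- t)).
{ intros t Ht; replace (1 - 1) with 0 by ring; rewrite Rpower_O, Rmult_1_l by assumption; reflexivity. }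
apply (real_integral_FTC (fun t => - exp (- t)) _ (-1) 0); [ring | | | |].
- intros t Ht; auto_derive; [auto|ring].
- intros t Ht; real_continuous; auto.
- apply filterlim_at_right_continuous; [rewrite Ropp_0, exp_0; reflexivity|].
  real_continuous; auto.
- apply filterlim_infty_bound with 1; intros t Ht.
  rewrite Rminus_0_r, Rabs_Ropp, Rabs_pos_eq by apply Rlt_le, exp_pos.
  rewrite exp_Ropp; unfold Rdiv; rewrite Rmult_1_l.
  apply Rinv_le_contravar; [lra|]. pose proof (exp_ineq1_le t); lra.
Qed.

(** * Convexity, asymptotics and duplication of the Gamma function *)

(** The weighted arithmetic-geometric mean inequality
    t^x <= c^x (1 - x + x t/c), integrated against t^(p-1) e^(-t).  The scale c
    is free; c = p gives the sharp bounds below. *)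
Lemma Gamma_integral_convex (p x c : R) : 0 < p -> 0 <= x <= 1 -> 0 < c ->
  Gamma_integral (p + x) <=
  Rpower c x * ((1 - x) * Gamma_integral p + x * (Gamma_integral (p + 1) / c)).
Proof.
intros Hp Hx Hc.
apply (integral_le (fun t => Rpower t (p + x - 1) * exp (- t))
  (fun t => scal (Rpower c x) (plus (scal (1 - x) (Rpower t (p - 1) * exp (- t)))
       (scal (x / c) (Rpower t (p + 1 - 1) * exp (- t)))))).
- intros t Ht; unfold scal, plus; simpl; unfold mult; simpl.
  replace (p + x - 1) with ((p - 1) + x) by ring.
  replace (p + 1 - 1) with ((p - 1) + 1) by ring.
  rewrite !Rpower_plus, Rpower_1 by assumption.
  pose proof (Rpower_pos t (p - 1)); pose proof (exp_pos (- t)).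
  (* With m = 1 - x + x u, the tangent bound ln v <= v/m - 1 + ln m at v = u
     and v = 1, with weights x and 1 - x, has remainders that cancel. *)
  assert (H1 : Rpower t x <= Rpower c x * ((1 - x) + x / c * t)).
  { assert (Htc : 0 < t / c) by (apply Rdiv_lt_0_compat; lra).
    replace t with (c * (t / c)) at 1 by (field; lra).
    rewrite <- Rpower_mult_distr by lra.
    apply Rmult_le_compat_l; [apply Rlt_le, Rpower_pos|].
    replace (x / c * t) with (x * (t / c)) by (field; lra).
    set (u := t / c) in *.
    destruct (Req_dec x 0) as [->|Hx0]; [rewrite Rpower_O; lra|].
    destruct (Req_dec x 1) as [->|Hx1]; [rewrite Rpower_1; lra|].
    set (m := 1 - x + x * u).
    assert (Hm : 0 < m) by (unfold m; nra).
    unfold Rpower; rewrite <- (exp_ln m Hm); apply exp_monotone.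
    assert (L : forall v, 0 < v -> ln (v / m) <= v / m - 1).
    { intros v Hv; assert (0 < v / m) by (apply Rdiv_lt_0_compat; lra).
      pose proof (exp_ineq1_le (ln (v / m))) as He; rewrite exp_ln in He; lra. }
    pose proof (L u Htc) as L1; pose proof (L 1 Rlt_0_1) as L2.
    unfold Rdiv in L1 at 1, L2 at 1.
    rewrite ln_mult, ln_Rinv in L1, L2 by (try apply Rinv_0_lt_compat; lra).
    rewrite ln_1 in L2.
    assert (E : x * (u / m - 1) + (1 - x) * (1 / m - 1) = 0) by (unfold m; field; unfold m in Hm; lra).
    nra. }
  replace (Rpower c x * ((1 - x) * (Rpower t (p - 1) * exp (- t)) +
     x / c * (Rpower t (p - 1) * t * exp (- t)))) with
   ((Rpower t (p - 1) * exp (- t)) * (Rpower c x * ((1 - x) + x / c * t))) by (field; lra).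
  replace (Rpower t (p - 1) * Rpower t x * exp (- t)) with
   ((Rpower t (p - 1) * exp (- t)) * Rpower t x) by ring.
  apply Rmult_le_compat_l; [nra|exact H1].
- apply integral_Gamma; lra.
- replace (Rpower c x * ((1 - x) * Gamma_integral p + x * (Gamma_integral (p + 1) / c))) with
   (scal (Rpower c x) (plus (scal (1 - x) (Gamma_integral p)) (scal (x / c) (Gamma_integral (p + 1)))))
   by (unfold scal, plus; simpl; unfold mult; simpl; field; lra).
  apply (integral_scal (V := R_NormedModule)).
  apply (integral_plus (V := R_NormedModule)); apply (integral_scal (V := R_NormedModule));
    apply integral_Gamma; lra.
Qed.
(** For y <= 1, convexity between y and y + 1 bounds Gamma(1) = 1 by a positive
    multiple of Gamma(y); the recurrence does the rest. *)
Lemma Gamma_integral_positive (x : R) : 0 < x -> 0 < Gamma_integral x.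
Proof.
assert (Hsmall : forall y, 0 < y <= 1 -> 0 < Gamma_integral y).
{ intros y Hy.
  pose proof (Gamma_integral_convex y (1 - y) 1 ltac:(lra) ltac:(lra) Rlt_0_1) as H.
  replace (y + (1 - y)) with 1 in H by ring.
  rewrite Gamma_integral_1, Gamma_integral_succ in H by lra.
  pose proof (Rpower_pos 1 (1 - y)).
  apply Rnot_le_lt; intros Hn.
  replace ((1 - (1 - y)) * Gamma_integral y + (1 - y) * (y * Gamma_integral y / 1))
    with (Gamma_integral y * (y * (2 - y))) in H by field.
  assert (Gamma_integral y * (y * (2 - y)) <= 0) by (assert (0 < y * (2 - y)) by nra; nra).
  nra. }
assert (Hn : forall n y, 0 < y <= INR n + 1 -> 0 < Gamma_integral y).
{ induction n as [|n IH]; intros y Hy.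
  - apply Hsmall; simpl in Hy; lra.
  - rewrite S_INR in Hy. destruct (Rle_dec y (INR n + 1)) as [H|H]; [apply IH; lra|].
    pose proof (pos_INR n).
    replace y with ((y - 1) + 1) by ring; rewrite Gamma_integral_succ by lra.
    apply Rmult_lt_0_compat; [lra|apply IH; lra]. }
intros Hx; destruct (nfloor_ex x ltac:(lra)) as [n Hnx].
apply (Hn n); lra.
Qed.

Lemma Gamma_integral_upper (p x : R) : 0 < p -> 0 <= x <= 1 ->
  Gamma_integral (p + x) <= Rpower p x * Gamma_integral p.
Proof.
intros Hp Hx; pose proof (Gamma_integral_convex p x p Hp Hx Hp) as H.
rewrite Gamma_integral_succ in H by assumption.
replace ((1 - x) * Gamma_integral p + x * (p * Gamma_integral p / p)) with (Gamma_integral p)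
  in H by (field; lra).
exact H.
Qed.

Lemma Gamma_integral_lower (p x : R) : 0 < p -> 0 <= x <= 1 ->
  p * Gamma_integral p <= Rpower (p + x) (1 - x) * Gamma_integral (p + x).
Proof.
intros Hp Hx; pose proof (Gamma_integral_upper (p + x) (1 - x) ltac:(lra) ltac:(lra)) as H.
replace (p + x + (1 - x)) with (p + 1) in H by ring.
rewrite Gamma_integral_succ in H by assumption; exact H.
Qed.

Definition Gamma_ratio (N x : R) : R := Gamma_integral (N + x) / (Rpower N x * Gamma_integral N).

Lemma is_lim_seq_inv_succ : is_lim_seq (fun n => / INR (S n)) 0.
Proof.
apply (is_lim_seq_incr_1 (fun n => / INR n)).
replace (Finite 0) with (Rbar_inv p_infty) by reflexivity.
apply is_lim_seq_inv; [apply is_lim_seq_INR | discriminate].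
Qed.

Lemma Rpower_ratio_lim (x y : R) :
  is_lim_seq (fun n => Rpower (1 + x * / INR (S n)) y) 1.
Proof.
replace (Finite 1) with (Finite (Rpower 1 y)) by (now rewrite Rpower_1_base).
apply (is_lim_seq_continuous (fun u => Rpower u y) (fun n => 1 + x * / INR (S n)) 1).
- apply continuity_pt_filterlim, continuous_Rpower; lra.
- replace (Finite 1) with (Finite (1 + x * 0)) by (f_equal; ring).
  apply is_lim_seq_plus'; [apply is_lim_seq_const|].
  apply (is_lim_seq_scal_l _ x 0), is_lim_seq_inv_succ.
Qed.

(** Gamma(N + x) ~ N^x Gamma(N): the upper bound at x and the one at 1 - x
    squeeze the ratio between (1 + x/N)^(x-1) and 1. *)
Lemma Gamma_ratio_lim_unit (x : R) : 0 <= x <= 1 -> is_lim_seq (fun n => Gamma_ratio (INR (S n)) x) 1.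
Proof.
intros Hx.
apply is_lim_seq_le_le with (fun n => Rpower (1 + x * / INR (S n)) (x - 1)) (fun _ => 1).
- intros n; unfold Gamma_ratio.
  assert (HN : 0 < INR (S n)) by (apply lt_0_INR; lia).
  set (N := INR (S n)) in *.
  pose proof (Gamma_integral_positive N HN) as HG.
  pose proof (Gamma_integral_upper N x HN Hx) as HU.
  pose proof (Gamma_integral_lower N x HN Hx) as HL.
  pose proof (Rpower_pos N x) as HP.
  assert (0 < Rpower N x * Gamma_integral N) by nra.
  split.
  + apply Rle_div_r; [lra|].
    replace (1 + x * / N) with ((N + x) * / N) by (field; lra).
    rewrite <- Rpower_mult_distr by (try apply Rinv_0_lt_compat; lra).
    replace (Rpower (/ N) (x - 1)) with (N * / Rpower N x).
    2:{ rewrite Rpower_pred by (apply Rinv_0_lt_compat; lra).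
        rewrite <- (Rpower_Ropp N); unfold Rpower; rewrite ln_Rinv by lra.
        replace (x * - ln N) with (- x * ln N) by ring; field; lra. }
    replace (x - 1) with (- (1 - x)) by ring; rewrite Rpower_Ropp.
    replace (/ Rpower (N + x) (1 - x) * (N * / Rpower N x) * (Rpower N x * Gamma_integral N))
      with ((N * Gamma_integral N) / Rpower (N + x) (1 - x)) by (field; split; apply Rgt_not_eq, Rpower_pos).
    apply Rle_div_l; [apply Rpower_pos|]. rewrite (Rmult_comm (Gamma_integral (N + x))); exact HL.
  + apply Rle_div_l; lra.
- apply Rpower_ratio_lim.
- apply is_lim_seq_const.
Qed.

Lemma Gamma_ratio_lim (x : R) : 0 <= x <= 2 -> is_lim_seq (fun n => Gamma_ratio (INR (S n)) x) 1.
Proof.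
intros Hx; destruct (Rle_dec x 1) as [H|H]; [apply Gamma_ratio_lim_unit; lra|].
apply is_lim_seq_ext with (fun n => (1 + (x - 1) * / INR (S n)) * Gamma_ratio (INR (S n)) (x - 1)).
- intros n; unfold Gamma_ratio.
  assert (HN : 0 < INR (S n)) by (apply lt_0_INR; lia).
  set (N := INR (S n)) in *.
  replace (N + x) with (N + (x - 1) + 1) by ring.
  rewrite Gamma_integral_succ by lra.
  replace (Rpower N x) with (N * Rpower N (x - 1)) by (rewrite <- Rpower_succ by lra; f_equal; ring).
  pose proof (Gamma_integral_positive N HN); pose proof (Rpower_pos N (x - 1)).
  field; lra.
- replace (Finite 1) with (Finite ((1 + (x - 1) * 0) * 1)) by (f_equal; ring).
  apply is_lim_seq_mult'; [|apply Gamma_ratio_lim_unit; lra].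
  apply is_lim_seq_plus'; [apply is_lim_seq_const|].
  apply (is_lim_seq_scal_l _ (x - 1) 0), is_lim_seq_inv_succ.
Qed.

Definition duplication_quotient (x : R) : R :=
  Rpower 4 x * Gamma_integral x * Gamma_integral (x + / 2) / Gamma_integral (2 * x).

Lemma duplication_quotient_periodic (x : R) (n : nat) : 0 < x ->
  duplication_quotient (INR n + x) = duplication_quotient x.
Proof.
intros Hx; induction n as [|n IH]; [simpl; rewrite Rplus_0_l; reflexivity|].
rewrite <- IH, S_INR; pose proof (pos_INR n).
set (y := INR n + x); replace (INR n + 1 + x) with (y + 1) by (unfold y; ring).
assert (Hy : 0 < y) by (unfold y; lra).
unfold duplication_quotient.
replace (y + 1 + / 2) with (y + / 2 + 1) by ring.
replace (2 * (y + 1)) with (2 * y + 1 + 1) by ring.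
rewrite !Gamma_integral_succ, Rpower_succ by lra.
pose proof (Gamma_integral_positive (2 * y) ltac:(lra)).
field; lra.
Qed.

(** The quotient has period 1, so it may be evaluated along x + n; there the
    powers of N in the asymptotics cancel because 4^x N^x N^x = (2N)^(2x), and
    the limit does not depend on x. *)
Lemma duplication_quotient_constant (x : R) : 0 < x <= 1 ->
  duplication_quotient x = duplication_quotient 1.
Proof.
intros Hx.
assert (H : is_lim_seq (fun n => duplication_quotient x / duplication_quotient 1) 1).
{ apply is_lim_seq_ext with (fun n =>
    Gamma_ratio (INR (S n)) x * Gamma_ratio (INR (S n)) (x + / 2)
    / Gamma_ratio (INR (S n)) (/ 2) / Gamma_ratio (INR (S (2 * n + 1))) (2 * x)).
  - intros n.
    rewrite <- (duplication_quotient_periodic x (S n)), <- (duplication_quotient_periodic 1 n) by lra.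
    replace (INR n + 1) with (INR (S n)) by (rewrite S_INR; ring).
    replace (S (2 * n + 1)) with (2 * S n)%nat by lia.
    rewrite mult_INR; change (INR 2) with 2.
    assert (HN : 0 < INR (S n)) by (apply lt_0_INR; lia).
    set (N := INR (S n)) in *.
    unfold Gamma_ratio, duplication_quotient.
    replace (2 * (N + x)) with (2 * N + 2 * x) by ring.
    replace (N + x + / 2) with (N + (x + / 2)) by ring.
    replace (Rpower (2 * N) (2 * x)) with (Rpower 4 x * Rpower N x * Rpower N x).
    2:{ rewrite <- Rpower_mult_distr by lra.
        replace 4 with (2 * 2) by ring; rewrite <- (Rpower_mult_distr 2 2) by lra.
        replace (2 * x) with (x + x) by ring; rewrite !Rpower_plus; ring. }
    rewrite !Rpower_plus.
    pose proof (Rpower_pos N x); pose proof (Rpower_pos N (/ 2)); pose proof (Rpower_pos 4 x).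
    pose proof (Rpower_pos 4 N).
    pose proof (Gamma_integral_positive N ltac:(lra)).
    pose proof (Gamma_integral_positive (2 * N) ltac:(lra)).
    pose proof (Gamma_integral_positive (N + / 2) ltac:(lra)).
    pose proof (Gamma_integral_positive (2 * N + 2 * x) ltac:(lra)).
    field; repeat split; lra.
  - replace (Finite 1) with (Finite (1 * 1 / 1 / 1)) by (f_equal; field).
    assert (L : is_lim_seq (fun n => Gamma_ratio (INR (S (2 * n + 1))) (2 * x)) 1).
    { apply (is_lim_seq_subseq (fun n => Gamma_ratio (INR (S n)) (2 * x)) 1 (fun n => (2 * n + 1)%nat)).
      + apply eventually_subseq; intros n; lia.
      + apply Gamma_ratio_lim; lra. }
    assert (L1 := Gamma_ratio_lim x ltac:(lra)).
    assert (L2 := Gamma_ratio_lim (x + / 2) ltac:(lra)).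
    assert (L3 := Gamma_ratio_lim (/ 2) ltac:(lra)).
    apply (is_lim_seq_div' _ _ (1 * 1 / 1) 1); [|exact L|exact R1_neq_R0].
    apply (is_lim_seq_div' _ _ (1 * 1) 1); [|exact L3|exact R1_neq_R0].
    apply (is_lim_seq_mult' _ _ 1 1); assumption. }
pose proof (is_lim_seq_unique _ _ H) as E; rewrite Lim_seq_const in E.
injection E as E.
assert (H1 : 0 < duplication_quotient 1).
{ unfold duplication_quotient; apply Rdiv_lt_0_compat; [|apply Gamma_integral_positive; lra].
  pose proof (Rpower_pos 4 1); pose proof (Gamma_integral_positive 1 Rlt_0_1).
  pose proof (Gamma_integral_positive (1 + / 2) ltac:(lra)).
  repeat apply Rmult_lt_0_compat; lra. }
apply Rmult_eq_reg_r with (/ duplication_quotient 1); [|apply Rinv_neq_0_compat; lra].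
fold (Rdiv (duplication_quotient x) (duplication_quotient 1)); rewrite E; field; lra.
Qed.

Lemma Gamma_integral_duplication (x : R) : 0 < x <= 1 ->
  Rpower 4 x * Gamma_integral x * Gamma_integral (x + / 2) =
  2 * Gamma_integral (/ 2) * Gamma_integral (2 * x).
Proof.
intros Hx; pose proof (duplication_quotient_constant x Hx) as H.
unfold duplication_quotient in H.
pose proof (Gamma_integral_positive (2 * x) ltac:(lra)).
replace (2 * 1) with (1 + 1) in H by ring; replace (1 + / 2) with (/ 2 + 1) in H by ring.
rewrite !Gamma_integral_succ, Gamma_integral_1, Rpower_1 in H by lra.
apply Rmult_eq_reg_r with (/ Gamma_integral (2 * x)); [|apply Rinv_neq_0_compat; lra].
fold (Rdiv (Rpower 4 x * Gamma_integral x * Gamma_integral (x + / 2)) (Gamma_integral (2 * x))).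
rewrite H; field; lra.
Qed.
(** * Calculus of complex-valued functions *)

Ltac C_ring :=
  change (zero (G := CR)) with (RtoC 0); change (plus (G := CR)) with Cplus;
  change (minus (G := CR)) with Cminus;
  match goal with |- @eq _ ?a ?b => change (@eq C a b) end; ring.

Ltac C_components := apply injective_projections; simpl; ring.

(** [H] proves the goal for another form of the value in last position; what
    remains is the equality of the two values in C. *)
Ltac exact_up_to_value H :=
  match type of H with _ ?l =>
    match goal with |- ?Q ?r => refine (@eq_ind C l Q H r _) end
  end.

Lemma Ci_sqr : (Ci * Ci)%C = (- (1))%C.
Proof. C_components. Qed.

Lemma norm_Cmod (z : C) : norm (K := R_AbsRing) (V := CR) z = Cmod z.
Proof. symmetry; exact (Cmod_norm z). Qed.

Lemma is_derive_C_pair (f : R -> C) (x a b : R) :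
  is_derive (fun t => fst (f t)) x a -> is_derive (fun t => snd (f t)) x b ->
  is_Cderive f x (a, b).
Proof.
intros Ha Hb.
apply (is_derive_ext (V := CR) (fun t => (fst (f t), snd (f t)))).
{ intros t; symmetry; apply surjective_pairing. }
apply (filterdiff_ext_lin (K := R_AbsRing) (U := AbsRing_NormedModule R_AbsRing) (V := CR) _
  (fun y : R => (scal (V := R_NormedModule) y a, scal (V := R_NormedModule) y b))); [|reflexivity].
apply (filterdiff_comp_2 (K := R_AbsRing) (fun t => fst (f t)) (fun t => snd (f t))
        (fun u v => (u, v) : CR) _ _ (fun u v => (u, v)) Ha Hb).
apply (filterdiff_ext (K := R_AbsRing) (U := prod_NormedModule R_AbsRing R_NormedModule R_NormedModule) (V := CR) (fun t => t)).
{ intros t; apply surjective_pairing. }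
apply (filterdiff_ext_lin (K := R_AbsRing) (U := prod_NormedModule R_AbsRing R_NormedModule R_NormedModule) (V := CR) _ (fun t => t)).
{ apply filterdiff_id. }
intros t; apply surjective_pairing.
Qed.

Lemma is_derive_Re (f : R -> C) (x : R) (l : C) :
  is_Cderive f x l -> is_derive (fun t => fst (f t)) x (fst l).
Proof.
intros H.
exact (filterdiff_comp (K := R_AbsRing) (V := CR) f fst (fun y => scal y l) fst H
         (filterdiff_linear _ is_linear_fst)).
Qed.

Lemma is_derive_Im (f : R -> C) (x : R) (l : C) :
  is_Cderive f x l -> is_derive (fun t => snd (f t)) x (snd l).
Proof.
intros H.
exact (filterdiff_comp (K := R_AbsRing) (V := CR) f snd (fun y => scal y l) snd H
         (filterdiff_linear _ is_linear_snd)).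
Qed.

Lemma is_derive_Cmult (f g : R -> C) (x : R) (df dg : C) :
  is_Cderive f x df -> is_Cderive g x dg ->
  is_Cderive (fun t => f t * g t)%C x (df * g x + f x * dg)%C.
Proof.
intros Hf Hg.
pose proof (is_derive_Re _ _ _ Hf); pose proof (is_derive_Im _ _ _ Hf).
pose proof (is_derive_Re _ _ _ Hg); pose proof (is_derive_Im _ _ _ Hg).
destruct df as [f1 f2]; destruct dg as [g1 g2]; simpl in *.
unfold Cmult, Cplus; simpl.
apply is_derive_C_pair; simpl.
- replace (f1 * fst (g x) - f2 * snd (g x) + (fst (f x) * g1 - snd (f x) * g2))
   with ((f1 * fst (g x) + fst (f x) * g1) - (f2 * snd (g x) + snd (f x) * g2)) by ring.
  apply (is_derive_minus (V := R_NormedModule)); apply (is_derive_mult (K := R_AbsRing)); auto; intros; apply Rmult_comm.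
- replace (f1 * snd (g x) + f2 * fst (g x) + (fst (f x) * g2 + snd (f x) * g1))
   with ((f1 * snd (g x) + fst (f x) * g2) + (f2 * fst (g x) + snd (f x) * g1)) by ring.
  apply (is_derive_plus (V := R_NormedModule)); apply (is_derive_mult (K := R_AbsRing)); auto; intros; apply Rmult_comm.
Qed.

Lemma C_neq_0_sqr (z : C) : z <> 0%C -> fst z ^ 2 + snd z ^ 2 <> 0.
Proof.
intros Hz H; apply Hz; destruct z as [a b]; simpl in *.
assert (a = 0) by nra; assert (b = 0) by nra; subst; reflexivity.
Qed.

Lemma is_derive_sum_sqr (u v : R -> R) (x du dv : R) :
  is_derive u x du -> is_derive v x dv ->
  is_derive (fun t => u t ^ 2 + v t ^ 2) x (2 * du * u x + 2 * dv * v x).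
Proof.
intros H1 H2.
replace (2 * du * u x + 2 * dv * v x) with (INR 2 * du * u x ^ pred 2 + INR 2 * dv * v x ^ pred 2)
  by (simpl; ring).
apply (is_derive_plus (V := R_NormedModule)); apply is_derive_pow; assumption.
Qed.

Lemma is_derive_Cinv (f : R -> C) (x : R) (df : C) :
  is_Cderive f x df -> f x <> 0%C ->
  is_Cderive (fun t => / f t)%C x (- df / (f x * f x))%C.
Proof.
intros Hf Hx.
pose proof (is_derive_Re _ _ _ Hf) as H1; pose proof (is_derive_Im _ _ _ Hf) as H2.
pose proof (C_neq_0_sqr _ Hx) as Hn.
assert (Hn2 : fst (f x * f x)%C ^ 2 + snd (f x * f x)%C ^ 2 <> 0).
{ apply C_neq_0_sqr, Cmult_neq_0; assumption. }
assert (Hs : is_derive (fun t => fst (f t) ^ 2 + snd (f t) ^ 2) x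
   (2 * fst df * fst (f x) + 2 * snd df * snd (f x))).
{ exact (is_derive_sum_sqr _ _ _ _ _ H1 H2). }
destruct (f x) as [a b] eqn:Efx; destruct df as [f1 f2]; simpl in H1, H2, Hs, Hn, Hn2 |- *.
replace (- (f1, f2) / ((a, b) * (a, b)))%C with
  ((f1 * (a ^ 2 + b ^ 2) - a * (2 * f1 * a + 2 * f2 * b)) / (a ^ 2 + b ^ 2) ^ 2,
   - ((f2 * (a ^ 2 + b ^ 2) - b * (2 * f1 * a + 2 * f2 * b)) / (a ^ 2 + b ^ 2) ^ 2)).
2:{ unfold Cdiv, Cinv, Cmult, Copp; simpl; f_equal; field; rewrite !Rmult_1_r in Hn, Hn2; split; assumption. }
assert (Ea : fst (f x) = a) by (rewrite Efx; reflexivity).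
assert (Eb : snd (f x) = b) by (rewrite Efx; reflexivity).
apply is_derive_C_pair; simpl.
- pose proof (is_derive_div _ _ x _ _ H1 Hs) as H; simpl in H.
  rewrite Ea, Eb in H; apply H; exact Hn.
- apply (is_derive_ext (fun t => - (snd (f t) / (fst (f t) ^ 2 + snd (f t) ^ 2)))).
  { intros t; simpl; unfold Rdiv; ring. }
  apply (is_derive_opp (V := R_NormedModule)).
  pose proof (is_derive_div _ _ x _ _ H2 Hs) as H; simpl in H.
  rewrite Ea, Eb in H; apply H; exact Hn.
Qed.

Lemma is_Cderive_const (c : C) (x : R) : is_Cderive (fun _ => c) x (RtoC 0).
Proof. exact (is_derive_const (K := R_AbsRing) (V := CR) c x). Qed.

Lemma is_derive_Cpow (f : R -> C) (x : R) (df : C) (n : nat) :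
  is_Cderive f x df ->
  is_Cderive (fun t => Cpow (f t) n) x
    (RtoC (INR n) * Cpow (f x) (n - 1) * df)%C.
Proof.
intros Hf; induction n as [|n IH].
- simpl; replace (RtoC 0 * 1 * df)%C with (RtoC 0) by ring.
  apply is_Cderive_const.
- replace (RtoC (INR (S n)) * Cpow (f x) (S n - 1) * df)%C
    with (df * Cpow (f x) n + f x * (RtoC (INR n) * Cpow (f x) (n - 1) * df))%C.
  { exact (is_derive_Cmult _ _ _ _ _ Hf IH). }
  rewrite S_INR, RtoC_plus; replace (S n - 1)%nat with n by lia.
  destruct n as [|n]; [simpl; ring|].
  replace (S n - 1)%nat with n by lia; simpl Cpow; ring.
Qed.

Lemma is_derive_RtoC (f : R -> R) (x l : R) :
  is_derive f x l -> is_Cderive (fun t => RtoC (f t)) x (RtoC l).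
Proof.
intros H; apply is_derive_C_pair; simpl; [exact H|].
apply (is_derive_const (K := R_AbsRing) (V := R_NormedModule)).
Qed.

Lemma continuous_C_of_derive (f : R -> C) (x : R) (l : C) :
  is_Cderive f x l -> continuous (U := CR) f x.
Proof.
intros H; apply (ex_derive_continuous (K := R_AbsRing) (V := CR)); exists l; exact H.
Qed.

Lemma integral_map {V W : NormedModule R_AbsRing} (phi : V -> W) (f : R -> V) l :
  (forall a b y, is_RInt f a b y -> is_RInt (fun z => phi (f z)) a b (phi y)) ->
  continuous phi l -> integral f l -> integral (fun z => phi (f z)) (phi l).
Proof.
intros Hphi Hc H P HP.
specialize (H (fun y => P (phi y)) (Hc P HP)).
unfold filtermapi in *; revert H; apply filter_imp.
intros ab [y [Hy HPy]]; exists (phi y); auto.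
Qed.

Lemma is_RInt_C_pair (f : R -> C) a b l :
  is_RInt (V := R_NormedModule) (fun t => fst (f t)) a b (fst l) ->
  is_RInt (V := R_NormedModule) (fun t => snd (f t)) a b (snd l) ->
  is_RInt (V := CR) f a b l.
Proof.
intros H1 H2; rewrite (surjective_pairing l).
exact (is_RInt_fct_extend_pair (U := R_NormedModule) (V := R_NormedModule) f a b _ _ H1 H2).
Qed.

Lemma is_RInt_Re (f : R -> C) a b l :
  is_RInt (V := CR) f a b l -> is_RInt (V := R_NormedModule) (fun t => fst (f t)) a b (fst l).
Proof. exact (is_RInt_fct_extend_fst (U := R_NormedModule) (V := R_NormedModule) f a b l). Qed.

Lemma is_RInt_Im (f : R -> C) a b l :
  is_RInt (V := CR) f a b l -> is_RInt (V := R_NormedModule) (fun t => snd (f t)) a b (snd l).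
Proof. exact (is_RInt_fct_extend_snd (U := R_NormedModule) (V := R_NormedModule) f a b l). Qed.

Lemma integral_Re (f : R -> C) l :
  Cintegral f l -> Rintegral (fun z => fst (f z)) (fst l).
Proof.
apply (integral_map (V := CR) (W := R_NormedModule) fst).
- intros a b y; apply is_RInt_Re.
- apply continuous_fst.
Qed.

Lemma integral_Im (f : R -> C) l :
  Cintegral f l -> Rintegral (fun z => snd (f z)) (snd l).
Proof.
apply (integral_map (V := CR) (W := R_NormedModule) snd).
- intros a b y; apply is_RInt_Im.
- apply continuous_snd.
Qed.

Lemma continuous_C_pair {U : UniformSpace} (f : U -> C) (x : U) :
  continuous (fun t => fst (f t)) x -> continuous (fun t => snd (f t)) x ->
  continuous (T := U) (U := CR) f x.
Proof.
intros H1 H2 P HP.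
destruct HP as [e He].
assert (A1 : locally x (fun t => ball (fst (f x)) e (fst (f t)))) by exact (H1 _ (locally_ball _ e)).
assert (A2 : locally x (fun t => ball (snd (f x)) e (snd (f t)))) by exact (H2 _ (locally_ball _ e)).
unfold filtermap; generalize (filter_and _ _ A1 A2).
apply filter_imp; intros t [Ht1 Ht2]; apply He; split; assumption.
Qed.

Lemma integral_RtoC (f : R -> R) l :
  Rintegral f l -> Cintegral (fun z => RtoC (f z)) (RtoC l).
Proof.
apply (integral_map (V := R_NormedModule) (W := CR) RtoC).
- intros a b y H; apply is_RInt_C_pair; simpl; [exact H|].
  pose proof (is_RInt_const (V := R_NormedModule) a b 0) as H0.
  unfold scal in H0; simpl in H0; unfold mult in H0; simpl in H0.
  rewrite Rmult_0_r in H0; exact H0.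
- apply continuous_C_pair; simpl; [apply continuous_id|apply continuous_const].
Qed.

Lemma C_continuous_Cmult (c z : C) : continuous (T := CR) (U := CR) (fun y => c * y)%C z.
Proof.
apply (continuous_C_pair (U := CR)); simpl.
- apply (continuous_minus (V := R_NormedModule)); apply (continuous_scal_r (V := R_NormedModule));
    [apply continuous_fst | apply continuous_snd].
- apply (continuous_plus (V := R_NormedModule)); apply (continuous_scal_r (V := R_NormedModule));
    [apply continuous_snd | apply continuous_fst].
Qed.

Lemma integral_Cmult (f : R -> C) (c l : C) :
  Cintegral f l -> Cintegral (fun z => c * f z)%C (c * l)%C.
Proof.
apply (integral_map (V := CR) (W := CR) (fun y => c * y)%C); [|apply C_continuous_Cmult].
intros a b y H; apply is_RInt_C_pair; simpl.
- apply (is_RInt_minus (V := R_NormedModule)); apply (is_RInt_scal (V := R_NormedModule));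
    [apply is_RInt_Re, H | apply is_RInt_Im, H].
- apply (is_RInt_plus (V := R_NormedModule)); apply (is_RInt_scal (V := R_NormedModule));
    [apply is_RInt_Im, H | apply is_RInt_Re, H].
Qed.

Lemma integral_Cconj (f : R -> C) (l : C) :
  Cintegral f l -> Cintegral (fun z => Cconj (f z)) (Cconj l).
Proof.
apply (integral_map (V := CR) (W := CR) Cconj).
- intros a b y H; apply is_RInt_C_pair; simpl; [apply is_RInt_Re, H|].
  apply (is_RInt_opp (V := R_NormedModule)), is_RInt_Im, H.
- apply continuous_C_pair; simpl; [apply continuous_fst|].
  apply (continuous_opp (V := R_NormedModule)), continuous_snd.
Qed.
(** * The integrals of z^(-b) (z + w)^(-n-1) *)

Definition beta_integral (b : R) : R :=
  RInt_gen (V := R_CompleteNormedModule) (fun z => Rpower z (- b) / (1 + z)) (at_right 0) (Rbar_locally p_infty).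

(** Comparison with z^(-b) (1+z)^(b-2) for z <= 1 and with (1+z)^(-b-1) for
    z > 1. *)
Lemma integral_beta (b : R) : 0 < b < 1 ->
  Rintegral (fun z => Rpower z (- b) / (1 + z)) (beta_integral b).
Proof.
intros Hb.
apply (RInt_gen_correct (V := R_CompleteNormedModule)).
pose proof (integral_scal (V := R_NormedModule) _ (2 / (1 - b)) _ (integral_Rpower_ratio (1 - b) ltac:(lra))) as H1.
pose proof (integral_scal (V := R_NormedModule) _ (2 / b) _ (integral_Rpower_tail b ltac:(lra))) as H2.
apply (integral_dominated (V := R_CompleteNormedModule) _ _ _) with (3 := integral_plus _ _ _ _ H1 H2).
- intros t Ht; real_continuous; lra.
- intros t Ht.
  change (Rabs (Rpower t (- b) / (1 + t)) <=
    2 / (1 - b) * ((1 - b) * (Rpower t (1 - b - 1) * Rpower (1 + t) (- (1 - b) - 1)))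
    + 2 / b * (b * Rpower (1 + t) (- b - 1))).
  replace (2 / b * (b * Rpower (1 + t) (- b - 1))) with (2 * (Rpower (1 + t) (- b) / (1 + t)))
    by (rewrite Rpower_pred by lra; field; lra).
  replace (2 / (1 - b) * ((1 - b) * (Rpower t (1 - b - 1) * Rpower (1 + t) (- (1 - b) - 1))))
    with (2 * (Rpower t (- b) * (Rpower (1 + t) b / (1 + t) / (1 + t)))).
  2:{ replace (1 - b - 1) with (- b) by ring.
      replace (- (1 - b) - 1) with (b - 1 - 1) by ring; rewrite !Rpower_pred by lra.
      field; lra. }
  pose proof (Rpower_pos t (- b)) as Ha; pose proof (Rpower_pos (1 + t) b) as Hb'.
  pose proof (Rpower_pos (1 + t) (- b)) as Hc.
  rewrite Rabs_pos_eq by (apply Rlt_le, Rdiv_lt_0_compat; lra).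
  apply (Rmult_le_reg_r (1 + t)); [lra|].
  replace (Rpower t (- b) / (1 + t) * (1 + t)) with (Rpower t (- b)) by (field; lra).
  replace ((2 * (Rpower t (- b) * (Rpower (1 + t) b / (1 + t) / (1 + t))) +
    2 * (Rpower (1 + t) (- b) / (1 + t))) * (1 + t)) with
    (Rpower t (- b) * Rpower (1 + t) b * (2 / (1 + t)) + 2 * Rpower (1 + t) (- b)) by (field; lra).
  destruct (Rle_dec t 1) as [Ht1|Ht1].
  + assert (1 <= Rpower (1 + t) b).
    { replace 1 with (Rpower (1 + t) 0) at 1 by (apply Rpower_O; lra). apply Rle_Rpower; lra. }
    assert (1 <= 2 / (1 + t)) by (apply Rle_div_r; lra).
    assert (Rpower t (- b) * 1 <= Rpower t (- b) * Rpower (1 + t) b) by (apply Rmult_le_compat_l; lra).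
    assert (Rpower t (- b) * Rpower (1 + t) b * 1 <= Rpower t (- b) * Rpower (1 + t) b * (2 / (1 + t)))
      by (apply Rmult_le_compat_l; [nra|lra]).
    lra.
  + assert (Rpower t (- b) <= 2 * Rpower (1 + t) (- b)).
    { rewrite !Rpower_Ropp.
      apply (Rmult_le_reg_r (Rpower t b * Rpower (1 + t) b)); [pose proof (Rpower_pos t b); nra|].
      replace (/ Rpower t b * (Rpower t b * Rpower (1 + t) b)) with (Rpower (1 + t) b)
        by (field; apply Rgt_not_eq, Rpower_pos).
      replace (2 * / Rpower (1 + t) b * (Rpower t b * Rpower (1 + t) b)) with (2 * Rpower t b)
        by (field; apply Rgt_not_eq, Rpower_pos).
      apply Rle_trans with (Rpower (2 * t) b); [apply Rle_Rpower_l; lra|].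
      rewrite <- Rpower_mult_distr by lra.
      apply Rmult_le_compat_r; [apply Rlt_le, Rpower_pos|].
      replace 2 with (Rpower 2 1) at 2 by (apply Rpower_1; lra). apply Rle_Rpower; lra. }
    assert (0 < Rpower t (- b) * Rpower (1 + t) b * (2 / (1 + t))).
    { apply Rmult_lt_0_compat; [nra|apply Rdiv_lt_0_compat; lra]. }
    lra.
Qed.

(** The exponent n + 1 makes each integral converge at infinity for every
    b > 0. *)
Definition resolvent_power (b : R) (w : C) (n : nat) (z : R) : C :=
  (RtoC (Rpower z (- b)) * Cpow (/ (RtoC z + w)) (S n))%C.

Definition resolvent_integral (b : R) (w : C) (n : nat) : C :=
  RInt_gen (V := C_R_CompleteNormedModule) (resolvent_power b w n) (at_right 0) (Rbar_locally p_infty).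

(** A quantitative form of: w is off the half line of nonpositive reals.  It
    bounds the integrands for w by the one for w = 1. *)
Definition off_cut (w : C) (c : R) : Prop :=
  0 < c /\ forall z, 0 < z -> c * (1 + z) <= Cmod (RtoC z + w).

Lemma off_cut_neq_0 (w : C) (c z : R) : off_cut w c -> 0 < z -> (RtoC z + w)%C <> 0%C.
Proof.
intros [Hc H] Hz; apply Cmod_gt_0; specialize (H z Hz).
assert (0 < c * (1 + z)) by (apply Rmult_lt_0_compat; lra); lra.
Qed.

Lemma is_derive_shift_inv (w : C) (z : R) : (RtoC z + w)%C <> 0%C ->
  is_Cderive (fun t => / (RtoC t + w))%C z
    (- ((/ (RtoC z + w)) * (/ (RtoC z + w))))%C.
Proof.
intros H.
replace (- ((/ (RtoC z + w)) * (/ (RtoC z + w))))%C with (- (1) / ((RtoC z + w) * (RtoC z + w)))%C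
  by (field; exact H).
apply (is_derive_Cinv (fun t => RtoC t + w)%C); [|exact H].
replace (RtoC 1) with (plus (G := CR) (RtoC 1) zero) by apply plus_zero_r.
apply (is_derive_plus (V := CR) (fun t => RtoC t) (fun _ => w)).
- apply (is_derive_RtoC (fun t => t)), (is_derive_id (K := R_AbsRing)).
- apply is_Cderive_const.
Qed.

Lemma is_derive_resolvent (a : R) (w : C) (n : nat) (z : R) : 0 < z -> (RtoC z + w)%C <> 0%C ->
  is_Cderive
    (fun t => RtoC (Rpower t a) * Cpow (/ (RtoC t + w)) (S n))%C z
    (RtoC (a * Rpower z (a - 1)) * Cpow (/ (RtoC z + w)) (S n)
     - RtoC (INR (S n)) * RtoC (Rpower z a) * Cpow (/ (RtoC z + w)) (S (S n)))%C.
Proof.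
intros Hz Hw.
pose proof (is_derive_RtoC _ _ _ (is_derive_Rpower z a Hz)) as H1.
pose proof (is_derive_Cpow _ _ _ (S n) (is_derive_shift_inv w z Hw)) as H2.
pose proof (is_derive_Cmult _ _ _ _ _ H1 H2) as H3.
replace (S n - 1)%nat with n in H3 by lia.
replace (RtoC (a * Rpower z (a - 1)) * Cpow (/ (RtoC z + w)) (S n)
     - RtoC (INR (S n)) * RtoC (Rpower z a) * Cpow (/ (RtoC z + w)) (S (S n)))%C
 with (RtoC (a * Rpower z (a - 1)) * Cpow (/ (RtoC z + w)) (S n) +
      RtoC (Rpower z a) * (RtoC (INR (S n)) * Cpow (/ (RtoC z + w)) n *
       - (/ (RtoC z + w) * / (RtoC z + w))))%C; [exact H3|].
simpl Cpow; ring.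
Qed.

Lemma Cmod_resolvent_le (b : R) (w : C) (c : R) (n : nat) (z : R) : off_cut w c -> 0 < z ->
  Cmod (RtoC (Rpower z b) * Cpow (/ (RtoC z + w)) (S n))
  <= (/ c) ^ S n * (Rpower z b / (1 + z)).
Proof.
intros Hw Hz; pose proof (off_cut_neq_0 w c z Hw Hz) as Hn; destruct Hw as [Hc Hw].
specialize (Hw z Hz).
rewrite Cmod_mult, Cmod_pow, Cmod_inv, Cmod_R, Rabs_pos_eq by (try apply Rlt_le, Rpower_pos; assumption).
assert (Hq : / Cmod (RtoC z + w) <= / c * / (1 + z)).
{ rewrite <- Rinv_mult; apply Rinv_le_contravar; [apply Rmult_lt_0_compat; lra|exact Hw]. }
assert (Hi : 0 < / (1 + z) <= 1).
{ apply Rinv_le_1; lra. }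
assert (Hic : 0 < / c) by (apply Rinv_0_lt_compat; lra).
assert (Hpw : (/ Cmod (RtoC z + w)) ^ S n <= (/ c) ^ S n * / (1 + z)).
{ apply Rle_trans with ((/ c * / (1 + z)) ^ S n).
  - apply pow_incr; split; [apply Rlt_le, Rinv_0_lt_compat, Cmod_gt_0, Hn|exact Hq].
  - rewrite Rpow_mult_distr; apply Rmult_le_compat_l; [apply Rlt_le, pow_lt, Hic|].
    rewrite <- (Rmult_1_r (/ (1 + z))) at 2; simpl; apply Rmult_le_compat_l; [lra|].
    apply Rle_trans with (1 ^ n); [apply pow_incr; lra|rewrite pow1; lra]. }
unfold Rdiv; rewrite (Rmult_comm (Rpower z b) (/ (1 + z))), <- Rmult_assoc, Rmult_comm.
apply Rmult_le_compat_r; [apply Rlt_le, Rpower_pos|exact Hpw].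
Qed.

Lemma continuous_resolvent_power (b : R) (w : C) (c : R) (n : nat) (z : R) : off_cut w c -> 0 < z ->
  continuous (U := CR) (resolvent_power b w n) z.
Proof.
intros Hw Hz; unfold resolvent_power; eapply continuous_C_of_derive.
apply is_derive_resolvent; [assumption|]. apply (off_cut_neq_0 w c z Hw Hz).
Qed.

Lemma integral_resolvent (b : R) (w : C) (c : R) (n : nat) : 0 < b < 1 -> off_cut w c ->
  Cintegral (resolvent_power b w n) (resolvent_integral b w n).
Proof.
intros Hb Hw.
apply (RInt_gen_correct (V := C_R_CompleteNormedModule)).
apply (integral_dominated (V := C_R_CompleteNormedModule) _
  (fun z => scal ((/ c) ^ S n) (Rpower z (- b) / (1 + z))) (scal ((/ c) ^ S n) (beta_integral b))).
- intros z Hz; apply (continuous_resolvent_power b w c n z Hw Hz).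
- intros z Hz.
  apply Rle_trans with (Cmod (resolvent_power b w n z)); [right; apply norm_Cmod|].
  apply Cmod_resolvent_le; assumption.
- apply (integral_scal (V := R_NormedModule)), integral_beta, Hb.
Qed.

Lemma C_integral_unique (f : R -> C) (l l' : C) :
  Cintegral f l -> Cintegral f l' -> l = l'.
Proof. apply (integral_unique (V := C_R_CompleteNormedModule)). Qed.

Lemma C_integral_Cmod_le (f : R -> C) (g : R -> R) lf lg :
  (forall z, 0 < z -> Cmod (f z) <= g z) ->
  Cintegral f lf -> Rintegral g lg -> Cmod lf <= lg.
Proof.
intros H Hf Hg; rewrite <- norm_Cmod.
apply (integral_norm_le (V := C_R_CompleteNormedModule) f g lf lg); auto.
intros z Hz; apply Rle_trans with (2 := H z Hz); right; apply norm_Cmod.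
Qed.

(** The primitive z^(1-b) (z + w)^(-n-1) vanishes at both ends, and
    z = (z + w) - w turns its derivative into a combination of two consecutive
    integrands. *)
Lemma resolvent_integral_succ (b : R) (w : C) (c : R) (n : nat) : 0 < b < 1 -> off_cut w c ->
  (RtoC (INR n + 1) * w * resolvent_integral b w (S n) =
   RtoC (INR n + b) * resolvent_integral b w n)%C.
Proof.
intros Hb Hw.
pose proof (integral_resolvent b w c n Hb Hw) as I0.
pose proof (integral_resolvent b w c (S n) Hb Hw) as I1.
pose proof (integral_plus (V := CR) _ _ _ _ (integral_Cmult _ (RtoC (- (INR n + b))) _ I0)
  (integral_Cmult _ (RtoC (INR n + 1) * w)%C _ I1)) as HL.
assert (HR : Cintegral (fun z => plus (G := CR) (RtoC (- (INR n + b)) * resolvent_power b w n z)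
   (RtoC (INR n + 1) * w * resolvent_power b w (S n) z))%C
   (minus (G := CR) zero zero)).
{ set (F := fun t => (RtoC (Rpower t (1 - b)) * Cpow (/ (RtoC t + w)) (S n))%C).
  assert (HF : forall z, 0 < z -> is_Cderive F z
     (plus (G := CR) (RtoC (- (INR n + b)) * resolvent_power b w n z)
        (RtoC (INR n + 1) * w * resolvent_power b w (S n) z))%C).
  { intros z Hz; pose proof (off_cut_neq_0 w c z Hw Hz) as Hn.
    pose proof (is_derive_resolvent (1 - b) w n z Hz Hn) as HD.
    exact_up_to_value HD.
    change (plus (G := CR)) with Cplus; unfold resolvent_power.
    replace (1 - b - 1) with (- b) by ring.
    replace (1 - b) with (- b + 1) by ring; rewrite Rpower_succ by assumption.
    rewrite S_INR, !RtoC_mult, RtoC_opp, !RtoC_plus, RtoC_opp.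
    simpl Cpow.
    set (q := (/ (RtoC z + w))%C); set (Q := Cpow q n); set (P := RtoC (Rpower z (- b))).
    assert (E : w = (/ q - RtoC z)%C) by (unfold q; field; exact Hn).
    assert (Hq : q <> 0%C).
    { unfold q; apply Cmod_gt_0; rewrite Cmod_inv by assumption; apply Rinv_0_lt_compat, Cmod_gt_0, Hn. }
    rewrite E; field; exact Hq. }
  apply (integral_FTC (V := C_R_CompleteNormedModule) F).
  - exact HF.
  - intros z Hz.
    apply (continuous_plus (V := CR)
      (fun z => RtoC (- (INR n + b)) * resolvent_power b w n z)%C
      (fun z => RtoC (INR n + 1) * w * resolvent_power b w (S n) z)%C).
    + pose proof (off_cut_neq_0 w c z Hw Hz) as Hn. eapply continuous_C_of_derive.
      apply is_derive_Cmult; [apply is_Cderive_const|].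
      apply is_derive_resolvent; assumption.
    + pose proof (off_cut_neq_0 w c z Hw Hz) as Hn. eapply continuous_C_of_derive.
      apply is_derive_Cmult; [apply is_Cderive_const|].
      apply is_derive_resolvent; assumption.
  - apply (filterlim_norm_zero (K := R_AbsRing) (V := CR)).
    apply (filterlim_le_le (F := at_right 0) (fun _ => 0) _ (fun t => (/ c) ^ S n * Rpower t (1 - b)) 0).
    + generalize at_right_pos; apply filter_imp; intros t Ht; split; [apply norm_ge_0|].
      apply Rle_trans with (Cmod (F t)); [right; apply norm_Cmod|].
      apply Rle_trans with (1 := Cmod_resolvent_le (1 - b) w c n t Hw Ht).
      apply Rmult_le_compat_l; [apply Rlt_le, pow_lt, Rinv_0_lt_compat, Hw|].
      pose proof (Rpower_pos t (1 - b)); apply Rle_div_l; nra.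
    + apply filterlim_const.
    + replace (Finite 0) with (Rbar_mult ((/ c) ^ S n) 0) by (simpl; f_equal; ring).
      apply (filterlim_comp _ _ _ (fun t => Rpower t (1 - b)) (fun u => (/ c) ^ S n * u) _ (locally 0)).
      * apply Rpower_lim_0; lra.
      * apply (filterlim_Rbar_mult_l ((/ c) ^ S n) 0).
  - apply (filterlim_norm_zero (K := R_AbsRing) (V := CR)).
    apply (filterlim_le_le (F := Rbar_locally p_infty) (fun _ => 0) _ (fun t => (/ c) ^ S n * Rpower (1 + t) (- b)) 0).
    + exists 0; intros t Ht; split; [apply norm_ge_0|].
      apply Rle_trans with (Cmod (F t)); [right; apply norm_Cmod|].
      apply Rle_trans with (1 := Cmod_resolvent_le (1 - b) w c n t Hw Ht).
      apply Rmult_le_compat_l; [apply Rlt_le, pow_lt, Rinv_0_lt_compat, Hw|].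
      apply Rle_div_l; [lra|]. replace (1 - b) with (- b + 1) by ring.
      rewrite Rmult_comm, <- Rpower_succ by lra.
      apply Rle_Rpower_l; lra.
    + apply filterlim_const.
    + replace (Finite 0) with (Rbar_mult ((/ c) ^ S n) 0) by (simpl; f_equal; ring).
      apply (filterlim_comp _ _ _ (fun t => Rpower (1 + t) (- b)) (fun u => (/ c) ^ S n * u) _ (locally 0)).
      * apply Rpower_lim_infty; lra.
      * apply (filterlim_Rbar_mult_l ((/ c) ^ S n) 0). }
pose proof (C_integral_unique _ _ _ HL HR) as E.
change (RtoC (- (INR n + b)) * resolvent_integral b w n + RtoC (INR n + 1) * w * resolvent_integral b w (S n)
  = 0 - 0)%C in E.
rewrite RtoC_opp in E.
transitivity ((- RtoC (INR n + b) * resolvent_integral b w n + RtoC (INR n + 1) * w * resolvent_integral b w (S n))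
  + RtoC (INR n + b) * resolvent_integral b w n)%C; [ring|]. rewrite E; ring.
Qed.
Lemma resolvent_integral_closed (b : R) (w : C) (c : R) (n : nat) : 0 < b < 1 -> off_cut w c -> w <> 0%C ->
  resolvent_integral b w n =
  (RtoC (rising b n / INR (fact n)) * Cpow (/ w) n * resolvent_integral b w 0)%C.
Proof.
intros Hb Hw Hw0; induction n as [|n IH].
- simpl; rewrite Rdiv_1_r; ring.
- pose proof (resolvent_integral_succ b w c n Hb Hw) as H; rewrite IH in H.
  assert (Hn : RtoC (INR n + 1) <> 0%C).
  { intros E; injection E; pose proof (pos_INR n); lra. }
  transitivity ((RtoC (INR n + 1) * w * resolvent_integral b w (S n)) * / RtoC (INR n + 1) * / w)%C;
    [field; auto|].
  rewrite H.
  replace (rising b (S n) / INR (fact (S n))) with (rising b n / INR (fact n) * (INR n + b) * / (INR n + 1)).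
  2:{ rewrite fact_simpl, mult_INR, S_INR; simpl. field; split; [apply INR_fact_neq_0|pose proof (pos_INR n); lra]. }
  rewrite !RtoC_mult, RtoC_inv by (pose proof (pos_INR n); lra). simpl Cpow; ring.
Qed.

(** * The Beta integral in terms of Gamma *)

Lemma off_cut_1 : off_cut (RtoC 1) 1.
Proof.
split; [lra|]. intros z Hz; rewrite <- RtoC_plus, Cmod_R, Rabs_pos_eq; lra.
Qed.

Lemma resolvent_power_1 (b : R) (n : nat) (z : R) : 0 < z ->
  resolvent_power b (RtoC 1) n z = RtoC (Rpower z (- b) / (1 + z) ^ S n).
Proof.
intros Hz; unfold resolvent_power.
rewrite <- RtoC_plus, <- RtoC_inv, <- RtoC_pow, <- RtoC_mult by lra.
f_equal; rewrite pow_inv; unfold Rdiv; f_equal; f_equal; f_equal; ring.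
Qed.

Lemma resolvent_integral_1 (b : R) : 0 < b < 1 ->
  resolvent_integral b (RtoC 1) 0 = RtoC (beta_integral b).
Proof.
intros Hb.
apply (C_integral_unique (resolvent_power b (RtoC 1) 0)).
- apply (integral_resolvent b _ 1); [assumption|apply off_cut_1].
- apply (integral_ext (V := CR) (fun z => RtoC (Rpower z (- b) / (1 + z)))).
  + intros z Hz; rewrite resolvent_power_1 by assumption; simpl; rewrite Rmult_1_r; reflexivity.
  + apply integral_RtoC, integral_beta, Hb.
Qed.

Lemma integral_beta_power (b : R) (n : nat) : 0 < b < 1 ->
  Rintegral (fun z => Rpower z (- b) / (1 + z) ^ S n)
    (rising b n / INR (fact n) * beta_integral b).
Proof.
intros Hb.
pose proof (integral_Re _ _ (integral_resolvent b _ 1 n Hb off_cut_1)) as H.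
rewrite (resolvent_integral_closed b _ 1 n Hb off_cut_1) in H by (intros E; injection E; lra).
replace (/ RtoC 1)%C with (RtoC 1) in H by (field; intros E; injection E; lra).
rewrite Cpow_1_l, resolvent_integral_1, Cmult_1_r, <- RtoC_mult in H by assumption.
apply integral_ext with (2 := H).
intros z Hz; rewrite resolvent_power_1 by assumption; reflexivity.
Qed.

(** From (1 + z)^(n+1) <= e^((n+1) z). *)
Lemma beta_power_lower (b : R) (n : nat) : 0 < b < 1 ->
  Rpower (INR (S n)) (- (1 - b)) * Gamma_integral (1 - b) <=
  rising b n / INR (fact n) * beta_integral b.
Proof.
intros Hb.
assert (HN : 0 < INR (S n)) by (apply lt_0_INR; lia).
apply (integral_le _ _ _ _) with
  (2 := integral_Gamma_scaled (1 - b) (INR (S n)) ltac:(lra) HN)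
  (3 := integral_beta_power b n Hb).
intros z Hz; replace (1 - b - 1) with (- b) by ring.
apply Rmult_le_compat_l; [apply Rlt_le, Rpower_pos|].
rewrite exp_Ropp; apply Rinv_le_contravar; [apply pow_lt; lra|].
rewrite <- Rpower_pow by lra; unfold Rpower; apply exp_monotone.
apply Rmult_le_compat_l; [lra|].
rewrite <- (ln_exp z) at 2; apply ln_le; [lra|]. pose proof (exp_ineq1_le z); lra.
Qed.

Lemma filterlim_expm1_0 : filterlim (fun t => exp t - 1) (at_right 0) (at_right 0).
Proof.
intros P [d Hd].
assert (H : filterlim (fun t => exp t - 1) (at_right 0) (locally 0)).
{ apply filterlim_at_right_continuous; [rewrite exp_0; ring|].
  real_continuous; auto. }
specialize (H _ (locally_ball _ d)); unfold filtermap in *.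
generalize (filter_and _ _ H at_right_pos); apply filter_imp; intros t [Ht Ht0].
apply Hd; [exact Ht|]. pose proof (exp_ineq1 t ltac:(lra)); lra.
Qed.

Lemma filterlim_expm1_infty : filterlim (fun t => exp t - 1) (Rbar_locally p_infty) (Rbar_locally p_infty).
Proof.
intros P [M HM]; exists (Rmax 0 M); intros t Ht; apply HM.
assert (0 < t) by (eapply Rle_lt_trans; [apply Rmax_l|apply Ht]).
assert (M < t) by (eapply Rle_lt_trans; [apply Rmax_r|apply Ht]).
pose proof (exp_ineq1 t ltac:(lra)); lra.
Qed.

(** The substitution z = e^t - 1 turns the integrand into
    (e^t - 1)^(-b) e^(-n t), which is at most t^(-b) e^(-n t). *)
Lemma beta_power_upper (b : R) (n : nat) : 0 < b < 1 -> (0 < n)%nat ->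
  rising b n / INR (fact n) * beta_integral b <=
  Rpower (INR n) (- (1 - b)) * Gamma_integral (1 - b).
Proof.
intros Hb Hn.
assert (HN : 0 < INR n) by (apply lt_0_INR; lia).
assert (Hpos : forall t, 0 < t -> 0 < exp t - 1) by (intros t Ht; pose proof (exp_ineq1 t ltac:(lra)); lra).
assert (H : Rintegral (fun t => scal (exp t)
    (Rpower (exp t - 1) (- b) / (1 + (exp t - 1)) ^ S n)) (rising b n / INR (fact n) * beta_integral b)).
{ apply (integral_comp (V := R_CompleteNormedModule) (fun z => Rpower z (- b) / (1 + z) ^ S n) _ (fun t => exp t - 1) exp).
  - intros z Hz; apply continuous_of_ex_derive.
    assert ((1 + z) ^ S n <> 0) by (apply pow_nonzero; lra).
    unfold Rpower; auto_derive; auto.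
  - exact Hpos.
  - intros z Hz; auto_derive; auto; ring.
  - intros z Hz; real_continuous; auto.
  - apply filterlim_expm1_0.
  - apply filterlim_expm1_infty.
  - apply integral_beta_power, Hb. }
apply (integral_le _ _ _ _) with (2 := H)
  (3 := integral_Gamma_scaled (1 - b) (INR n) ltac:(lra) HN).
intros t Ht; replace (1 - b - 1) with (- b) by ring.
change (exp t * (Rpower (exp t - 1) (- b) / (1 + (exp t - 1)) ^ S n)
  <= Rpower t (- b) * exp (- (INR n * t))).
replace (1 + (exp t - 1)) with (exp t) by ring.
pose proof (exp_pos t) as He.
replace (exp t * (Rpower (exp t - 1) (- b) / exp t ^ S n)) with (Rpower (exp t - 1) (- b) * / exp t ^ n)
  by (simpl; field; split; try apply pow_nonzero; lra).
replace (exp (- (INR n * t))) with (/ exp t ^ n).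
2:{ rewrite exp_Ropp; f_equal; rewrite <- Rpower_pow by assumption; unfold Rpower; rewrite ln_exp; reflexivity. }
apply Rmult_le_compat_r; [apply Rlt_le, Rinv_0_lt_compat, pow_lt, He|].
rewrite !Rpower_Ropp; apply Rinv_le_contravar; [apply Rpower_pos|].
apply Rle_Rpower_l; [lra|]. pose proof (exp_ineq1_le t); lra.
Qed.

Lemma Gamma_integral_rising (b : R) (n : nat) : 0 < b ->
  Gamma_integral (INR n + b) = rising b n * Gamma_integral b.
Proof.
intros Hb; induction n as [|n IH]; [simpl; rewrite Rplus_0_l; ring|].
rewrite S_INR; replace (INR n + 1 + b) with (INR n + b + 1) by ring.
rewrite Gamma_integral_succ, IH by (pose proof (pos_INR n); lra). simpl; ring.
Qed.

Lemma Gamma_integral_fact (n : nat) : Gamma_integral (INR n + 1) = INR (fact n).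
Proof.
induction n as [|n IH]; [simpl; rewrite Rplus_0_l; apply Gamma_integral_1|].
rewrite S_INR, Gamma_integral_succ, IH, fact_simpl, mult_INR, S_INR by (pose proof (pos_INR n); lra); reflexivity.
Qed.

(** The moments (b)_n / n! B(b, 1 - b) lie between two multiples of
    Gamma(1 - b) that are asymptotically equal, and (b)_n / n! is governed by
    Gamma(n + b) ~ n^b Gamma(n). *)
Lemma beta_integral_Gamma (b : R) : 0 < b < 1 ->
  beta_integral b = Gamma_integral b * Gamma_integral (1 - b).
Proof.
intros Hb; set (G := Gamma_integral b * Gamma_integral (1 - b)).
pose proof (Gamma_integral_positive b ltac:(lra)) as HG.
assert (E : forall n, rising b (S n) / INR (fact (S n)) * beta_integral b =
   beta_integral b * Gamma_ratio (INR (S n)) b * Rpower (INR (S n)) (- (1 - b)) / Gamma_integral b).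
{ intros n; assert (HN : 0 < INR (S n)) by (apply lt_0_INR; lia).
  unfold Gamma_ratio; rewrite Gamma_integral_rising by lra.
  rewrite <- Gamma_integral_fact, Gamma_integral_succ by assumption.
  replace (- (1 - b)) with (b - 1) by ring; rewrite Rpower_pred by assumption.
  pose proof (Gamma_integral_positive _ HN); pose proof (Rpower_pos (INR (S n)) b).
  field; lra. }
assert (L1 : is_lim_seq (fun n => beta_integral b * Gamma_ratio (INR (S n)) b) G).
{ apply is_lim_seq_le_le with (fun n => Rpower (1 + 1 * / INR (S n)) (- (1 - b)) * G) (fun _ => G).
  - intros n; assert (HN : 0 < INR (S n)) by (apply lt_0_INR; lia).
    pose proof (beta_power_lower b (S n) Hb) as HL; pose proof (beta_power_upper b (S n) Hb ltac:(lia)) as HU.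
    rewrite E in HL, HU; set (I := beta_integral b * Gamma_ratio (INR (S n)) b) in *.
    rewrite (S_INR (S n)) in HL; set (N := INR (S n)) in *.
    replace (N + 1) with (N * (1 + 1 * / N)) in HL by (field; lra).
    assert (0 < / N) by (apply Rinv_0_lt_compat; lra).
    rewrite <- Rpower_mult_distr in HL by lra.
    pose proof (Rpower_pos N (- (1 - b))) as HP; set (P := Rpower N (- (1 - b))) in *.
    set (Q := Rpower (1 + 1 * / N) (- (1 - b))) in *.
    split.
    + apply (Rmult_le_reg_r (P / Gamma_integral b)); [apply Rdiv_lt_0_compat; lra|].
      apply Rle_trans with (P * Q * Gamma_integral (1 - b)); [right; unfold G; field; lra|].
      apply Rle_trans with (1 := HL); right; field; lra.
    + apply (Rmult_le_reg_r (P / Gamma_integral b)); [apply Rdiv_lt_0_compat; lra|].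
      apply Rle_trans with (P * Gamma_integral (1 - b)); [|right; unfold G; field; lra].
      apply Rle_trans with (2 := HU); right; field; lra.
  - replace (Finite G) with (Finite (1 * G)) by (f_equal; ring).
    apply is_lim_seq_mult'; [apply Rpower_ratio_lim|apply is_lim_seq_const].
  - apply is_lim_seq_const. }
assert (L2 : is_lim_seq (fun n => beta_integral b * Gamma_ratio (INR (S n)) b) (beta_integral b * 1)).
{ apply (is_lim_seq_scal_l _ (beta_integral b) 1), Gamma_ratio_lim; lra. }
apply is_lim_seq_unique in L1; apply is_lim_seq_unique in L2.
rewrite L1 in L2; injection L2; lra.
Qed.
(** * Continuation from the half line to the line Im w = 1 *)

(** The point i - x. *)
Definition upper_point (x : R) : C := (- x, 1).

(** The branch of (i - x)^a whose argument pi/2 + atan x lies in (0, pi); it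
    continues the positive power on the side x -> -oo. *)
Definition upper_pow (a x : R) : C :=
  (RtoC (Rpower (1 + x ^ 2) (a / 2)) * expi (a * (PI / 2 + atan x)))%C.

Lemma expi_plus (s t : R) : expi (s + t) = (expi s * expi t)%C.
Proof. unfold expi, Cmult; simpl; rewrite cos_plus, sin_plus; f_equal; ring. Qed.

Lemma expi_0 : expi 0 = RtoC 1.
Proof. unfold expi; rewrite cos_0, sin_0; reflexivity. Qed.

Lemma expi_neq_0 (t : R) : expi t <> 0%C.
Proof. unfold expi; intros E; injection E; intros; pose proof (sin2_cos2 t) as H1; unfold Rsqr in H1; nra. Qed.

Lemma expi_opp (t : R) : expi (- t) = (/ expi t)%C.
Proof.
transitivity (expi (- t) * (expi t * / expi t))%C.
- rewrite Cinv_r by apply expi_neq_0; ring.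
- rewrite Cmult_assoc, <- expi_plus; replace (- t + t) with 0 by ring; rewrite expi_0; ring.
Qed.

Lemma Cconj_expi (t : R) : Cconj (expi t) = expi (- t).
Proof. unfold Cconj, expi; simpl; rewrite cos_neg, sin_neg; reflexivity. Qed.

Lemma expi_pow (t : R) (n : nat) : Cpow (expi t) n = expi (INR n * t).
Proof.
induction n as [|n IH]; [simpl; rewrite Rmult_0_l, expi_0; reflexivity|].
rewrite S_INR, Cpow_S, IH, <- expi_plus; f_equal; ring.
Qed.

Lemma is_derive_expi (g : R -> R) (x dg : R) : is_derive g x dg ->
  is_Cderive (fun t => expi (g t)) x (Ci * RtoC dg * expi (g x))%C.
Proof.
intros H.
replace (Ci * RtoC dg * expi (g x))%C with (dg * - sin (g x), dg * cos (g x))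
  by (unfold Ci, expi, RtoC, Cmult; simpl; f_equal; ring).
apply is_derive_C_pair; simpl.
- apply (is_derive_comp cos g); [apply is_derive_cos|exact H].
- apply (is_derive_comp sin g); [apply is_derive_sin|exact H].
Qed.

Lemma one_plus_sqr_pos (x : R) : 0 < 1 + x ^ 2.
Proof. nra. Qed.

Lemma upper_point_neq_0 (x : R) : upper_point x <> 0%C.
Proof. intros E; injection E; lra. Qed.

Lemma upper_pow_plus (a c x : R) : upper_pow (a + c) x = (upper_pow a x * upper_pow c x)%C.
Proof.
unfold upper_pow.
replace ((a + c) / 2) with (a / 2 + c / 2) by field.
replace ((a + c) * (PI / 2 + atan x)) with (a * (PI / 2 + atan x) + c * (PI / 2 + atan x)) by ring.
rewrite Rpower_plus, expi_plus, RtoC_mult; ring.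
Qed.

Lemma upper_pow_0 (x : R) : upper_pow 0 x = RtoC 1.
Proof.
unfold upper_pow; replace (0 / 2) with 0 by field.
rewrite Rpower_O, Rmult_0_l, expi_0 by apply one_plus_sqr_pos; ring.
Qed.

Lemma upper_pow_1 (x : R) : upper_pow 1 x = upper_point x.
Proof.
unfold upper_pow, upper_point.
replace (1 / 2) with (/ 2) by field; rewrite Rmult_1_l.
rewrite Rpower_sqrt by apply one_plus_sqr_pos.
unfold expi, RtoC, Cmult; simpl.
rewrite cos_plus, sin_plus, cos_PI2, sin_PI2, sin_atan, cos_atan.
replace (1 + Rsqr x) with (1 + x * (x * 1)) by (unfold Rsqr; ring).
assert (H : sqrt (1 + x * (x * 1)) <> 0) by (apply Rgt_not_eq, sqrt_lt_R0; nra).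
f_equal; field; exact H.
Qed.

Lemma upper_pow_neq_0 (a x : R) : upper_pow a x <> 0%C.
Proof.
unfold upper_pow; apply Cmult_neq_0; [|apply expi_neq_0].
intros E; injection E; intros H; pose proof (Rpower_pos (1 + x ^ 2) (a / 2)); simpl in *; lra.
Qed.

Lemma upper_pow_opp (a x : R) : upper_pow (- a) x = (/ upper_pow a x)%C.
Proof.
transitivity (upper_pow (- a) x * (upper_pow a x * / upper_pow a x))%C.
- rewrite Cinv_r by apply upper_pow_neq_0; ring.
- rewrite Cmult_assoc, <- upper_pow_plus; replace (- a + a) with 0 by ring; rewrite upper_pow_0; ring.
Qed.

Lemma upper_pow_pred (a x : R) : upper_pow (a - 1) x = (upper_pow a x / upper_point x)%C.
Proof.
unfold Rminus; rewrite upper_pow_plus, upper_pow_opp, upper_pow_1; reflexivity.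
Qed.

Lemma is_derive_upper_pow (a x : R) :
  is_Cderive (upper_pow a) x (- RtoC a * upper_pow (a - 1) x)%C.
Proof.
assert (Hx := one_plus_sqr_pos x).
assert (H1 : is_derive (fun x => Rpower (1 + x ^ 2) (a / 2)) x
   (Rpower (1 + x ^ 2) (a / 2) * (a * x / (1 + x ^ 2)))).
{ unfold Rpower; auto_derive; [simpl in Hx; lra|].
  replace (1 + x * (x * 1)) with (1 + x ^ 2) by (simpl; ring). field; lra. }
assert (H2 : is_derive (fun x => a * (PI / 2 + atan x)) x (a / (1 + x ^ 2))).
{ auto_derive; auto. unfold Rsqr; field; nra. }
pose proof (is_derive_Cmult _ _ _ _ _ (is_derive_RtoC _ _ _ H1) (is_derive_expi _ _ _ H2)) as H.
exact_up_to_value H.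
rewrite upper_pow_pred; unfold upper_pow.
set (P := Rpower (1 + x ^ 2) (a / 2)); set (e := expi (a * (PI / 2 + atan x))).
rewrite (RtoC_mult P).
assert (Hs : RtoC (1 + x ^ 2) <> 0%C) by (intros E; injection E; intros; nra).
replace (upper_point x) with (Ci - RtoC x)%C
  by (unfold upper_point, Ci, RtoC, Cminus, Cplus, Copp; simpl; f_equal; ring).
assert (Hw : (Ci - RtoC x)%C <> 0%C).
{ unfold Ci, RtoC, Cminus, Cplus, Copp; simpl; intros E; injection E; intros; lra. }
rewrite !RtoC_div by lra. rewrite RtoC_mult.
assert (Ef : RtoC (1 + x ^ 2) = ((Ci - RtoC x) * (- Ci - RtoC x))%C).
{ unfold Ci, RtoC, Cminus, Cplus, Copp, Cmult; simpl; f_equal; ring. }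
rewrite Ef.
assert (Hw2 : (- Ci - RtoC x)%C <> 0%C).
{ unfold Ci, RtoC, Cminus, Cplus, Copp; simpl; intros E; injection E; intros; lra. }
field; auto.
Qed.

(** The form in which derivatives are exchanged below with integrals and with
    series: quadratic remainders can be integrated and summed. *)
Lemma is_derive_quadratic {V : NormedModule R_AbsRing} (f : R -> V) (x : R) (l : V) (K : R) :
  (forall h, norm (minus (minus (f (x + h)) (f x)) (scal h l)) <= K * h ^ 2) ->
  is_derive f x l.
Proof.
intros H; split; [apply is_linear_scal_l|].
intros y Hy.
assert (Ey : x = y) by exact (is_filter_lim_locally_unique (K := R_AbsRing) (V := AbsRing_NormedModule R_AbsRing) x y Hy).
subst y; clear Hy.
intros eps.
assert (Hd : 0 < eps / (Rabs K + 1)).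
{ apply Rdiv_lt_0_compat; [destruct eps; auto|pose proof (Rabs_pos K); lra]. }
exists (mkposreal _ Hd); intros t; change R in t; intros Ht.
change (Rabs (t - x) < eps / (Rabs K + 1)) in Ht.
specialize (H (t - x)); replace (x + (t - x)) with t in H by ring.
apply Rle_trans with (1 := H).
change (K * (t - x) ^ 2 <= eps * Rabs (t - x)).
pose proof (Rabs_pos K); pose proof (Rabs_pos (t - x)); pose proof (Rle_abs K).
rewrite <- (pow2_abs (t - x)).
apply Rlt_div_r in Ht; [|lra]. nra.
Qed.

Lemma Re_Im_Cmod (z : C) : Rabs (fst z) <= Cmod z /\ Rabs (snd z) <= Cmod z.
Proof. pose proof (Rmax_Cmod z) as H; split; eapply Rle_trans; [apply Rmax_l|exact H|apply Rmax_r|exact H]. Qed.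

Lemma Cmod_shift_upper (x z : R) : Rabs (z - x) <= Cmod (RtoC z + upper_point x) /\
  1 <= Cmod (RtoC z + upper_point x).
Proof.
destruct (Re_Im_Cmod (RtoC z + upper_point x)) as [H1 H2]; simpl in H1, H2.
split; [exact H1|]. rewrite Rplus_0_l, Rabs_R1 in H2; exact H2.
Qed.

Lemma off_cut_upper (x : R) : off_cut (upper_point x) (/ (2 + Rabs x)).
Proof.
pose proof (Rabs_pos x) as Hx; split; [apply Rinv_0_lt_compat; lra|].
intros z Hz; destruct (Cmod_shift_upper x z) as [H1 H2].
apply (Rmult_le_reg_l (2 + Rabs x)); [lra|].
rewrite <- Rmult_assoc, Rinv_r, Rmult_1_l by lra.
pose proof (Rle_abs (z - x)); pose proof (Rle_abs x); nra.
Qed.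

(** With A = z + i - x, the remainder of 1/(A - h) at first order is
    h^2 / (A^2 (A - h)); since |A - h| >= 1 and |A| >= 1, it is at most h^2/|A|,
    which is integrable against z^(-b). *)
Lemma is_derive_resolvent_integral (b x : R) : 0 < b < 1 ->
  is_Cderive (fun x => resolvent_integral b (upper_point x) 0) x
    (resolvent_integral b (upper_point x) 1).
Proof.
intros Hb.
apply (is_derive_quadratic (V := CR)) with ((2 + Rabs x) * beta_integral b).
intros h; rewrite norm_Cmod.
change (Cmod (resolvent_integral b (upper_point (x + h)) 0 - resolvent_integral b (upper_point x) 0
  - scal (V := CR) h (resolvent_integral b (upper_point x) 1)) <= (2 + Rabs x) * beta_integral b * h ^ 2).
apply (C_integral_Cmod_le _ (fun z => scal (h ^ 2 * (2 + Rabs x)) (Rpower z (- b) / (1 + z)))) with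
  (2 := integral_minus (V := CR) _ _ _ _ (integral_minus (V := CR) _ _ _ _
    (integral_resolvent b _ _ 0 Hb (off_cut_upper (x + h)))
    (integral_resolvent b _ _ 0 Hb (off_cut_upper x)))
    (integral_scal (V := CR) _ h _ (integral_resolvent b _ _ 1 Hb (off_cut_upper x)))).
- intros z Hz.
  change (Cmod (resolvent_power b (upper_point (x + h)) 0 z - resolvent_power b (upper_point x) 0 z
    - scal (V := CR) h (resolvent_power b (upper_point x) 1 z))
    <= h ^ 2 * (2 + Rabs x) * (Rpower z (- b) / (1 + z))).
  rewrite scal_R_Cmult; unfold resolvent_power.
  set (A := (RtoC z + upper_point x)%C).
  assert (EA : (RtoC z + upper_point (x + h) = A - RtoC h)%C).
  { C_components. }
  rewrite EA; simpl Cpow.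
  destruct (Cmod_shift_upper x z) as [_ HA1]; fold A in HA1.
  destruct (Cmod_shift_upper (x + h) z) as [_ HB1]; rewrite EA in HB1.
  pose proof (proj2 (off_cut_upper x) z Hz) as HA2; fold A in HA2.
  assert (NA : A <> 0%C) by (apply Cmod_gt_0; lra).
  assert (NB : (A - RtoC h)%C <> 0%C) by (apply Cmod_gt_0; lra).
  replace (RtoC (Rpower z (- b)) * (/ (A - RtoC h) * 1) - RtoC (Rpower z (- b)) * (/ A * 1)
    - RtoC h * (RtoC (Rpower z (- b)) * (/ A * (/ A * 1))))%C with
   (RtoC (h ^ 2) * RtoC (Rpower z (- b)) * (/ A * / A * / (A - RtoC h)))%C.
  2:{ rewrite RtoC_pow; field; auto. }
  rewrite !Cmod_mult, !Cmod_inv, !Cmod_R by assumption.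
  pose proof (Rpower_pos z (- b)) as HP.
  rewrite (Rabs_pos_eq (h ^ 2)), (Rabs_pos_eq (Rpower z (- b))) by nra.
  replace (h ^ 2 * (2 + Rabs x) * (Rpower z (- b) / (1 + z))) with
    (h ^ 2 * Rpower z (- b) * ((2 + Rabs x) / (1 + z))) by (field; lra).
  apply Rmult_le_compat_l; [nra|].
  assert (0 < / Cmod A <= 1) by (apply Rinv_le_1; lra).
  assert (0 < / Cmod (A - RtoC h) <= 1) by (apply Rinv_le_1; lra).
  assert (/ Cmod A <= (2 + Rabs x) / (1 + z)).
  { pose proof (Rabs_pos x).
    replace ((2 + Rabs x) / (1 + z)) with (/ (/ (2 + Rabs x) * (1 + z))) by (field; lra).
    apply Rinv_le_contravar; [|exact HA2].
    apply Rmult_lt_0_compat; [apply Rinv_0_lt_compat|]; lra. }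
  assert (/ Cmod A * / Cmod A <= / Cmod A) by nra.
  assert (0 <= / Cmod A * / Cmod A) by nra.
  nra.
- replace ((2 + Rabs x) * beta_integral b * h ^ 2) with (scal (h ^ 2 * (2 + Rabs x)) (beta_integral b))
    by (unfold scal; simpl; unfold mult; simpl; ring).
  apply (integral_scal (V := R_NormedModule)), integral_beta, Hb.
Qed.

Lemma C_derive_zero_const (f : R -> C) (x y : R) :
  (forall t, is_Cderive f t (RtoC 0)) -> f x = f y.
Proof.
intros H; destruct (Rtotal_order x y) as [Hxy|[->|Hxy]]; [|reflexivity|symmetry];
  apply (eq_is_derive (V := CR)); auto; intros t _; apply H.
Qed.

(** The x-derivative is the integral of index 1, that is b/w times the integral
    of index 0: the opposite of the logarithmic derivative of w^b. *)
Lemma resolvent_integral_ray (b x : R) : 0 < b < 1 ->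
  (resolvent_integral b (upper_point x) 0 * upper_pow b x =
   resolvent_integral b (upper_point 0) 0 * upper_pow b 0)%C.
Proof.
intros Hb.
apply (C_derive_zero_const (fun x => resolvent_integral b (upper_point x) 0 * upper_pow b x)%C x 0).
intros t.
pose proof (is_derive_Cmult _ _ _ _ _ (is_derive_resolvent_integral b t Hb) (is_derive_upper_pow b t)) as H.
exact_up_to_value H.
rewrite upper_pow_pred.
rewrite (resolvent_integral_closed b _ _ 1 Hb (off_cut_upper t) (upper_point_neq_0 t)).
simpl; replace (1 * (b + 0) / 1) with b by field.
field; apply upper_point_neq_0.
Qed.

Lemma integral_beta_scaled (b t : R) : 0 < b < 1 -> 0 < t ->
  Rintegral (fun z => Rpower z (- b) / (z + t)) (Rpower t (- b) * beta_integral b).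
Proof.
intros Hb Ht.
assert (Hi : 0 < / t) by (apply Rinv_0_lt_compat, Ht).
apply (integral_ext (V := R_NormedModule) (fun z => scal (Rpower t (- b)) (scal (/ t) (Rpower (/ t * z) (- b) / (1 + / t * z))))).
- intros z Hz; unfold scal; simpl; unfold mult; simpl.
  rewrite <- Rpower_mult_distr by lra.
  assert (E : Rpower t (- b) * Rpower (/ t) (- b) = 1).
  { rewrite Rpower_mult_distr, Rinv_r by lra; apply Rpower_1_base. }
  replace (Rpower t (- b) * (/ t * (Rpower (/ t) (- b) * Rpower z (- b) / (1 + / t * z))))
   with (Rpower t (- b) * Rpower (/ t) (- b) * Rpower z (- b) / (z + t)) by (field; nra).
  rewrite E, Rmult_1_l; reflexivity.
- apply (integral_scal (V := R_NormedModule)).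
  apply (integral_scale (V := R_CompleteNormedModule) (fun z => Rpower z (- b) / (1 + z)));
    [exact Hi| |apply integral_beta, Hb].
  intros z Hz; real_continuous; lra.
Qed.

(** Far to the left, i - x is a real number up to the bounded error i:
    |1/(z + t + i) - 1/(z + t)| <= 1/(t (z + t)). *)
Lemma resolvent_integral_far (b t : R) : 0 < b < 1 -> 0 < t ->
  Cmod (resolvent_integral b (upper_point (- t)) 0 - RtoC (Rpower t (- b) * beta_integral b))
  <= / t * (Rpower t (- b) * beta_integral b).
Proof.
intros Hb Ht.
apply (C_integral_Cmod_le _ (fun z => scal (/ t) (Rpower z (- b) / (z + t)))) with
  (2 := integral_minus (V := CR) _ _ _ _ (integral_resolvent b _ _ 0 Hb (off_cut_upper (- t)))
     (integral_RtoC _ _ (integral_beta_scaled b t Hb Ht)))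
  (3 := integral_scal (V := R_NormedModule) _ (/ t) _ (integral_beta_scaled b t Hb Ht)).
intros z Hz.
change (Cmod (resolvent_power b (upper_point (- t)) 0 z - RtoC (Rpower z (- b) / (z + t)))
  <= / t * (Rpower z (- b) / (z + t))).
unfold resolvent_power; simpl Cpow.
destruct (Cmod_shift_upper (- t) z) as [H1 H2].
set (A := (RtoC z + upper_point (- t))%C) in *.
replace (z - - t) with (z + t) in H1 by ring; rewrite Rabs_pos_eq in H1 by lra.
assert (NA : A <> 0%C) by (apply Cmod_gt_0; lra).
assert (NB : RtoC (z + t) <> 0%C) by (intros E; injection E; lra).
assert (EA : A = (RtoC (z + t) + Ci)%C).
{ C_components. }
replace (RtoC (Rpower z (- b)) * (/ A * 1) - RtoC (Rpower z (- b) / (z + t)))%C with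
  (RtoC (Rpower z (- b)) * (- Ci * / A * / RtoC (z + t)))%C.
2:{ rewrite RtoC_div by lra.
    replace Ci with (A - RtoC (z + t))%C by (rewrite EA; ring). field; auto. }
rewrite !Cmod_mult, Cmod_opp, Cmod_Ci, !Cmod_inv, !Cmod_R by assumption.
pose proof (Rpower_pos z (- b)) as HP; rewrite !Rabs_pos_eq by lra.
replace (/ t * (Rpower z (- b) / (z + t))) with (Rpower z (- b) * (/ t * / (z + t))) by (field; lra).
apply Rmult_le_compat_l; [lra|]. rewrite Rmult_1_l.
apply Rmult_le_compat_r; [apply Rlt_le, Rinv_0_lt_compat; lra|].
apply Rinv_le_contravar; lra.
Qed.

Lemma squeeze_at_zero (F : R -> R) (C : R) :
  continuous F 0 -> (forall u, 0 < u -> Rabs (F u) <= C * u) -> F 0 = 0.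
Proof.
intros HF HC.
assert (L1 : is_lim_seq (fun n => F (/ INR (S n))) (F 0)).
{ apply (is_lim_seq_continuous F (fun n => / INR (S n)) 0).
  - apply continuity_pt_filterlim; exact HF.
  - apply is_lim_seq_inv_succ. }
assert (L2 : is_lim_seq (fun n => F (/ INR (S n))) 0).
{ apply is_lim_seq_abs_0.
  apply is_lim_seq_le_le with (fun _ => 0) (fun n => C * / INR (S n)).
  - intros n; split; [apply Rabs_pos|]. apply HC, Rinv_0_lt_compat, lt_0_INR; lia.
  - apply is_lim_seq_const.
  - replace (Finite 0) with (Rbar_mult C 0) by (simpl; f_equal; ring).
    apply is_lim_seq_scal_l, is_lim_seq_inv_succ. }
apply is_lim_seq_unique in L1; apply is_lim_seq_unique in L2.
rewrite L1 in L2; injection L2; auto.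
Qed.

(** The constant left by the differential equation is computed at x = -1/u as u
    tends to 0: after division by u^b the comparison with the real integral has
    an error of order u, and u^(-b) w^(-b) tends to 1. *)
Lemma resolvent_integral_upper (b x : R) : 0 < b < 1 ->
  resolvent_integral b (upper_point x) 0 = (RtoC (beta_integral b) * upper_pow (- b) x)%C.
Proof.
intros Hb.
set (K := (resolvent_integral b (upper_point 0) 0 * upper_pow b 0)%C).
assert (HK : forall x, resolvent_integral b (upper_point x) 0 = (K * upper_pow (- b) x)%C).
{ intros y; unfold K; rewrite <- (resolvent_integral_ray b y Hb), upper_pow_opp.
  field; apply upper_pow_neq_0. }
rewrite HK; f_equal.
set (I := beta_integral b) in *.
set (g := fun u => (RtoC (Rpower (1 + u ^ 2) (- b / 2)) * expi (- b * atan u))%C).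
assert (Hg : forall u, 0 < u -> Cmod (K * g u - RtoC I) <= I * u).
{ intros u Hu.
  assert (Hi : 0 < / u) by (apply Rinv_0_lt_compat, Hu).
  pose proof (resolvent_integral_far b (/ u) Hb Hi) as H; fold I in H.
  rewrite HK, Rinv_inv in H.
  assert (E : upper_pow (- b) (- / u) = (RtoC (Rpower (/ u) (- b)) * g u)%C).
  { unfold upper_pow, g; rewrite Cmult_assoc, <- RtoC_mult; f_equal.
    - f_equal. replace (1 + (- / u) ^ 2) with ((/ u * / u) * (1 + u ^ 2)) by (field; lra).
      rewrite <- !Rpower_mult_distr, <- Rpower_plus by nra. f_equal; f_equal; field.
    - f_equal. rewrite atan_opp, (atan_inv _ Hu); ring. }
  rewrite E in H; set (P := Rpower (/ u) (- b)) in *.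
  assert (HP : 0 < P) by apply Rpower_pos.
  replace (K * (RtoC P * g u) - RtoC (P * I))%C with (RtoC P * (K * g u - RtoC I))%C in H
    by (rewrite RtoC_mult; ring).
  rewrite Cmod_mult, Cmod_R, Rabs_pos_eq in H by lra.
  apply (Rmult_le_reg_l P); [exact HP|]. lra. }
assert (Dg : exists l, is_Cderive (fun u => K * g u - RtoC I)%C 0 l).
{ assert (H1 : ex_derive (fun u => Rpower (1 + u ^ 2) (- b / 2)) 0).
  { unfold Rpower; auto_derive; lra. }
  assert (H2 : ex_derive (fun u => - b * atan u) 0) by (auto_derive; auto).
  destruct H1 as [l1 H1]; destruct H2 as [l2 H2].
  eexists; apply (is_derive_minus (V := CR) (fun u => K * g u)%C (fun _ => RtoC I)).
  - apply is_derive_Cmult; [apply is_Cderive_const|].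
    apply is_derive_Cmult; [apply is_derive_RtoC, H1|apply is_derive_expi, H2].
  - apply is_Cderive_const. }
destruct Dg as [l Dg].
assert (E : (K * g 0 - RtoC I)%C = 0%C).
{ apply injective_projections.
  - apply (squeeze_at_zero (fun u => fst (K * g u - RtoC I)%C) I).
    + apply continuous_of_ex_derive; eexists; apply (is_derive_Re _ _ _ Dg).
    + intros u Hu; eapply Rle_trans; [apply Re_Im_Cmod|apply Hg, Hu].
  - apply (squeeze_at_zero (fun u => snd (K * g u - RtoC I)%C) I).
    + apply continuous_of_ex_derive; eexists; apply (is_derive_Im _ _ _ Dg).
    + intros u Hu; eapply Rle_trans; [apply Re_Im_Cmod|apply Hg, Hu]. }
replace (g 0) with (RtoC 1) in E.
2:{ unfold g; rewrite atan_0, Rmult_0_r, expi_0; replace (1 + 0 ^ 2) with 1 by ring.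
    rewrite Rpower_1_base; ring. }
apply Ceq_minus; rewrite <- E; ring.
Qed.
(** * The reflection formula and the constant c_alpha *)

(** The imaginary part of the integral at w = i is the integral of
    z^(-b)/(1 + z^2) up to sign, and z -> z^2 identifies it with half the Beta
    integral of parameter (1 + b)/2. *)
Lemma beta_integral_half (b : R) : 0 < b < 1 ->
  beta_integral ((1 + b) / 2) = 2 * beta_integral b * sin (b * (PI / 2)).
Proof.
intros Hb.
(* The imaginary part of 1/(z + i) is -1/(1 + z^2). *)
assert (H1 : Rintegral (fun z => Rpower z (- b) / (1 + z ^ 2))
   (beta_integral b * sin (b * (PI / 2)))).
{ pose proof (integral_Im _ _ (integral_resolvent b _ _ 0 Hb (off_cut_upper 0))) as H.
  rewrite (resolvent_integral_upper b 0 Hb) in H.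
  replace (beta_integral b * sin (b * (PI / 2))) with
    (scal (-1) (snd (RtoC (beta_integral b) * upper_pow (- b) 0)%C)).
  2:{ unfold upper_pow; rewrite atan_0; replace (1 + 0 ^ 2) with 1 by ring.
      replace (Rpower 1 (- b / 2)) with 1 by (now rewrite Rpower_1_base).
      unfold expi, RtoC, Cmult, scal; simpl; unfold mult; simpl.
      replace (- b * (PI / 2 + 0)) with (- (b * (PI / 2))) by ring.
      rewrite sin_neg; ring. }
  apply (integral_ext (V := R_NormedModule)) with (2 := integral_scal (V := R_NormedModule) _ (-1) _ H).
  intros z Hz; unfold resolvent_power, upper_point, RtoC, Cplus, Cinv, Cmult, scal; simpl; unfold mult; simpl.
  rewrite !Ropp_0, !Rplus_0_r, Rplus_0_l; field; nra. }
assert (H2 : Rintegral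
   (fun z => scal (2 * z) (Rpower (z ^ 2) (- ((1 + b) / 2)) / (1 + z ^ 2))) (beta_integral ((1 + b) / 2))).
{ apply (integral_comp (V := R_CompleteNormedModule) (fun u => Rpower u (- ((1 + b) / 2)) / (1 + u)) _
     (fun z => z ^ 2) (fun z => 2 * z)).
  - intros z Hz; real_continuous; lra.
  - intros z Hz; apply pow_lt, Hz.
  - intros z Hz; auto_derive; auto; ring.
  - intros z Hz; real_continuous; auto.
  - intros P [d Hd].
    assert (H : filterlim (fun t => t ^ 2) (at_right 0) (locally 0)).
    { apply filterlim_at_right_continuous; [ring|]. real_continuous; auto. }
    specialize (H _ (locally_ball _ d)); unfold filtermap in *.
    generalize (filter_and _ _ H at_right_pos); apply filter_imp; intros t [Ht Ht0].
    apply Hd; [exact Ht|apply pow_lt, Ht0].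
  - intros P [M HM]; exists (Rmax 1 M); intros t Ht; apply HM.
    assert (1 < t) by (eapply Rle_lt_trans; [apply Rmax_l|apply Ht]).
    assert (M < t) by (eapply Rle_lt_trans; [apply Rmax_r|apply Ht]). nra.
  - apply integral_beta; lra. }
pose proof (integral_scal (V := R_NormedModule) _ 2 _ H1) as H3.
assert (E : beta_integral ((1 + b) / 2) = scal 2 (beta_integral b * sin (b * (PI / 2)))).
{ apply (integral_unique (V := R_CompleteNormedModule)) with (2 := H3).
  apply integral_ext with (2 := H2).
  intros z Hz; unfold scal; simpl; unfold mult; simpl.
  replace (z * (z * 1)) with (z * z) by ring.
  rewrite <- Rpower_mult_distr, <- Rpower_plus by assumption.
  replace (- ((1 + b) / 2) + - ((1 + b) / 2)) with (- b - 1) by field.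
  rewrite Rpower_pred by assumption; field; split; nra. }
rewrite E; unfold scal; simpl; unfold mult; simpl; ring.
Qed.

Definition reflection_product (b : R) : R := beta_integral b * sin (PI * b).

Lemma reflection_product_half (b : R) : 0 < b < 1 ->
  reflection_product ((1 + b) / 2) = reflection_product b.
Proof.
intros Hb; unfold reflection_product; rewrite beta_integral_half by assumption.
replace (PI * ((1 + b) / 2)) with (b * (PI / 2) + PI / 2) by field.
replace (PI * b) with (2 * (b * (PI / 2))) by field.
rewrite sin_plus, sin_2a, sin_PI2, cos_PI2; ring.
Qed.

Lemma reflection_product_iter (e : R) (n : nat) : 0 < e < 1 ->
  reflection_product (1 - e / 2 ^ n) = reflection_product (1 - e).
Proof.
intros He; induction n as [|n IH]; [simpl; f_equal; field|].
rewrite <- IH, <- (reflection_product_half (1 - e / 2 ^ n)).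
- f_equal; simpl; field; apply pow_nonzero; lra.
- assert (1 <= 2 ^ n) by (apply pow_R1_Rle; lra).
  assert (0 < e / 2 ^ n) by (apply Rdiv_lt_0_compat; lra).
  assert (e / 2 ^ n <= e) by (apply Rle_div_l; nra). lra.
Qed.

Lemma Gamma_integral_near_1 (u : nat -> R) :
  (forall n, 0 <= u n <= 1) -> is_lim_seq (fun n => Rpower (1 + u n) (u n - 1)) 1 ->
  is_lim_seq (fun n => Gamma_integral (1 + u n)) 1.
Proof.
intros Hu Hl; apply is_lim_seq_le_le with (2 := Hl) (w := fun _ => 1); [|apply is_lim_seq_const].
intros n; specialize (Hu n).
pose proof (Gamma_integral_lower 1 (u n) Rlt_0_1 Hu) as HL.
pose proof (Gamma_integral_upper 1 (u n) Rlt_0_1 Hu) as HU.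
rewrite Gamma_integral_1 in HL, HU.
replace (Rpower 1 (u n)) with 1 in HU by (now rewrite Rpower_1_base).
split; [|lra].
replace (u n - 1) with (- (1 - u n)) by ring; rewrite Rpower_Ropp.
pose proof (Rpower_pos (1 + u n) (1 - u n)).
apply (Rmult_le_reg_l (Rpower (1 + u n) (1 - u n))); [assumption|].
rewrite Rinv_r by lra; lra.
Qed.

Lemma is_lim_seq_R_continuous (F : R -> R) (u : nat -> R) (l : R) :
  ex_derive F l -> is_lim_seq u l -> is_lim_seq (fun n => F (u n)) (F l).
Proof.
intros HF Hu; apply (is_lim_seq_continuous F u l); [|exact Hu].
apply continuity_pt_filterlim, continuous_of_ex_derive, HF.
Qed.

(** Iterating b -> (1 + b)/2 brings b to 1 without changing the product; with
    u = 1 - b it equals Gamma(2 - u) Gamma(1 + u) / (1 - u) times sin(pi u)/u,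
    whose limit at u = 0 is pi. *)
Lemma reflection_product_value (b : R) : 0 < b < 1 -> reflection_product b = PI.
Proof.
intros Hb; set (e := 1 - b).
set (u := fun n => e / 2 ^ n).
assert (Hu : forall n, 0 < u n < 1).
{ intros n; unfold u, e; assert (1 <= 2 ^ n) by (apply pow_R1_Rle; lra).
  split; [apply Rdiv_lt_0_compat; lra|apply Rlt_div_l; nra]. }
assert (Lu : is_lim_seq u 0).
{ apply is_lim_seq_ext with (fun n => e * (/ 2) ^ n).
  - intros n; unfold u, Rdiv; rewrite pow_inv; reflexivity.
  - replace (Finite 0) with (Rbar_mult e 0) by (simpl; f_equal; ring).
    apply is_lim_seq_scal_l, is_lim_seq_geom; rewrite Rabs_pos_eq; lra. }
assert (H : is_lim_seq (fun n => reflection_product (1 - u n)) (1 * 1 * / (1 - 0) * (PI * 1))).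
{ apply is_lim_seq_ext with (fun n => Gamma_integral (1 + (1 - u n)) * Gamma_integral (1 + u n)
     * / (1 - u n) * (PI * (sin (PI * u n) / (PI * u n)))).
  - intros n; specialize (Hu n); unfold reflection_product.
    rewrite beta_integral_Gamma by lra.
    replace (1 - (1 - u n)) with (u n) by ring.
    replace (1 + (1 - u n)) with (1 - u n + 1) by ring; rewrite (Rplus_comm 1 (u n)).
    rewrite !Gamma_integral_succ by lra.
    replace (PI * (1 - u n)) with (- (PI * u n) + PI) by ring; rewrite neg_sin, sin_neg.
    pose proof PI_RGT_0; field; lra.
  - apply is_lim_seq_mult'; [apply is_lim_seq_mult'; [apply is_lim_seq_mult'|]|].
    + apply (Gamma_integral_near_1 (fun n => 1 - u n)); [intros n; specialize (Hu n); lra|].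
      replace (Finite 1) with (Finite ((fun v => Rpower (1 + (1 - v)) (1 - v - 1)) 0)).
      * apply (is_lim_seq_R_continuous (fun v => Rpower (1 + (1 - v)) (1 - v - 1)));
          [unfold Rpower; auto_derive; lra|exact Lu].
      * f_equal; replace (1 - 0 - 1) with 0 by ring; apply Rpower_O; lra.
    + apply Gamma_integral_near_1; [intros n; specialize (Hu n); lra|].
      replace (Finite 1) with (Finite ((fun v => Rpower (1 + v) (v - 1)) 0)).
      * apply (is_lim_seq_R_continuous (fun v => Rpower (1 + v) (v - 1)));
          [unfold Rpower; auto_derive; lra|exact Lu].
      * f_equal; rewrite Rplus_0_r; apply Rpower_1_base.
    + apply (is_lim_seq_R_continuous (fun v => / (1 - v))); [auto_derive; lra|exact Lu].
    + apply (is_lim_seq_scal_l _ PI 1).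
      apply (is_lim_comp_seq (fun y => sin y / y) (fun n => PI * u n) 0 1).
      * apply is_lim_sinc_0.
      * exists 0%nat; intros n _ E; injection E; intros E'.
        pose proof PI_RGT_0; specialize (Hu n); nra.
      * replace (Finite 0) with (Rbar_mult PI 0) by (simpl; f_equal; ring).
        apply is_lim_seq_scal_l, Lu. }
assert (H' : is_lim_seq (fun n => reflection_product (1 - u n)) (reflection_product b)).
{ apply is_lim_seq_ext with (fun _ => reflection_product b); [|apply is_lim_seq_const].
  intros n; unfold u; rewrite reflection_product_iter by (unfold e; lra).
  f_equal; unfold e; ring. }
apply is_lim_seq_unique in H; apply is_lim_seq_unique in H'.
rewrite H in H'; injection H' as E; rewrite <- E; field.
Qed.

Lemma Gamma_integral_reflection (b : R) : 0 < b < 1 ->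
  Gamma_integral b * Gamma_integral (1 - b) * sin (PI * b) = PI.
Proof.
intros Hb; rewrite <- beta_integral_Gamma by assumption; exact (reflection_product_value b Hb).
Qed.

Lemma Gamma_integral_one_half : Gamma_integral (/ 2) = sqrt PI.
Proof.
pose proof (Gamma_integral_reflection (/ 2) ltac:(lra)) as H.
replace (1 - / 2) with (/ 2) in H by field; replace (PI * / 2) with (PI / 2) in H by field.
rewrite sin_PI2, Rmult_1_r in H; rewrite <- H; symmetry; apply sqrt_square.
apply Rlt_le, Gamma_integral_positive; lra.
Qed.

(** Duplication and reflection, both at alpha/2. *)
Lemma c_const_closed (alpha : R) : 0 < alpha < 2 ->
  c_const alpha = alpha * Gamma_integral alpha * sin (alpha * (PI / 2)) / PI.
Proof.
intros Ha; unfold c_const; rewrite !Gamma_pos by lra.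
pose proof (Gamma_integral_duplication (alpha / 2) ltac:(lra)) as HD.
pose proof (Gamma_integral_reflection (alpha / 2) ltac:(lra)) as HR.
rewrite Gamma_integral_one_half in HD.
replace (2 * (alpha / 2)) with alpha in HD by field.
replace (alpha / 2 + / 2) with (1 / 2 + alpha / 2) in HD by field.
replace (PI * (alpha / 2)) with (alpha * (PI / 2)) in HR by field.
replace (Rpower 4 (alpha / 2)) with (2 * Rpower 2 (alpha - 1)) in HD.
2:{ replace 4 with (2 * 2) by ring; rewrite <- Rpower_mult_distr, <- Rpower_plus by lra.
    rewrite <- Rpower_succ by lra; f_equal; field. }
pose proof (Gamma_integral_positive (alpha / 2) ltac:(lra)) as P1.
pose proof (Gamma_integral_positive (1 - alpha / 2) ltac:(lra)) as P2.
pose proof (sqrt_lt_R0 _ PI_RGT_0) as P3; pose proof PI_RGT_0 as P4.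
set (s := sin _) in *; set (A := Gamma_integral (alpha / 2)) in *.
set (B := Gamma_integral (1 - alpha / 2)) in *; set (D := Gamma_integral (1 / 2 + alpha / 2)) in *.
assert (E1 : Rpower 2 (alpha - 1) * D = sqrt PI * Gamma_integral alpha / A).
{ apply (Rmult_eq_reg_r (2 * A)); [|lra]. transitivity (2 * Rpower 2 (alpha - 1) * A * D); [ring|].
  rewrite HD; field; lra. }
assert (Hs : s <> 0) by (intros Es; rewrite Es, Rmult_0_r in HR; lra).
replace (alpha * Gamma_integral alpha * s / PI) with (alpha * Gamma_integral alpha / (A * B))
  by (rewrite <- HR; field; repeat split; lra).
rewrite E1; field; repeat split; lra.
Qed.
(** * Fractional derivatives of the Higgins functions for k > 0 *)

(** The sum of C(n,j) f(j) over j, defined by Pascal's rule: anything linear in f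
    then passes through it by induction on n, without binomial coefficients. *)
Fixpoint binomial_sum (n : nat) (f : nat -> C) : C :=
  match n with
  | O => f O
  | S m => (binomial_sum m f + binomial_sum m (fun j => f (S j)))%C
  end.

Lemma binomial_sum_ext (n : nat) (f g : nat -> C) :
  (forall j, f j = g j) -> binomial_sum n f = binomial_sum n g.
Proof.
revert f g; induction n as [|n IH]; intros f g H; simpl; [apply H|].
f_equal; apply IH; intros j; apply H.
Qed.

Lemma binomial_sum_Cmult (n : nat) (c : C) (f : nat -> C) :
  binomial_sum n (fun j => c * f j)%C = (c * binomial_sum n f)%C.
Proof.
revert f; induction n as [|n IH]; intros f; simpl; [reflexivity|].
rewrite !IH; ring.
Qed.

Lemma binomial_sum_pow (n : nat) (t : C) : binomial_sum n (fun j => Cpow t j) = Cpow (1 + t) n.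
Proof.
induction n as [|n IH]; [reflexivity|].
change (binomial_sum n (fun j => Cpow t j) + binomial_sum n (fun j => t * Cpow t j) = Cpow (1 + t) (S n))%C.
rewrite (binomial_sum_Cmult n t (Cpow t)), Cpow_S.
change (binomial_sum n (Cpow t)) with (binomial_sum n (fun j => Cpow t j)); rewrite IH; ring.
Qed.

Lemma integral_binomial_sum (n : nat) (F : nat -> R -> C) (L : nat -> C) :
  (forall j, Cintegral (F j) (L j)) ->
  Cintegral (fun z => binomial_sum n (fun j => F j z)) (binomial_sum n L).
Proof.
revert F L; induction n as [|n IH]; intros F L H; simpl; [apply H|].
apply (integral_plus (V := CR) (fun z => binomial_sum n (fun j => F j z))
  (fun z => binomial_sum n (fun j => F (S j) z))); apply IH; intros j; apply H.
Qed.

Lemma is_derive_binomial_sum (n : nat) (F : nat -> R -> C) (x : R) (L : nat -> C) :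
  (forall j, is_Cderive (F j) x (L j)) ->
  is_Cderive (fun t => binomial_sum n (fun j => F j t)) x (binomial_sum n L).
Proof.
revert F L; induction n as [|n IH]; intros F L H; simpl; [apply H|].
apply (is_derive_plus (V := CR) (fun z => binomial_sum n (fun j => F j z))
  (fun z => binomial_sum n (fun j => F (S j) z))); apply IH; intros j; apply H.
Qed.

Definition minus_2i : C := (- (2) * Ci)%C.

Lemma higgins_ratio (x : R) :
  ((Ci * RtoC x - RtoC 1) / (Ci * RtoC x + RtoC 1))%C = (1 + minus_2i * / upper_point x)%C.
Proof.
assert (H1 : (Ci * RtoC x + RtoC 1)%C = (- Ci * upper_point x)%C)
  by C_components.
assert (H2 : (Ci * RtoC x - RtoC 1)%C = (- Ci * (upper_point x - 2 * Ci))%C)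
  by C_components.
rewrite H1, H2; unfold minus_2i; field; split; [apply upper_point_neq_0|apply Ci_nz].
Qed.

Lemma higgins_pos (p : positive) (x : R) :
  higgins (Zpos p) x = binomial_sum (Pos.to_nat p) (fun j => Cpow (minus_2i * / upper_point x) j)%C.
Proof. rewrite binomial_sum_pow, <- higgins_ratio; reflexivity. Qed.

Lemma is_derive_inv_upper_point (x : R) :
  is_Cderive (fun t => / upper_point t)%C x (/ upper_point x * / upper_point x)%C.
Proof.
replace (/ upper_point x * / upper_point x)%C with (- (- (1)) / (upper_point x * upper_point x))%C
  by (field; apply upper_point_neq_0).
apply is_derive_Cinv; [|apply upper_point_neq_0].
replace (- (1))%C with ((- 1, 0) : C) by C_components.
apply is_derive_C_pair; simpl.
- auto_derive; auto; ring.
- apply (is_derive_const (K := R_AbsRing) (V := R_NormedModule)).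
Qed.

Lemma RC_derive_higgins_pos (p : positive) (x : R) :
  RC_derive (higgins (Zpos p)) x =
  binomial_sum (Pos.to_nat p)
    (fun j => RtoC (INR j) * Cpow minus_2i j * Cpow (/ upper_point x) (S j))%C.
Proof.
apply is_RC_derive_unique.
apply (is_derive_ext (V := CR) (fun t => binomial_sum (Pos.to_nat p) (fun j => Cpow (minus_2i * / upper_point t) j)%C)).
{ intros t; symmetry; apply higgins_pos. }
apply (is_derive_binomial_sum _ (fun j t => Cpow (minus_2i * / upper_point t) j)).
intros j.
pose proof (is_derive_Cpow _ _ _ j (is_derive_Cmult _ _ _ _ _
  (is_Cderive_const minus_2i x) (is_derive_inv_upper_point x))) as H.
exact_up_to_value H.
destruct j as [|j]; [simpl; ring|].
replace (S j - 1)%nat with j by lia; rewrite Cpow_mult_l, !Cpow_S; ring.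
Qed.

Lemma upper_point_shift (x z : R) : upper_point (x - z) = (RtoC z + upper_point x)%C.
Proof. apply injective_projections; simpl; ring. Qed.

Lemma Dfrac_integrand_higgins_pos (b x z : R) (p : positive) : 0 < z ->
  Dfrac_integrand b (higgins (Zpos p)) x z =
  binomial_sum (Pos.to_nat p) (fun j => RtoC (INR j) * Cpow minus_2i j * resolvent_power b (upper_point x) j z)%C.
Proof.
intros Hz; unfold Dfrac_integrand; rewrite RC_derive_higgins_pos, upper_point_shift.
unfold Cdiv; rewrite Cmult_comm, <- binomial_sum_Cmult; apply binomial_sum_ext; intros j.
unfold resolvent_power; rewrite Rpower_Ropp, RtoC_inv by (apply Rgt_not_eq, Rpower_pos).
ring.
Qed.

(** The number (a)_j / (j-1)!, in a form that also gives 0 at j = 0. *)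
Definition higgins_coef (a : R) (j : nat) : R := INR j * (rising a j / INR (fact j)).

(** Each term is a single power of i - x, so that differentiation acts on it by
    shifting a. *)
Definition Dfrac_closed (a : R) (n : nat) (x : R) : C :=
  binomial_sum n (fun j =>
    RtoC (Gamma_integral a * higgins_coef a j) * Cpow minus_2i j * upper_pow (- (a + INR j)) x)%C.

Lemma upper_pow_sub_nat (a x : R) (j : nat) :
  upper_pow (- (a + INR j)) x = (Cpow (/ upper_point x) j * upper_pow (- a) x)%C.
Proof.
induction j as [|j IH]; [simpl; rewrite Rplus_0_r; ring|].
rewrite S_INR; replace (- (a + (INR j + 1))) with (- (a + INR j) - 1) by ring.
rewrite upper_pow_pred, IH, Cpow_S; unfold Cdiv; ring.
Qed.

Lemma integral_Dfrac_higgins_pos (b x : R) (p : positive) : 0 < b < 1 ->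
  Cintegral (Dfrac_integrand b (higgins (Zpos p)) x)
    (RtoC (Gamma_integral (1 - b)) * Dfrac_closed b (Pos.to_nat p) x)%C.
Proof.
intros Hb.
apply (integral_ext (V := CR) (fun z => binomial_sum (Pos.to_nat p)
  (fun j => RtoC (INR j) * Cpow minus_2i j * resolvent_power b (upper_point x) j z)%C)).
{ intros z Hz; symmetry; apply Dfrac_integrand_higgins_pos, Hz. }
unfold Dfrac_closed; rewrite <- binomial_sum_Cmult.
apply (integral_binomial_sum _ (fun j z => RtoC (INR j) * Cpow minus_2i j * resolvent_power b (upper_point x) j z)%C).
intros j.
pose proof (integral_Cmult _ (RtoC (INR j) * Cpow minus_2i j)%C _
  (integral_resolvent b _ _ j Hb (off_cut_upper x))) as H.
exact_up_to_value H.
rewrite (resolvent_integral_closed b _ _ j Hb (off_cut_upper x) (upper_point_neq_0 x)).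
rewrite resolvent_integral_upper, upper_pow_sub_nat, beta_integral_Gamma by assumption.
unfold higgins_coef; rewrite !RtoC_mult; ring.
Qed.

Lemma rising_shift (a : R) (n : nat) : rising a (S n) = a * rising (a + 1) n.
Proof.
induction n as [|n IH]; [simpl; ring|].
change (rising a (S (S n))) with (rising a (S n) * (a + INR (S n))).
rewrite IH, S_INR; simpl; ring.
Qed.

(** Because Gamma(b) (b)_j (b + j) = Gamma(b + 1) (b + 1)_j. *)
Lemma is_derive_Dfrac_closed (b x : R) (n : nat) : 0 < b ->
  is_Cderive (Dfrac_closed b n) x (Dfrac_closed (b + 1) n x).
Proof.
intros Hb.
apply (is_derive_binomial_sum n (fun j x => RtoC (Gamma_integral b * higgins_coef b j) * Cpow minus_2i j * upper_pow (- (b + INR j)) x)%C).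
intros j.
pose proof (is_derive_Cmult _ _ _ _ _
  (is_Cderive_const (RtoC (Gamma_integral b * higgins_coef b j) * Cpow minus_2i j)%C x)
  (is_derive_upper_pow (- (b + INR j)) x)) as H.
exact_up_to_value H.
replace (- (b + 1 + INR j)) with (- (b + INR j) - 1) by ring.
rewrite Gamma_integral_succ by assumption.
assert (E : Gamma_integral b * higgins_coef b j * (b + INR j) = b * Gamma_integral b * higgins_coef (b + 1) j).
{ unfold higgins_coef.
  assert (E : rising b j * (b + INR j) = b * rising (b + 1) j) by (rewrite <- rising_shift; reflexivity).
  transitivity (Gamma_integral b * INR j * (rising b j * (b + INR j)) / INR (fact j)); [|rewrite E];
    field; apply INR_fact_neq_0. }
rewrite <- E, (RtoC_mult _ (b + INR j)), RtoC_opp; ring.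
Qed.

Lemma upper_pow_cot (a s : R) : 0 < s < PI ->
  upper_pow (- a) (cot s) = (RtoC (Rpower (sin s) a) * expi (- (a * (PI - s))))%C.
Proof.
intros Hs; unfold upper_pow.
assert (Hsin : 0 < sin s) by (apply sin_gt_0; lra).
assert (E1 : atan (cot s) = PI / 2 - s).
{ unfold cot; replace (cos s / sin s) with (tan (PI / 2 - s)).
  - apply atan_tan; lra.
  - unfold tan; rewrite cos_shift, sin_shift; reflexivity. }
rewrite E1; replace (- a * (PI / 2 + (PI / 2 - s))) with (- (a * (PI - s))) by field.
f_equal; f_equal.
replace (1 + cot s ^ 2) with (/ (sin s * sin s)).
2:{ unfold cot; pose proof (sin2_cos2 s) as H; unfold Rsqr in H.
    replace (1 + (cos s / sin s) ^ 2) with ((sin s * sin s + cos s * cos s) / (sin s * sin s)) by (field; lra).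
    rewrite H; field; lra. }
unfold Rpower; f_equal; rewrite ln_Rinv, ln_mult by (try apply Rmult_lt_0_compat; assumption); field.
Qed.

Lemma minus_2i_upper_point_cot (s : R) : 0 < s < PI ->
  (minus_2i * / upper_point (cot s))%C = (expi (2 * s) - 1)%C.
Proof.
intros Hs.
assert (Hsin : 0 < sin s) by (apply sin_gt_0; lra).
assert (E : (minus_2i = (expi (2 * s) - 1) * upper_point (cot s))%C).
{ pose proof (sin2_cos2 s) as H; unfold Rsqr in H.
  apply injective_projections; unfold minus_2i, expi, upper_point, cot; simpl; rewrite cos_2a_sin, sin_2a.
  - field; lra.
  - transitivity (- (2) * (sin s * sin s + cos s * cos s)); [rewrite H; ring|field; lra]. }
rewrite E; field; apply upper_point_neq_0.
Qed.

Lemma Dfrac_closed_cot (a s : R) (n : nat) : 0 < s < PI ->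
  Dfrac_closed a n (cot s) =
  (RtoC (Gamma_integral a * Rpower (sin s) a) * expi (- (a * (PI - s))) *
   binomial_sum n (fun j => RtoC (higgins_coef a j) * Cpow (expi (2 * s) - 1) j))%C.
Proof.
intros Hs; unfold Dfrac_closed; rewrite <- binomial_sum_Cmult; apply binomial_sum_ext; intros j.
rewrite upper_pow_sub_nat, upper_pow_cot, <- minus_2i_upper_point_cot, Cpow_mult_l, !RtoC_mult by assumption.
ring.
Qed.
(** * Series indexed by the integers *)

Definition is_Zseries (a : Z -> C) (S : C) : Prop :=
  exists s1 s2 : C,
    is_Cseries (fun n => a (Z.of_nat n)) s1 /\
    is_Cseries (fun n => a (- Z.of_nat (Datatypes.S n))%Z) s2 /\
    S = (s1 + s2)%C.

Lemma is_series_map {V W : NormedModule R_AbsRing} (phi : V -> W) (u : nat -> V) (s : V) :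
  (forall x y, phi (plus x y) = plus (phi x) (phi y)) -> continuous phi s ->
  is_series u s -> is_series (fun n => phi (u n)) (phi s).
Proof.
intros Hp Hc Hu; unfold is_series in *.
apply (filterlim_ext (fun n => phi (sum_n u n))).
{ intros n; induction n as [|n IH]; [rewrite !sum_O; reflexivity|].
  rewrite !sum_Sn, Hp, IH; reflexivity. }
exact (filterlim_comp _ _ _ _ _ _ _ _ Hu Hc).
Qed.

Lemma is_Zseries_unique (a : Z -> C) (S : C) : is_Zseries a S -> ex_Zseries a /\ Zseries a = S.
Proof.
intros [s1 [s2 [H1 [H2 ->]]]]; split; [split; eexists; eassumption|].
assert (HC : forall u s, is_Cseries u s -> CSeries u = s).
{ intros u s H; unfold CSeries; rewrite (surjective_pairing s); f_equal; apply is_series_unique.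
  - apply (is_series_map (V := CR) (W := R_NormedModule) fst u s); [reflexivity|apply continuous_fst|exact H].
  - apply (is_series_map (V := CR) (W := R_NormedModule) snd u s); [reflexivity|apply continuous_snd|exact H]. }
unfold Zseries; rewrite (HC _ _ H1), (HC _ _ H2); reflexivity.
Qed.

Lemma is_Zseries_inj (a : Z -> C) (S S' : C) : is_Zseries a S -> is_Zseries a S' -> S = S'.
Proof. intros H H'; rewrite <- (proj2 (is_Zseries_unique _ _ H)); apply is_Zseries_unique, H'. Qed.

Lemma is_Zseries_ext (a b : Z -> C) (S : C) : (forall l, a l = b l) -> is_Zseries a S -> is_Zseries b S.
Proof.
intros E [s1 [s2 [H1 [H2 ->]]]]; exists s1, s2; split; [|split]; [| |reflexivity].
- exact (is_series_ext _ _ _ (fun n => E _) H1).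
- exact (is_series_ext _ _ _ (fun n => E _) H2).
Qed.

Lemma is_Zseries_Cmult (a : Z -> C) (c S : C) : is_Zseries a S -> is_Zseries (fun l => c * a l)%C (c * S)%C.
Proof.
intros [s1 [s2 [H1 [H2 ->]]]]; exists (c * s1)%C, (c * s2)%C; split; [|split; [|ring]].
- apply (is_series_map (V := CR) (W := CR) (fun y => c * y)%C) with (3 := H1); [|apply C_continuous_Cmult].
  intros x y; change (c * (x + y) = c * x + c * y)%C; ring.
- apply (is_series_map (V := CR) (W := CR) (fun y => c * y)%C) with (3 := H2); [|apply C_continuous_Cmult].
  intros x y; change (c * (x + y) = c * x + c * y)%C; ring.
Qed.

Lemma is_Zseries_Cconj (a : Z -> C) (S : C) : is_Zseries a S -> is_Zseries (fun l => Cconj (a l)) (Cconj S).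
Proof.
assert (Hc : forall z, continuous (T := CR) (U := CR) Cconj z).
{ intros z; apply (continuous_C_pair (U := CR)); simpl; [apply continuous_fst|].
  apply (continuous_opp (V := R_NormedModule)), continuous_snd. }
intros [s1 [s2 [H1 [H2 ->]]]]; exists (Cconj s1), (Cconj s2); split; [|split; [|apply Cplus_conj]].
- apply (is_series_map (V := CR) (W := CR) Cconj) with (3 := H1); [apply Cplus_conj|apply Hc].
- apply (is_series_map (V := CR) (W := CR) Cconj) with (3 := H2); [apply Cplus_conj|apply Hc].
Qed.

Lemma is_Zseries_plus (a b : Z -> C) (S T : C) : is_Zseries a S -> is_Zseries b T ->
  is_Zseries (fun l => a l + b l)%C (S + T)%C.
Proof.
intros [s1 [s2 [H1 [H2 ->]]]] [t1 [t2 [G1 [G2 ->]]]].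
exists (s1 + t1)%C, (s2 + t2)%C; split; [|split; [|ring]].
- exact (is_series_plus _ _ _ _ H1 G1).
- exact (is_series_plus _ _ _ _ H2 G2).
Qed.

Lemma is_series_C_cons (u : nat -> C) (s : C) :
  is_Cseries (fun n => u (S n)) s ->
  is_Cseries u (s + u O)%C.
Proof.
intros H; apply is_series_decr_1.
change (is_Cseries (fun n => u (S n)) (s + u O - u O)%C).
replace (s + u O - u O)%C with s by ring.
exact H.
Qed.

Lemma is_series_C_tail (u : nat -> C) (s : C) :
  is_Cseries u s ->
  is_Cseries (fun n => u (S n)) (s - u O)%C.
Proof.
intros H; apply is_series_incr_1.
change (is_Cseries u (s - u O + u O)%C).
replace (s - u O + u O)%C with s by ring.
exact H.
Qed.

Lemma is_Zseries_shift (a : Z -> C) (S : C) : is_Zseries a S -> is_Zseries (fun l => a (l - 1)%Z) S.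
Proof.
intros [s1 [s2 [H1 [H2 ->]]]].
exists (s1 + a (-1)%Z)%C, (s2 - a (-1)%Z)%C; split; [|split; [|ring]].
- apply (is_series_C_cons (fun n => a (Z.of_nat n - 1)%Z)).
  apply (is_series_ext (V := CR)) with (2 := H1); intros n; f_equal; lia.
- apply (is_series_ext (V := CR)) with (2 := is_series_C_tail _ _ H2); intros n; f_equal; lia.
Qed.

Lemma is_Zseries_opp_index (a : Z -> C) (S : C) : is_Zseries a S -> is_Zseries (fun l => a (- l)%Z) S.
Proof.
intros [s1 [s2 [H1 [H2 ->]]]].
exists (s2 + a 0%Z)%C, (s1 - a 0%Z)%C; split; [|split; [|ring]].
- exact (is_series_C_cons (fun n => a (- Z.of_nat n)%Z) _ H2).
- apply (is_series_ext (V := CR)) with (2 := is_series_C_tail _ _ H1); intros n; f_equal; lia.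
Qed.

Lemma is_series_zero (u : nat -> C) : (forall n, u n = RtoC 0) ->
  is_Cseries u (RtoC 0).
Proof.
intros E; apply (filterlim_ext (fun _ => RtoC 0 : CR)); [|apply filterlim_const].
intros n; induction n as [|n IH]; [rewrite sum_O; symmetry; apply E|].
rewrite sum_Sn, <- IH, E; change (RtoC 0 = RtoC 0 + RtoC 0)%C; ring.
Qed.

Lemma is_Zseries_delta (c : C) : is_Zseries (fun l => if Z.eq_dec l 0 then c else RtoC 0) c.
Proof.
exists (RtoC 0 + c)%C, (RtoC 0); split; [|split; [|ring]].
- apply (is_series_C_cons (fun n => if Z.eq_dec (Z.of_nat n) 0 then c else RtoC 0)).
  apply is_series_zero; intros n; destruct Z.eq_dec; [lia|reflexivity].
- apply is_series_zero; intros n; destruct Z.eq_dec; [lia|reflexivity].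
Qed.

(** The summable sequence used in all comparisons. *)
Definition Zweight (l : Z) : R := / (1 + Rabs (IZR l)) ^ 2.

Lemma is_series_telescope : is_series (V := R_NormedModule) (fun n => 2 * (/ INR (S n) - / INR (S (S n)))) 2.
Proof.
unfold is_series.
apply (filterlim_ext (fun n => 2 * (1 - / INR (S (S n))))).
{ intros n; induction n as [|n IH]; [rewrite sum_O; simpl; field|].
  rewrite sum_Sn, <- IH; change plus with Rplus; simpl; ring. }
change (is_lim_seq (fun n => 2 * (1 - / INR (S (S n)))) 2).
replace (Finite 2) with (Rbar_mult 2 (1 - 0)) by (simpl; f_equal; ring).
apply (is_lim_seq_scal_l (fun n => 1 - / INR (S (S n))) 2 (1 - 0)).
apply is_lim_seq_minus'; [apply is_lim_seq_const|].
apply (is_lim_seq_incr_1 (fun n => / INR (S n))), is_lim_seq_inv_succ.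
Qed.

Lemma inv_square_le (x : R) : 0 <= x -> / (1 + x) ^ 2 <= 2 * (/ (x + 1) - / (x + 1 + 1)).
Proof.
intros Hx; replace (2 * (/ (x + 1) - / (x + 1 + 1))) with (2 / ((x + 1) * (x + 2))) by (field; lra).
apply Rle_div_r; [nra|]. rewrite Rmult_comm. apply Rle_div_l; [nra|]. nra.
Qed.

Lemma Zweight_nonneg_le (n : nat) : Zweight (Z.of_nat n) <= 2 * (/ INR (S n) - / INR (S (S n))).
Proof.
unfold Zweight; rewrite !S_INR, <- INR_IZR_INZ, Rabs_pos_eq by apply pos_INR.
apply inv_square_le, pos_INR.
Qed.

Lemma Zweight_neg_le (n : nat) : Zweight (- Z.of_nat (S n)) <= 2 * (/ INR (S n) - / INR (S (S n))).
Proof.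
unfold Zweight; rewrite opp_IZR, Rabs_Ropp, <- INR_IZR_INZ, Rabs_pos_eq by apply pos_INR.
apply Rle_trans with (/ (1 + INR n) ^ 2).
- pose proof (pos_INR n); apply Rinv_le_contravar; [nra|]. rewrite S_INR; nra.
- rewrite !S_INR; apply inv_square_le, pos_INR.
Qed.

Lemma is_series_Cmod_le (u : nat -> C) (b : nat -> R) (s : C) (t : R) :
  (forall n, Cmod (u n) <= b n) ->
  is_Cseries u s -> is_series (V := R_NormedModule) b t -> Cmod s <= t.
Proof.
intros H Hu Hb; rewrite <- norm_Cmod.
change (Rbar_le (norm (K := R_AbsRing) (V := CR) s) t).
apply (is_lim_seq_le (fun n => norm (K := R_AbsRing) (V := CR) (sum_n u n)) (sum_n b)
  (norm (K := R_AbsRing) (V := CR) s) t).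
- intros n; apply Rle_trans with (1 := norm_sum_n_m (K := R_AbsRing) (V := CR) u 0 n).
  apply sum_n_m_le; intros k; rewrite norm_Cmod; apply H.
- exact (filterlim_comp _ _ _ _ _ _ _ _ Hu (filterlim_norm (K := R_AbsRing) (V := CR) s)).
- exact Hb.
Qed.

Lemma is_Zseries_Cmod_le (a : Z -> C) (B : R) (S : C) :
  0 <= B -> (forall l, Cmod (a l) <= B * Zweight l) -> is_Zseries a S -> Cmod S <= 4 * B.
Proof.
intros HB H [s1 [s2 [H1 [H2 ->]]]].
pose proof (is_series_scal_l (V := R_NormedModule) B _ _ is_series_telescope) as HT.
apply Rle_trans with (1 := Cmod_triangle s1 s2).
assert (Cmod s1 <= scal B 2).
{ apply (is_series_Cmod_le _ _ _ _) with (2 := H1) (3 := HT).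
  intros n; apply Rle_trans with (1 := H _); apply Rmult_le_compat_l; [exact HB|apply Zweight_nonneg_le]. }
assert (Cmod s2 <= scal B 2).
{ apply (is_series_Cmod_le _ _ _ _) with (2 := H2) (3 := HT).
  intros n; apply Rle_trans with (1 := H _); apply Rmult_le_compat_l; [exact HB|apply Zweight_neg_le]. }
change (scal B 2) with (B * 2) in *; lra.
Qed.

Lemma ex_is_Zseries (a : Z -> C) (B : R) :
  0 <= B -> (forall l, Cmod (a l) <= B * Zweight l) -> exists S, is_Zseries a S.
Proof.
intros HB H.
assert (HT : ex_series (V := R_NormedModule) (fun n => B * (2 * (/ INR (S n) - / INR (S (S n)))))).
{ eexists; exact (is_series_scal_l (V := R_NormedModule) B _ _ is_series_telescope). }
assert (E1 : ex_series (K := R_AbsRing) (V := CR) (fun n => a (Z.of_nat n))).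
{ apply (ex_series_le (V := C_R_CompleteNormedModule)) with (2 := HT).
  intros n; eapply Rle_trans; [right; apply norm_Cmod|].
  apply Rle_trans with (1 := H _); apply Rmult_le_compat_l; [exact HB|apply Zweight_nonneg_le]. }
assert (E2 : ex_series (K := R_AbsRing) (V := CR) (fun n => a (- Z.of_nat (S n))%Z)).
{ apply (ex_series_le (V := C_R_CompleteNormedModule)) with (2 := HT).
  intros n; eapply Rle_trans; [right; apply norm_Cmod|].
  apply Rle_trans with (1 := H _); apply Rmult_le_compat_l; [exact HB|apply Zweight_neg_le]. }
destruct E1 as [s1 H1]; destruct E2 as [s2 H2]; exists (s1 + s2)%C, s1, s2; auto.
Qed.

(** Quadratic remainders of the terms add up to a quadratic remainder. *)
Lemma is_derive_Zseries (F dF : Z -> R -> C) (f : R -> C) (x : R) (g : C) (B : R) :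
  0 <= B ->
  (forall t, is_Zseries (fun l => F l t) (f t)) -> is_Zseries (fun l => dF l x) g ->
  (forall l h, Cmod (F l (x + h) - F l x - RtoC h * dF l x) <= h ^ 2 * B * Zweight l) ->
  is_Cderive f x g.
Proof.
intros HB HF HdF H.
apply (is_derive_quadratic (V := CR)) with (4 * B); intros h.
rewrite norm_Cmod.
change (Cmod (f (x + h)%R - f x - scal (V := CR) h g) <= 4 * B * h ^ 2).
rewrite scal_R_Cmult.
replace (4 * B * h ^ 2) with (4 * (h ^ 2 * B)) by ring.
apply (is_Zseries_Cmod_le (fun l => F l (x + h)%R - F l x - RtoC h * dF l x)%C); [nra|intros l; apply (H l h)|].
replace (f (x + h)%R - f x - RtoC h * g)%C with (f (x + h)%R + - (1) * f x + - RtoC h * g)%C by ring.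
apply (is_Zseries_ext (fun l => F l (x + h)%R + - (1) * F l x + - RtoC h * dF l x)%C).
{ intros l; ring. }
apply is_Zseries_plus; [apply is_Zseries_plus; [apply HF|]|]; apply is_Zseries_Cmult; auto.
Qed.
(** * Fourier series with coefficients 1/(y_l)_m *)

(** Passing from l to l - 1 adds 1 to the node, so shifting the index of a series
    shifts the rising factorials of the nodes. *)
Definition node (alpha : R) (l : Z) : R := (alpha - 1) / 2 - IZR l.

(** For these alpha the nodes avoid the integers. *)
Definition admissible (alpha : R) : Prop := 0 < alpha < 2 /\ alpha <> 1.

Lemma node_pred (alpha : R) (l : Z) : node alpha (l - 1) = node alpha l + 1.
Proof. unfold node; rewrite minus_IZR; ring. Qed.

Lemma IZR_Rabs_ge_1 (m : Z) : m <> 0%Z -> 1 <= Rabs (IZR m).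
Proof. intros Hm; rewrite <- abs_IZR; apply IZR_le; lia. Qed.

(** A nonzero g with |g| < 1/2 satisfies |g - m| >= |g|/2 (1 + |m|) for every
    integer m; here g = (alpha - 1)/2 and m = l - i. *)
Lemma node_lower (alpha : R) : admissible alpha ->
  exists c, 0 < c /\ forall (l : Z) (i : nat), c / (1 + INR i) * (1 + Rabs (IZR l)) <= Rabs (node alpha l + INR i).
Proof.
intros [Ha Ha1]; set (g := (alpha - 1) / 2).
assert (Hg : 0 < Rabs g) by (apply Rabs_pos_lt; unfold g; intros E; apply Ha1; lra).
assert (Hg2 : Rabs g < / 2) by (apply Rabs_def1; unfold g; lra).
exists (Rabs g / 2); split; [lra|]; intros l i.
assert (H1 : Rabs g / 2 * (1 + Rabs (IZR (l - Z.of_nat i))) <= Rabs (node alpha l + INR i)).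
{ replace (node alpha l + INR i) with (g - IZR (l - Z.of_nat i))
    by (unfold node, g; rewrite minus_IZR, <- INR_IZR_INZ; ring).
  set (m := (l - Z.of_nat i)%Z).
  destruct (Z.eq_dec m 0) as [->|Hm].
  - rewrite Rabs_R0, Rminus_0_r; lra.
  - pose proof (IZR_Rabs_ge_1 m Hm) as Hm1.
    pose proof (Rabs_triang_inv (IZR m) g) as H; rewrite Rabs_minus_sym in H. nra. }
apply Rle_trans with (2 := H1).
rewrite minus_IZR, <- INR_IZR_INZ.
pose proof (pos_INR i) as Hi.
pose proof (Rabs_triang (IZR l - INR i) (INR i)) as HT.
replace (IZR l - INR i + INR i) with (IZR l) in HT by ring.
rewrite (Rabs_pos_eq (INR i)) in HT by assumption.
replace (Rabs g / 2 / (1 + INR i) * (1 + Rabs (IZR l))) with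
  (Rabs g / 2 * ((1 + Rabs (IZR l)) / (1 + INR i))) by (field; lra).
apply Rmult_le_compat_l; [lra|]. apply Rle_div_l; [lra|].
pose proof (Rabs_pos (IZR l - INR i)); nra.
Qed.

Lemma rising_node_lower (alpha : R) (m : nat) : admissible alpha ->
  exists c, 0 < c /\ forall l : Z, c * (1 + Rabs (IZR l)) ^ m <= Rabs (rising (node alpha l) m).
Proof.
intros Ha; induction m as [|m [c [Hc IH]]].
- exists 1; split; [lra|]; intros l; simpl; rewrite Rabs_R1; lra.
- destruct (node_lower alpha Ha) as [d [Hd H]].
  assert (Hd' : 0 < d / (1 + INR m)) by (apply Rdiv_lt_0_compat; [assumption|pose proof (pos_INR m); lra]).
  exists (c * (d / (1 + INR m))); split; [apply Rmult_lt_0_compat; assumption|].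
  intros l; simpl rising; rewrite Rabs_mult.
  pose proof (Rabs_pos (IZR l)) as Hl.
  replace (c * (d / (1 + INR m)) * (1 + Rabs (IZR l)) ^ S m) with
    ((c * (1 + Rabs (IZR l)) ^ m) * (d / (1 + INR m) * (1 + Rabs (IZR l)))) by (simpl; ring).
  apply Rmult_le_compat; [|apply Rmult_le_pos; lra|apply IH|apply H].
  apply Rmult_le_pos; [lra|apply pow_le; lra].
Qed.

Lemma rising_node_neq_0 (alpha : R) (m : nat) (l : Z) : admissible alpha -> rising (node alpha l) m <> 0.
Proof.
intros Ha E; destruct (rising_node_lower alpha m Ha) as [c [Hc H]]; specialize (H l).
rewrite E, Rabs_R0 in H.
assert (0 < c * (1 + Rabs (IZR l)) ^ m); [|lra].
apply Rmult_lt_0_compat; [assumption|apply pow_lt; pose proof (Rabs_pos (IZR l)); lra].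
Qed.

Lemma node_neq_0 (alpha : R) (l : Z) (i : nat) : admissible alpha -> node alpha l + INR i <> 0.
Proof.
intros Ha E; destruct (node_lower alpha Ha) as [c [Hc H]]; specialize (H l i).
rewrite E, Rabs_R0 in H.
assert (0 < c / (1 + INR i) * (1 + Rabs (IZR l))); [|lra].
apply Rmult_lt_0_compat; [apply Rdiv_lt_0_compat; [|pose proof (pos_INR i)]|pose proof (Rabs_pos (IZR l))]; lra.
Qed.

Lemma inv_rising_node_le (alpha : R) (m : nat) : admissible alpha ->
  exists B, 0 <= B /\ forall l : Z, (1 + Rabs (IZR l)) ^ m * Rabs (/ rising (node alpha l) (m + 2)) <= B * Zweight l.
Proof.
intros Ha; destruct (rising_node_lower alpha (m + 2) Ha) as [c [Hc H]].
exists (/ c); split; [apply Rlt_le, Rinv_0_lt_compat, Hc|]; intros l; specialize (H l).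
unfold Zweight; rewrite Rabs_inv.
pose proof (Rabs_pos (IZR l)); set (L := 1 + Rabs (IZR l)) in *.
assert (0 < L) by (unfold L; lra).
assert (HL : 0 < L ^ m) by (apply pow_lt; assumption).
assert (HL2 : 0 < L ^ 2) by (apply pow_lt; assumption).
rewrite pow_add in H.
assert (0 < c * (L ^ m * L ^ 2)) by (apply Rmult_lt_0_compat; [|apply Rmult_lt_0_compat]; assumption).
apply Rle_trans with (L ^ m * / (c * (L ^ m * L ^ 2))).
- apply Rmult_le_compat_l; [lra|]. apply Rinv_le_contravar; assumption.
- right; field; repeat split; lra.
Qed.

Lemma Cmod_expi (t : R) : Cmod (expi t) = 1.
Proof.
unfold Cmod, expi; simpl; pose proof (sin2_cos2 t) as H; unfold Rsqr in H.
replace (cos t * (cos t * 1) + sin t * (sin t * 1)) with 1 by lra; apply sqrt_1.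
Qed.

(** The term e^(2ils)/(y_l)_m, modulated by a factor that does not depend on l
    and centres the frequencies: sums of consecutive levels m are then related
    by real trigonometric functions, up to the factor -2i. *)
Definition wave (alpha : R) (m : nat) (l : Z) (s : R) : C :=
  (RtoC (/ rising (node alpha l) m) * expi (- (2 * node alpha l + INR m - 1) * s))%C.

Lemma Cmod_wave (alpha : R) (m : nat) (l : Z) (s : R) :
  Cmod (wave alpha m l s) = Rabs (/ rising (node alpha l) m).
Proof. unfold wave; rewrite Cmod_mult, Cmod_R, Cmod_expi; ring. Qed.

Definition wave_sum (alpha : R) (m : nat) (s : R) : C := Zseries (fun l => wave alpha m l s).

Lemma is_Zseries_wave (alpha : R) (m : nat) (s : R) : admissible alpha -> (2 <= m)%nat ->
  is_Zseries (fun l => wave alpha m l s) (wave_sum alpha m s).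
Proof.
intros Ha Hm; destruct (inv_rising_node_le alpha (m - 2) Ha) as [B [HB H]].
replace (m - 2 + 2)%nat with m in H by lia.
destruct (ex_is_Zseries (fun l => wave alpha m l s) B HB) as [S HS].
- intros l; rewrite Cmod_wave; apply Rle_trans with (2 := H l).
  rewrite <- (Rmult_1_l (Rabs (/ _))) at 1; apply Rmult_le_compat_r; [apply Rabs_pos|].
  apply pow_R1_Rle; pose proof (Rabs_pos (IZR l)); lra.
- unfold wave_sum; rewrite (proj2 (is_Zseries_unique _ _ HS)); exact HS.
Qed.

Lemma wave_shift (alpha : R) (m : nat) (l : Z) (s : R) :
  (expi s * wave alpha m (l - 1) s)%C =
  (RtoC (/ rising (node alpha l + 1) m) * expi (- (2 * node alpha l + INR m) * s))%C.
Proof.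
unfold wave; rewrite node_pred.
replace (expi (- (2 * node alpha l + INR m) * s)) with
  (expi s * expi (- (2 * (node alpha l + 1) + INR m - 1) * s))%C by (rewrite <- expi_plus; f_equal; ring).
ring.
Qed.

Lemma wave_noshift (alpha : R) (m : nat) (l : Z) (s : R) :
  (expi (- s) * wave alpha m l s)%C =
  (RtoC (/ rising (node alpha l) m) * expi (- (2 * node alpha l + INR m) * s))%C.
Proof.
unfold wave.
replace (expi (- (2 * node alpha l + INR m) * s)) with
  (expi (- s) * expi (- (2 * node alpha l + INR m - 1) * s))%C by (rewrite <- expi_plus; f_equal; ring).
ring.
Qed.

Lemma rising_succ_shift (y : R) (m : nat) : y * rising (y + 1) m = rising y m * (y + INR m).
Proof. rewrite <- rising_shift; reflexivity. Qed.

Lemma expi_minus_expi (s : R) : (expi (- s) - expi s)%C = (- 2 * Ci * RtoC (sin s))%C.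
Proof. unfold expi; rewrite cos_neg, sin_neg; apply injective_projections; simpl; ring. Qed.

Lemma expi_plus_expi (s : R) : (expi (- s) + expi s)%C = (2 * RtoC (cos s))%C.
Proof. unfold expi; rewrite cos_neg, sin_neg; apply injective_projections; simpl; ring. Qed.

Lemma wave_rising_facts (alpha : R) (m : nat) (l : Z) : admissible alpha ->
  let y := node alpha l in
  y <> 0 /\ y + INR m <> 0 /\ rising y m <> 0 /\ rising (y + 1) m <> 0 /\
  rising y (S m) = rising y m * (y + INR m) /\ rising (y + 1) m = rising y m * (y + INR m) / y.
Proof.
intros Ha y.
assert (Hy : y <> 0) by (rewrite <- (Rplus_0_r y); exact (node_neq_0 alpha l 0 Ha)).
assert (E : rising (y + 1) m = rising y m * (y + INR m) / y) by (rewrite <- rising_succ_shift; field; exact Hy).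
repeat split; auto.
- apply node_neq_0, Ha.
- apply rising_node_neq_0, Ha.
- unfold y; rewrite <- node_pred; apply rising_node_neq_0, Ha.
Qed.

(** From 1/(y)_m - 1/(y + 1)_m = m/(y)_(m+1), where y_l + 1 = y_(l-1) is undone by
    shifting the index. *)
Lemma wave_sum_succ (alpha : R) (m : nat) (s : R) : admissible alpha -> (2 <= m)%nat ->
  (RtoC (INR m) * wave_sum alpha (S m) s = - 2 * Ci * RtoC (sin s) * wave_sum alpha m s)%C.
Proof.
intros Ha Hm.
pose proof (is_Zseries_wave alpha m s Ha Hm) as H0.
pose proof (is_Zseries_wave alpha (S m) s Ha ltac:(lia)) as H1.
apply (is_Zseries_inj (fun l => RtoC (INR m) * wave alpha (S m) l s)%C); [apply is_Zseries_Cmult, H1|].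
rewrite <- expi_minus_expi.
replace ((expi (- s) - expi s) * wave_sum alpha m s)%C with
  (expi (- s) * wave_sum alpha m s + - (1) * (expi s * wave_sum alpha m s))%C by ring.
apply (is_Zseries_ext (fun l => expi (- s) * wave alpha m l s + - (1) * (expi s * wave alpha m (l - 1) s))%C).
- intros l; rewrite wave_shift, wave_noshift; unfold wave; rewrite S_INR.
  replace (- (2 * node alpha l + (INR m + 1) - 1) * s) with (- (2 * node alpha l + INR m) * s) by ring.
  destruct (wave_rising_facts alpha m l Ha) as (H2 & H3 & H4 & H5 & H6 & H7).
  replace (- (1))%C with (RtoC (-1)) by C_components.
  rewrite !Cmult_assoc, <- !RtoC_mult, <- Cmult_plus_distr_r, <- RtoC_plus; f_equal; f_equal.
  rewrite H6, H7; field; auto.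
- apply is_Zseries_plus; [apply is_Zseries_Cmult, H0|].
  apply is_Zseries_Cmult, (is_Zseries_Cmult (fun l => wave alpha m (l - 1) s)).
  exact (is_Zseries_shift _ _ H0).
Qed.

Lemma sin_le_Rabs (t : R) : Rabs (sin t) <= Rabs t.
Proof.
assert (H : forall t, 0 <= t -> Rabs (sin t) <= t).
{ intros u Hu; destruct (Rle_dec u 1) as [H1|H1].
  - destruct Hu as [Hu|<-]; [|rewrite sin_0, Rabs_R0; lra].
    rewrite Rabs_pos_eq; [apply Rlt_le, sin_lt_x, Hu|].
    apply sin_ge_0; [lra|]. pose proof PI2_1; lra.
  - pose proof (SIN_bound u); apply Rle_trans with 1; [apply Rabs_le; lra|lra]. }
destruct (Rle_dec 0 t) as [H0|H0].
- rewrite (Rabs_pos_eq t) by assumption; apply H, H0.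
- rewrite <- Rabs_Ropp, <- sin_neg, <- (Rabs_Ropp t), (Rabs_pos_eq (- t)) by lra; apply H; lra.
Qed.

Lemma one_minus_cos_le (t : R) : 0 <= 1 - cos t <= t ^ 2 / 2.
Proof.
assert (E : 1 - cos t = 2 * (sin (t / 2) * sin (t / 2))).
{ replace t with (2 * (t / 2)) at 1 by field; rewrite cos_2a_sin; ring. }
rewrite E; pose proof (sin_le_Rabs (t / 2)) as H.
pose proof (Rabs_pos (sin (t / 2))).
assert (H2 : Rabs (sin (t / 2)) ^ 2 <= Rabs (t / 2) ^ 2) by (apply pow_incr; lra).
rewrite !pow2_abs in H2; split; nra.
Qed.

Lemma sin_minus_id_le (t : R) : Rabs (sin t - t) <= t ^ 2.
Proof.
destruct (MVT_gen (fun u => sin u - u) 0 t (fun u => cos u - 1)) as [c [Hc E]].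
- intros u Hu; auto_derive; auto; ring.
- intros u Hu; apply continuity_pt_filterlim.
  apply (continuous_of_ex_derive (fun v => sin v - v) u); auto_derive; auto.
- rewrite sin_0, !Rminus_0_r in E; rewrite E, Rabs_mult.
  assert (Hct : Rabs c <= Rabs t).
  { destruct (Rle_dec 0 t).
    - rewrite Rmin_left, Rmax_right in Hc by assumption; rewrite !Rabs_pos_eq; lra.
    - rewrite Rmin_right, Rmax_left in Hc by lra; rewrite !Rabs_left1; lra. }
  assert (Hcos : Rabs (cos c - 1) <= Rabs c).
  { pose proof (one_minus_cos_le c) as H; pose proof (COS_bound c).
    rewrite Rabs_minus_sym, Rabs_pos_eq by lra.
    rewrite <- pow2_abs in H; pose proof (Rabs_pos c).
    destruct (Rle_dec (Rabs c) 2); nra. }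
  rewrite <- pow2_abs; pose proof (Rabs_pos c); pose proof (Rabs_pos t); nra.
Qed.

Lemma Cmod_le_sum (z : C) : Cmod z <= Rabs (fst z) + Rabs (snd z).
Proof.
unfold Cmod; rewrite <- (sqrt_Rsqr (Rabs (fst z) + Rabs (snd z)))
  by (pose proof (Rabs_pos (fst z)); pose proof (Rabs_pos (snd z)); lra).
apply sqrt_le_1_alt; unfold Rsqr.
rewrite <- (pow2_abs (fst z)), <- (pow2_abs (snd z)).
pose proof (Rabs_pos (fst z)); pose proof (Rabs_pos (snd z)); nra.
Qed.

(** Second order remainder of the exponential, with a constant that is uniform in
    the frequency up to its square. *)
Lemma expi_taylor (w s h : R) :
  Cmod (expi (w * (s + h)) - expi (w * s) - RtoC h * (Ci * RtoC w * expi (w * s)))%C <= h ^ 2 * (2 * w ^ 2).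
Proof.
replace (expi (w * (s + h)) - expi (w * s) - RtoC h * (Ci * RtoC w * expi (w * s)))%C
  with (expi (w * s) * (expi (w * h) - 1 - Ci * RtoC (w * h)))%C.
2:{ rewrite Rmult_plus_distr_l, expi_plus, RtoC_mult; ring. }
rewrite Cmod_mult, Cmod_expi, Rmult_1_l.
set (t := w * h); replace (h ^ 2 * (2 * w ^ 2)) with (2 * t ^ 2) by (unfold t; ring).
apply Rle_trans with (1 := Cmod_le_sum _); unfold expi; simpl.
replace (cos t + - (1) + - (0 * t - 1 * 0)) with (- (1 - cos t)) by ring.
replace (sin t + - 0 + - (0 * 0 + 1 * t)) with (sin t - t) by ring.
pose proof (one_minus_cos_le t); pose proof (sin_minus_id_le t).
rewrite Rabs_Ropp, Rabs_pos_eq by lra. simpl in *; nra.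
Qed.

(** The frequency 2y + 3 = y + (y + 3) splits the derivative of each term into two
    terms of level 3.  Level 4 is the first one where the second derivatives of
    the terms, of order l^2/l^4, are summable. *)
Lemma is_derive_wave_sum (alpha s : R) : admissible alpha ->
  is_Cderive (wave_sum alpha 4) s
    (- 2 * Ci * RtoC (cos s) * wave_sum alpha 3 s)%C.
Proof.
intros Ha.
destruct (inv_rising_node_le alpha 2 Ha) as [B [HB H]].
set (W := fun l => - (2 * node alpha l + INR 4 - 1)).
apply (is_derive_Zseries (wave alpha 4) (fun l s => Ci * RtoC (W l) * wave alpha 4 l s)%C _ s _ (2 * 36 * B)).
- lra.
- intros t; apply is_Zseries_wave; [exact Ha|lia].
- pose proof (is_Zseries_wave alpha 3 s Ha ltac:(lia)) as H0.
  replace (- 2 * Ci * RtoC (cos s) * wave_sum alpha 3 s)%C with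
    (- Ci * (expi (- s) * wave_sum alpha 3 s) + - Ci * (expi s * wave_sum alpha 3 s))%C.
  2:{ transitivity (- Ci * (expi (- s) + expi s) * wave_sum alpha 3 s)%C; [ring|].
      rewrite expi_plus_expi; ring. }
  apply (is_Zseries_ext (fun l => - Ci * (expi (- s) * wave alpha 3 l s) + - Ci * (expi s * wave alpha 3 (l - 1) s))%C).
  + intros l; rewrite wave_shift, wave_noshift; unfold wave, W.
    destruct (wave_rising_facts alpha 3 l Ha) as (H2 & H3 & H4 & H5 & H6 & H7).
    replace (- (2 * node alpha l + INR 4 - 1) * s) with (- (2 * node alpha l + INR 3) * s) by (simpl; ring).
    replace (- Ci)%C with (Ci * RtoC (-1))%C by C_components.
    set (e := expi _).
    transitivity (Ci * RtoC (-1 * / rising (node alpha l) 3 + -1 * / rising (node alpha l + 1) 3) * e)%C.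
    { rewrite RtoC_plus, !RtoC_mult; ring. }
    transitivity (Ci * RtoC (- (2 * node alpha l + INR 4 - 1) * / rising (node alpha l) 4) * e)%C;
      [|rewrite RtoC_mult; ring].
    f_equal; f_equal; f_equal.
    change (rising (node alpha l) 4) with (rising (node alpha l) (S 3)).
    rewrite H6, H7; simpl INR in *; field; repeat split; try assumption; lra.
  + apply is_Zseries_plus; apply is_Zseries_Cmult.
    * apply is_Zseries_Cmult, H0.
    * apply (is_Zseries_Cmult (fun l => wave alpha 3 (l - 1) s)). exact (is_Zseries_shift _ _ H0).
- intros l h; unfold wave.
  replace (RtoC (/ rising (node alpha l) 4) * expi (- (2 * node alpha l + INR 4 - 1) * (s + h))
    - RtoC (/ rising (node alpha l) 4) * expi (- (2 * node alpha l + INR 4 - 1) * s)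
    - RtoC h * (Ci * RtoC (W l) * (RtoC (/ rising (node alpha l) 4) * expi (- (2 * node alpha l + INR 4 - 1) * s))))%C
  with (RtoC (/ rising (node alpha l) 4) * (expi (W l * (s + h)) - expi (W l * s) - RtoC h * (Ci * RtoC (W l) * expi (W l * s))))%C
  by (unfold W; ring).
  rewrite Cmod_mult, Cmod_R.
  assert (HW : W l ^ 2 <= 36 * (1 + Rabs (IZR l)) ^ 2).
  { assert (Rabs (W l) <= 6 * (1 + Rabs (IZR l))).
    { unfold W, node; simpl INR. destruct Ha as [Ha _].
      replace (- (2 * ((alpha - 1) / 2 - IZR l) + (1 + 1 + 1 + 1) - 1)) with (2 * IZR l - (alpha + 2)) by field.
      unfold Rminus; apply Rle_trans with (1 := Rabs_triang _ _).
      rewrite Rabs_mult, Rabs_Ropp, (Rabs_pos_eq 2), (Rabs_pos_eq (alpha + 2)) by lra.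
      pose proof (Rabs_pos (IZR l)); lra. }
    rewrite <- pow2_abs; pose proof (Rabs_pos (W l)).
    replace (36 * (1 + Rabs (IZR l)) ^ 2) with ((6 * (1 + Rabs (IZR l))) ^ 2) by ring.
    apply pow_incr; lra. }
  specialize (H l); replace (2 + 2)%nat with 4%nat in H by lia.
  set (R4 := Rabs (/ rising (node alpha l) 4)) in *.
  assert (0 <= R4) by apply Rabs_pos.
  apply Rle_trans with (R4 * (h ^ 2 * (2 * W l ^ 2))).
  + apply Rmult_le_compat_l; [assumption|apply expi_taylor].
  + apply Rle_trans with (h ^ 2 * 72 * ((1 + Rabs (IZR l)) ^ 2 * R4)).
    * replace (R4 * (h ^ 2 * (2 * W l ^ 2))) with (h ^ 2 * 2 * R4 * W l ^ 2) by ring.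
      replace (h ^ 2 * 72 * ((1 + Rabs (IZR l)) ^ 2 * R4)) with (h ^ 2 * 2 * R4 * (36 * (1 + Rabs (IZR l)) ^ 2)) by ring.
      apply Rmult_le_compat_l; [|exact HW].
      pose proof (pow2_ge_0 h); apply Rmult_le_pos; [lra|assumption].
    * replace (h ^ 2 * (2 * 36 * B) * Zweight l) with (h ^ 2 * 72 * (B * Zweight l)) by ring.
      apply Rmult_le_compat_l; [pose proof (pow2_ge_0 h); lra|exact H].
Qed.
Lemma RtoC_neq_0 (r : R) : r <> 0 -> RtoC r <> 0%C.
Proof. intros H E; injection E; exact H. Qed.

(** The recurrence and the derivative give U' = 3 cot(s) U, so U/sin^3 is
    constant. *)
Lemma wave_sum_4_sin (alpha s : R) : admissible alpha -> 0 < s < PI ->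
  wave_sum alpha 4 s = (wave_sum alpha 4 (PI / 2) * RtoC (sin s ^ 3))%C.
Proof.
intros Ha Hs.
set (f := fun t => (RtoC (/ sin t ^ 3) * wave_sum alpha 4 t)%C).
assert (Hf : forall t, 0 < t < PI -> is_Cderive f t (RtoC 0)).
{ intros t Ht; assert (Hsin : 0 < sin t) by (apply sin_gt_0; lra).
  assert (H1 : is_derive (fun t => / sin t ^ 3) t (- (3 * cos t) / sin t ^ 4)).
  { auto_derive; [repeat apply Rmult_integral_contrapositive_currified; lra|field; lra]. }
  pose proof (is_derive_Cmult _ _ _ _ _ (is_derive_RtoC _ _ _ H1) (is_derive_wave_sum alpha t Ha)) as H.
  exact_up_to_value H.
  pose proof (wave_sum_succ alpha 3 t Ha ltac:(lia)) as E.
  replace (INR 3) with 3 in E by (simpl; ring).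
  assert (E4 : wave_sum alpha 4 t = (- 2 * Ci * RtoC (sin t) * wave_sum alpha 3 t * RtoC (/ 3))%C).
  { rewrite <- E, RtoC_inv by lra; field. }
  rewrite E4.
  transitivity (RtoC (- (3 * cos t) / sin t ^ 4 * sin t * / 3 + / sin t ^ 3 * cos t) * (- 2 * Ci * wave_sum alpha 3 t))%C.
  - rewrite RtoC_plus, !RtoC_mult; ring.
  - replace (- (3 * cos t) / sin t ^ 4 * sin t * / 3 + / sin t ^ 3 * cos t) with 0 by (field; lra); ring. }
assert (E : f s = f (PI / 2)).
{ destruct (Rtotal_order s (PI / 2)) as [H|[->|H]]; [|reflexivity|symmetry];
    apply (eq_is_derive (V := CR)); auto; intros t Ht; apply Hf; pose proof PI_RGT_0; lra. }
assert (Hsin : 0 < sin s) by (apply sin_gt_0; lra).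
unfold f in E; rewrite sin_PI2 in E.
replace (/ 1 ^ 3) with 1 in E by field.
transitivity (RtoC (/ sin s ^ 3) * wave_sum alpha 4 s * RtoC (sin s ^ 3))%C; [|rewrite E; ring].
rewrite RtoC_inv by (apply pow_nonzero; lra); field.
apply RtoC_neq_0, pow_nonzero; lra.
Qed.

Lemma wave_sum_3_sin (alpha : R) : admissible alpha ->
  exists kappa : C, forall s, 0 <= s <= PI -> wave_sum alpha 3 s = (kappa * RtoC (sin s ^ 2))%C.
Proof.
intros Ha; exists (wave_sum alpha 4 (PI / 2) * (RtoC (3 / 2) * Ci))%C; intros s Hs.
destruct (Req_dec (sin s) 0) as [E|Hsin].
- pose proof (wave_sum_succ alpha 2 s Ha (le_n 2)) as H.
  rewrite E in *; replace (INR 2) with 2 in H by (simpl; ring).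
  transitivity (RtoC (/ 2) * (RtoC 2 * wave_sum alpha 3 s))%C.
  + rewrite RtoC_inv by lra; field; apply RtoC_neq_0; lra.
  + rewrite H; replace (0 ^ 2) with 0 by ring; ring.
- assert (Hs' : 0 < s < PI).
  { split.
    - destruct (Rle_lt_or_eq_dec 0 s) as [H|H]; [tauto|exact H|].
      exfalso; apply Hsin; rewrite <- H; apply sin_0.
    - destruct (Rle_lt_or_eq_dec s PI) as [H|H]; [tauto|exact H|].
      exfalso; apply Hsin; rewrite H; apply sin_PI. }
  pose proof (wave_sum_succ alpha 3 s Ha ltac:(lia)) as H.
  rewrite (wave_sum_4_sin alpha s Ha Hs') in H.
  replace (INR 3) with 3 in H by (simpl; ring).
  set (K := wave_sum alpha 4 (PI / 2)) in *; set (U := wave_sum alpha 3 s) in *.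
  assert (HR : RtoC (sin s) <> 0%C) by (apply RtoC_neq_0, Hsin).
  transitivity ((- 2 * Ci * RtoC (sin s) * U) * (Ci * RtoC (/ 2) * / RtoC (sin s)))%C.
  + replace (- 2 * Ci * RtoC (sin s) * U * (Ci * RtoC (/ 2) * / RtoC (sin s)))%C with
      (- (Ci * Ci) * (2 * RtoC (/ 2)) * (RtoC (sin s) * / RtoC (sin s)) * U)%C by ring.
    rewrite Cinv_r by assumption; rewrite <- RtoC_mult; replace (2 * / 2) with 1 by field.
    rewrite Ci_sqr; ring.
  + rewrite <- H, !RtoC_pow; replace (3 / 2) with (3 * / 2) by field; rewrite RtoC_mult; field; assumption.
Qed.

Lemma expi_2PI (l : Z) : expi (2 * IZR l * PI) = RtoC 1.
Proof.
assert (H : forall n : nat, expi (INR n * (2 * PI)) = RtoC 1).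
{ intros n; rewrite <- expi_pow; replace (expi (2 * PI)) with (RtoC 1); [apply Cpow_1_l|].
  unfold expi; rewrite cos_2PI, sin_2PI; reflexivity. }
destruct (Z_le_gt_dec 0 l) as [Hl|Hl].
- rewrite <- (H (Z.to_nat l)); f_equal; rewrite INR_IZR_INZ, Z2Nat.id by assumption; ring.
- transitivity (/ expi (INR (Z.to_nat (- l)) * (2 * PI)))%C.
  + rewrite <- expi_opp; f_equal; rewrite INR_IZR_INZ, Z2Nat.id, opp_IZR by lia; ring.
  + rewrite H; field; apply C1_nz.
Qed.

Definition fourier_term (alpha : R) (m : nat) (s : R) (l : Z) : C :=
  (RtoC (/ rising (node alpha l) m) * expi (2 * IZR l * s))%C.

Definition fourier_sum (alpha : R) (m : nat) (s : R) : C :=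
  (expi ((alpha + INR m - 2) * s) * wave_sum alpha m s)%C.

Lemma is_Zseries_fourier (alpha : R) (m : nat) (s : R) : admissible alpha -> (2 <= m)%nat ->
  is_Zseries (fourier_term alpha m s) (fourier_sum alpha m s).
Proof.
intros Ha Hm; apply (is_Zseries_ext (fun l => expi ((alpha + INR m - 2) * s) * wave alpha m l s)%C).
- intros l; unfold wave, fourier_term.
  replace (2 * IZR l * s) with ((alpha + INR m - 2) * s + - (2 * node alpha l + INR m - 1) * s)
    by (unfold node; field).
  rewrite expi_plus; ring.
- apply is_Zseries_Cmult, is_Zseries_wave; assumption.
Qed.

(** Primitive of [fourier_term] of level 3, except at l = 0: there the primitive is
    linear, and leaving it out keeps the sum periodic. *)
Definition fourier_primitive (alpha : R) (l : Z) (s : R) : C :=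
  if Z.eq_dec l 0 then RtoC 0 else
  (RtoC (/ (2 * IZR l) * / rising (node alpha l) 3) * - Ci * expi (2 * IZR l * s))%C.

Lemma fourier_primitive_coef (l : Z) (r : R) : l <> 0%Z ->
  Rabs (/ (2 * IZR l) * r) <= (1 + Rabs (IZR l)) ^ 1 * Rabs r /\
  Rabs (/ (2 * IZR l) * r) * (2 * (2 * IZR l) ^ 2) <= 4 * ((1 + Rabs (IZR l)) ^ 1 * Rabs r).
Proof.
intros Hl; pose proof (IZR_Rabs_ge_1 l Hl) as H1; pose proof (Rabs_pos r) as Hr.
rewrite Rabs_mult, Rabs_inv, Rabs_mult, (Rabs_pos_eq 2) by lra.
rewrite <- (pow2_abs (2 * IZR l)), Rabs_mult, (Rabs_pos_eq 2) by lra.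
set (L := Rabs (IZR l)) in *.
assert (0 < / (2 * L) <= 1).
{ apply Rinv_le_1; lra. }
split.
- apply Rmult_le_compat_r; lra.
- replace (/ (2 * L) * Rabs r * (2 * (2 * L) ^ 2)) with (4 * (L * Rabs r)) by (field; lra).
  apply Rmult_le_compat_l; [lra|apply Rmult_le_compat_r; lra].
Qed.

Lemma is_derive_fourier_primitive (alpha s : R) : admissible alpha ->
  is_Cderive (fun t => Zseries (fun l => fourier_primitive alpha l t)) s
    (fourier_sum alpha 3 s - RtoC (/ rising (node alpha 0) 3))%C.
Proof.
intros Ha; destruct (inv_rising_node_le alpha 1 Ha) as [B [HB H]].
replace (1 + 2)%nat with 3%nat in H by lia.
apply (is_derive_Zseries (fourier_primitive alpha)
  (fun l s => fourier_term alpha 3 s l + (if Z.eq_dec l 0 then - RtoC (/ rising (node alpha 0) 3) else RtoC 0))%C _ s _ (4 * B)).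
- lra.
- intros t; destruct (ex_is_Zseries (fun l => fourier_primitive alpha l t) B HB) as [S HS].
  + intros l; unfold fourier_primitive; destruct Z.eq_dec as [E|E].
    * rewrite Cmod_0; apply Rmult_le_pos; [exact HB|].
      apply Rlt_le, Rinv_0_lt_compat, pow_lt; pose proof (Rabs_pos (IZR l)); lra.
    * rewrite !Cmod_mult, Cmod_opp, Cmod_Ci, Cmod_expi, Cmod_R, !Rmult_1_r.
      apply Rle_trans with (2 := H l); apply fourier_primitive_coef, E.
  + rewrite (proj2 (is_Zseries_unique _ _ HS)); exact HS.
- apply is_Zseries_plus; [apply is_Zseries_fourier; [exact Ha|lia]|apply is_Zseries_delta].
- intros l h; unfold fourier_primitive, fourier_term; destruct Z.eq_dec as [->|E].
  + replace (2 * 0 * s) with 0 by ring; rewrite expi_0.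
    replace (RtoC 0 - RtoC 0 - RtoC h * (RtoC (/ rising (node alpha 0) 3) * RtoC 1 + - RtoC (/ rising (node alpha 0) 3)))%C with (RtoC 0) by ring.
    rewrite Cmod_0; pose proof (pow2_ge_0 h).
    apply Rmult_le_pos; [apply Rmult_le_pos; lra|].
    apply Rlt_le, Rinv_0_lt_compat, pow_lt; rewrite Rabs_R0; lra.
  + set (w := 2 * IZR l); set (r := / rising (node alpha l) 3).
    assert (Hw : w <> 0) by (unfold w; apply not_0_IZR in E; lra).
    replace (RtoC (/ w * r) * - Ci * expi (w * (s + h)) - RtoC (/ w * r) * - Ci * expi (w * s)
       - RtoC h * (RtoC r * expi (w * s) + RtoC 0))%C with
     (RtoC (/ w * r) * - Ci * (expi (w * (s + h)) - expi (w * s) - RtoC h * (Ci * RtoC w * expi (w * s))))%C.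
    2:{ replace (RtoC r) with (RtoC (/ w * r) * RtoC w)%C
          by (rewrite <- RtoC_mult; f_equal; field; exact Hw).
        set (A := RtoC (/ w * r)).
        transitivity (A * - Ci * expi (w * (s + h)) - A * - Ci * expi (w * s) + (Ci * Ci) * A * RtoC h * RtoC w * expi (w * s))%C;
          [ring|].
        rewrite Ci_sqr; ring. }
    rewrite !Cmod_mult, Cmod_opp, Cmod_Ci, Cmod_R, Rmult_1_r.
    apply Rle_trans with (Rabs (/ w * r) * (h ^ 2 * (2 * w ^ 2))).
    * apply Rmult_le_compat_l; [apply Rabs_pos|apply expi_taylor].
    * replace (Rabs (/ w * r) * (h ^ 2 * (2 * w ^ 2))) with (h ^ 2 * (Rabs (/ w * r) * (2 * w ^ 2))) by ring.
      rewrite Rmult_assoc; apply Rmult_le_compat_l; [apply pow2_ge_0|].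
      apply Rle_trans with (4 * ((1 + Rabs (IZR l)) ^ 1 * Rabs r)).
      -- apply fourier_primitive_coef, E.
      -- rewrite Rmult_assoc; apply Rmult_le_compat_l; [lra|apply H].
Qed.

Lemma fourier_primitive_periodic (alpha : R) :
  Zseries (fun l => fourier_primitive alpha l PI) = Zseries (fun l => fourier_primitive alpha l 0).
Proof.
assert (E : forall l, fourier_primitive alpha l PI = fourier_primitive alpha l 0).
{ intros l; unfold fourier_primitive; destruct Z.eq_dec; [reflexivity|].
  rewrite expi_2PI, Rmult_0_r, expi_0; reflexivity. }
unfold Zseries, CSeries; f_equal; f_equal; apply Series_ext; intros n; rewrite E; reflexivity.
Qed.

(** A primitive of e^(i(alpha+1)s) sin^2 s. *)
Definition sin2_primitive (alpha s : R) : C :=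
  (RtoC (/ 4) * Ci * (RtoC (/ (alpha + 3)) * expi ((alpha + 3) * s) - RtoC (2 / (alpha + 1)) * expi ((alpha + 1) * s)
     + RtoC (/ (alpha - 1)) * expi ((alpha - 1) * s)))%C.

Lemma is_derive_expi_scaled (c w s : R) : w <> 0 ->
  is_Cderive (fun s => RtoC (c / w) * expi (w * s))%C s (RtoC c * Ci * expi (w * s))%C.
Proof.
intros Hw.
assert (H1 : is_derive (fun s => w * s) s w) by (auto_derive; auto; ring).
pose proof (is_derive_Cmult _ _ _ _ _ (is_Cderive_const (RtoC (c / w)) s)
  (is_derive_expi _ _ _ H1)) as H.
exact_up_to_value H.
replace c with (c / w * w) at 2 by (field; exact Hw); rewrite (RtoC_mult (c / w) w); ring.
Qed.

Lemma is_derive_sin2_primitive (alpha s : R) : admissible alpha ->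
  is_Cderive (sin2_primitive alpha) s
    (expi ((alpha + 1) * s) * RtoC (sin s ^ 2))%C.
Proof.
intros [Ha Ha1].
pose proof (is_derive_expi_scaled 1 (alpha + 3) s ltac:(lra)) as H1.
pose proof (is_derive_expi_scaled 2 (alpha + 1) s ltac:(lra)) as H2.
pose proof (is_derive_expi_scaled 1 (alpha - 1) s ltac:(lra)) as H3.
pose proof (is_derive_Cmult _ _ _ _ _ (is_Cderive_const (RtoC (/ 4) * Ci)%C s)
  (is_derive_plus (V := CR) _ _ _ _ _ (is_derive_minus (V := CR) _ _ _ _ _ H1 H2) H3)) as H.
apply (is_derive_ext (V := CR)) with (g := sin2_primitive alpha) in H.
2:{ intros t; unfold sin2_primitive; change (plus (G := CR)) with Cplus; change (minus (G := CR)) with Cminus.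
    unfold Rdiv; rewrite !Rmult_1_l; reflexivity. }
exact_up_to_value H.
change (plus (G := CR)) with Cplus; change (minus (G := CR)) with Cminus.
replace ((alpha + 3) * s) with ((alpha + 1) * s + (s + s)) by ring.
replace ((alpha - 1) * s) with ((alpha + 1) * s + (- s + - s)) by ring.
rewrite !expi_plus.
assert (E : ((expi s - expi (- s)) * (expi s - expi (- s)) = - RtoC 4 * RtoC (sin s ^ 2))%C).
{ unfold expi; rewrite cos_neg, sin_neg; apply injective_projections; simpl; ring. }
assert (E2 : (expi s * expi (- s) = RtoC 1)%C) by (rewrite <- expi_plus, Rplus_opp_r; apply expi_0).
set (e := expi ((alpha + 1) * s)); set (u := expi s) in *; set (v := expi (- s)) in *.
transitivity (RtoC (/ 4) * (Ci * Ci) * e * ((u - v) * (u - v) + RtoC 2 * (u * v - RtoC 1)))%C; [ring|].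
rewrite E, E2.
rewrite Ci_sqr.
rewrite RtoC_inv by lra; field; apply RtoC_neq_0; lra.
Qed.

Lemma expi_plus_odd_PI (t : R) (l : Z) : expi (t + (2 * IZR l + 1) * PI) = (- expi t)%C.
Proof.
replace (t + (2 * IZR l + 1) * PI) with (t + (2 * IZR l * PI + PI)) by ring.
rewrite !expi_plus, expi_2PI.
replace (expi PI) with (- (1))%C; [ring|].
unfold expi; rewrite cos_PI, sin_PI; apply injective_projections; simpl; ring.
Qed.

(** Integrate the sum of level 3 over (0, pi).  Term by term only l = 0 contributes,
    giving pi/(y_0)_3; integrating the closed form gives kappa times an explicit
    integral, in which the three denominators combine to the same (y_0)_3. *)
Lemma wave_constant (alpha : R) (kappa : C) : admissible alpha ->
  (forall s, 0 <= s <= PI -> wave_sum alpha 3 s = (kappa * RtoC (sin s ^ 2))%C) ->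
  (kappa * RtoC (cos (alpha * (PI / 2))) * expi (alpha * (PI / 2)) = RtoC (2 * PI) * Ci)%C.
Proof.
intros Ha Hk; pose proof PI_RGT_0 as HPI.
set (r0 := / rising (node alpha 0) 3).
set (Psi := fun s => (Zseries (fun l => fourier_primitive alpha l s) + RtoC (r0 * s) - kappa * sin2_primitive alpha s)%C).
assert (E : Psi 0 = Psi PI).
{ apply (eq_is_derive (V := CR)); [|exact HPI]; intros t Ht.
  assert (Hlin : is_derive (fun s => r0 * s) t r0) by (auto_derive; auto; ring).
  pose proof (is_derive_minus (V := CR) _ _ _ _ _ (is_derive_plus (V := CR) _ _ _ _ _
    (is_derive_fourier_primitive alpha t Ha) (is_derive_RtoC _ _ _ Hlin))
    (is_derive_Cmult _ _ _ _ _ (is_Cderive_const kappa t)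
      (is_derive_sin2_primitive alpha t Ha))) as H.
  exact_up_to_value H.
  unfold fourier_sum; rewrite Hk by assumption.
  replace (alpha + INR 3 - 2) with (alpha + 1) by (simpl; ring).
  fold r0; C_ring. }
unfold Psi in E; rewrite fourier_primitive_periodic in E.
set (Z0 := Zseries _) in E.
assert (E1 : (RtoC (r0 * PI) = kappa * (sin2_primitive alpha PI - sin2_primitive alpha 0))%C).
{ rewrite Rmult_0_r in E.
  transitivity ((Z0 + RtoC (r0 * PI) - kappa * sin2_primitive alpha PI) - Z0 + kappa * sin2_primitive alpha PI)%C; [ring|].
  rewrite <- E; ring. }
destruct Ha as [Ha Ha1].
assert (E2 : (sin2_primitive alpha PI - sin2_primitive alpha 0 =
   - RtoC (/ 4) * Ci * RtoC r0 * (RtoC 1 + expi (alpha * PI)))%C).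
{ unfold sin2_primitive; rewrite !Rmult_0_r, expi_0.
  replace ((alpha + 3) * PI) with (alpha * PI + (2 * IZR 1 + 1) * PI) by ring.
  replace ((alpha + 1) * PI) with (alpha * PI + (2 * IZR 0 + 1) * PI) by ring.
  replace ((alpha - 1) * PI) with (alpha * PI + (2 * IZR (-1) + 1) * PI) by ring.
  rewrite !expi_plus_odd_PI.
  transitivity (- RtoC (/ 4) * Ci * RtoC (/ (alpha + 3) - 2 / (alpha + 1) + / (alpha - 1)) * (RtoC 1 + expi (alpha * PI)))%C.
  { rewrite RtoC_plus, RtoC_minus; ring. }
  do 3 f_equal.
  unfold r0, node; simpl; field; repeat split; try lra. }
rewrite E2 in E1.
assert (E3 : (RtoC 1 + expi (alpha * PI) = RtoC 2 * RtoC (cos (alpha * (PI / 2))) * expi (alpha * (PI / 2)))%C).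
{ replace (alpha * PI) with (2 * (alpha * (PI / 2))) by field.
  unfold expi; rewrite cos_2a_cos, sin_2a; apply injective_projections; simpl; ring. }
rewrite E3 in E1.
assert (Hr0 : RtoC r0 <> 0%C).
{ apply RtoC_neq_0, Rinv_neq_0_compat, rising_node_neq_0; split; assumption. }
set (X := (kappa * RtoC (cos (alpha * (PI / 2))) * expi (alpha * (PI / 2)))%C) in *.
assert (E4 : (RtoC r0 * RtoC PI = RtoC r0 * (- RtoC (/ 2) * Ci * X))%C).
{ rewrite <- RtoC_mult, E1; unfold X; replace (/ 2) with (/ 4 * 2) by field; rewrite RtoC_mult; ring. }
assert (E5 : (RtoC PI = - RtoC (/ 2) * Ci * X)%C).
{ transitivity (/ RtoC r0 * (RtoC r0 * RtoC PI))%C; [field; exact Hr0|]. rewrite E4; field; exact Hr0. }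
rewrite RtoC_mult, E5.
transitivity (- (Ci * Ci) * (RtoC 2 * RtoC (/ 2)) * X)%C; [|ring].
rewrite <- RtoC_mult; replace (2 * / 2) with 1 by field.
rewrite Ci_sqr; ring.
Qed.

Lemma fourier_sum_succ (alpha s : R) (m : nat) : admissible alpha -> (2 <= m)%nat ->
  (RtoC (INR m) * fourier_sum alpha (S m) s = (1 - expi (2 * s)) * fourier_sum alpha m s)%C.
Proof.
intros Ha Hm; unfold fourier_sum; rewrite S_INR.
replace ((alpha + (INR m + 1) - 2) * s) with ((alpha + INR m - 2) * s + s) by ring.
rewrite expi_plus.
transitivity (expi ((alpha + INR m - 2) * s) * expi s * (RtoC (INR m) * wave_sum alpha (S m) s))%C; [ring|].
rewrite (wave_sum_succ alpha m s Ha Hm), <- expi_minus_expi.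
replace (2 * s) with (s + s) by ring; rewrite expi_plus.
assert (E2 : (expi s * expi (- s) = RtoC 1)%C) by (rewrite <- expi_plus, Rplus_opp_r; apply expi_0).
rewrite <- E2; ring.
Qed.

(** Going down from level 3, where the closed form is known, by the recurrence. *)
Lemma fourier_sum_2 (alpha s : R) : admissible alpha -> 0 < s < PI ->
  fourier_sum alpha 2 s =
  (- RtoC (2 * PI * sin s / cos (alpha * (PI / 2))) * expi (alpha * (s - PI / 2)))%C.
Proof.
intros Ha Hs; destruct (wave_sum_3_sin alpha Ha) as [kappa Hk].
pose proof (wave_constant alpha kappa Ha Hk) as Hc.
pose proof (wave_sum_succ alpha 2 s Ha (le_n 2)) as H.
rewrite Hk in H by lra; replace (INR 2) with 2 in H by (simpl; ring).
assert (Hsin : RtoC (sin s) <> 0%C) by (apply RtoC_neq_0, Rgt_not_eq, sin_gt_0; lra).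
assert (Hcos : cos (alpha * (PI / 2)) <> 0).
{ intros E; rewrite E in Hc.
  assert (E0 : (RtoC (2 * PI) * Ci)%C = RtoC 0) by (rewrite <- Hc; ring).
  injection E0; intros E1 _; pose proof PI_RGT_0; lra. }
unfold fourier_sum.
replace ((alpha + INR 2 - 2) * s) with (alpha * s) by (simpl; ring).
assert (E : wave_sum alpha 2 s = (Ci * kappa * RtoC (sin s))%C).
{ transitivity ((- 2 * Ci * RtoC (sin s) * wave_sum alpha 2 s) * (Ci * RtoC (/ 2) * / RtoC (sin s)))%C.
  - replace (- 2 * Ci * RtoC (sin s) * wave_sum alpha 2 s * (Ci * RtoC (/ 2) * / RtoC (sin s)))%C with
      (- (Ci * Ci) * (2 * RtoC (/ 2)) * (RtoC (sin s) * / RtoC (sin s)) * wave_sum alpha 2 s)%C by ring.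
    rewrite Cinv_r by assumption; rewrite <- RtoC_mult; replace (2 * / 2) with 1 by field.
    rewrite Ci_sqr; ring.
  - rewrite <- H, RtoC_pow, RtoC_inv by lra; field; exact Hsin. }
rewrite E.
replace (alpha * (s - PI / 2)) with (alpha * s + - (alpha * (PI / 2))) by ring.
rewrite expi_plus, expi_opp.
assert (Hk2 : kappa = (RtoC (2 * PI) * Ci / (RtoC (cos (alpha * (PI / 2))) * expi (alpha * (PI / 2))))%C).
{ rewrite <- Hc; field; split; [apply expi_neq_0|apply RtoC_neq_0, Hcos]. }
rewrite Hk2, RtoC_div, (RtoC_mult (2 * PI)) by assumption.
transitivity ((Ci * Ci) * expi (alpha * s) * RtoC (2 * PI) * RtoC (sin s) * / (RtoC (cos (alpha * (PI / 2))) * expi (alpha * (PI / 2))))%C.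
{ field; split; [apply expi_neq_0|apply RtoC_neq_0, Hcos]. }
rewrite Ci_sqr.
field; split; [apply expi_neq_0|apply RtoC_neq_0, Hcos].
Qed.

Lemma fourier_sum_closed (alpha s : R) (j : nat) : admissible alpha ->
  fourier_sum alpha (j + 2) s =
  (RtoC (/ INR (fact (S j))) * Cpow (1 - expi (2 * s)) j * fourier_sum alpha 2 s)%C.
Proof.
intros Ha; induction j as [|j IH].
- simpl; rewrite Rinv_1; ring.
- pose proof (fourier_sum_succ alpha s (j + 2) Ha ltac:(lia)) as H; rewrite IH in H.
  change (S j + 2)%nat with (S (j + 2)).
  assert (Hn : INR (j + 2) <> 0) by (apply not_0_INR; lia).
  transitivity (RtoC (/ INR (j + 2)) * (RtoC (INR (j + 2)) * fourier_sum alpha (S (j + 2)) s))%C.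
  + rewrite RtoC_inv by assumption; field; apply RtoC_neq_0, Hn.
  + rewrite H, (fact_simpl (S j)), mult_INR, Rinv_mult, RtoC_mult.
    replace (S (S j)) with (j + 2)%nat by lia. rewrite (Cpow_S _ j); ring.
Qed.
(** * Gamma quotients and the Chu-Vandermonde identity *)

Definition non_integer (x : R) : Prop := forall m : Z, x + IZR m <> 0.

Lemma non_integer_nat (x : R) (n : nat) : non_integer x -> x + INR n <> 0.
Proof. intros H; rewrite INR_IZR_INZ; apply H. Qed.

Lemma non_integer_shift (x : R) (m : Z) : non_integer x -> non_integer (x + IZR m).
Proof. intros H j; rewrite Rplus_assoc, <- plus_IZR; apply H. Qed.

Lemma non_integer_reflect (x : R) : non_integer x -> non_integer (1 - x).
Proof.
intros H j E; apply (H (- (1 + j))%Z); rewrite opp_IZR, plus_IZR; lra.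
Qed.

Lemma non_integer_neq_0 (x : R) : non_integer x -> x <> 0.
Proof. intros H E; apply (H 0%Z); lra. Qed.

Lemma rising_neq_0 (x : R) (n : nat) : non_integer x -> rising x n <> 0.
Proof.
intros H; induction n as [|n IH]; simpl; [lra|].
apply Rmult_integral_contrapositive_currified; [exact IH|apply non_integer_nat, H].
Qed.

(** By the recurrence, every shift into the positive half line gives the same
    quotient, not only the least one. *)
Lemma Gamma_continuation (x : R) (n : nat) : non_integer x -> 0 < x + INR n ->
  Gamma x = Gamma_integral (x + INR n) / rising x n.
Proof.
intros Hx Hn.
assert (Hstep : forall n, 0 < x + INR n -> forall d,
  Gamma_integral (x + INR (n + d)) / rising x (n + d) = Gamma_integral (x + INR n) / rising x n).
{ intros p Hp d; induction d as [|d IH]; [rewrite Nat.add_0_r; reflexivity|].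
  rewrite <- IH; rewrite Nat.add_succ_r, S_INR, <- Rplus_assoc.
  assert (Hpd : 0 < x + INR (p + d)) by (rewrite plus_INR; pose proof (pos_INR d); lra).
  rewrite Gamma_integral_succ by assumption; simpl.
  field; split; try (apply rising_neq_0; exact Hx); lra. }
unfold Gamma; set (n0 := Z.to_nat (up (- x))).
assert (Hn0 : 0 < x + INR n0).
{ destruct (archimed (- x)) as [H _]; unfold n0; destruct (Z_le_gt_dec 0 (up (- x))) as [Hz|Hz].
  - rewrite INR_IZR_INZ, Z2Nat.id by assumption; lra.
  - assert (IZR (up (- x)) <= 0) by (apply IZR_le; lia).
    pose proof (pos_INR (Z.to_nat (up (- x)))); lra. }
rewrite <- (Hstep n0 Hn0 n), Nat.add_comm; apply Hstep, Hn.
Qed.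

Lemma exists_nat_above (x : R) : exists n : nat, 0 < x + INR n.
Proof.
destruct (INR_unbounded (- x)) as [n Hn]; exists n; lra.
Qed.

Lemma Gamma_neq_0 (x : R) : non_integer x -> Gamma x <> 0.
Proof.
intros Hx; destruct (exists_nat_above x) as [n Hn].
rewrite (Gamma_continuation x n Hx Hn).
apply Rmult_integral_contrapositive_currified.
- apply Rgt_not_eq, Gamma_integral_positive, Hn.
- apply Rinv_neq_0_compat, rising_neq_0, Hx.
Qed.

Lemma Gamma_succ (x : R) : non_integer x -> Gamma (x + 1) = x * Gamma x.
Proof.
intros Hx; destruct (exists_nat_above x) as [n Hn].
assert (Hx1 : non_integer (x + 1)) by (apply (non_integer_shift x 1), Hx).
rewrite (Gamma_continuation (x + 1) n Hx1 ltac:(lra)).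
rewrite (Gamma_continuation x (S n) Hx) by (rewrite S_INR; lra).
rewrite S_INR; replace (x + (INR n + 1)) with (x + 1 + INR n) by ring.
rewrite rising_shift; field; split; [apply rising_neq_0, Hx1|apply non_integer_neq_0, Hx].
Qed.

Lemma Gamma_rising (x : R) (n : nat) : non_integer x -> Gamma (x + INR n) = rising x n * Gamma x.
Proof.
intros Hx; induction n as [|n IH]; [simpl; rewrite Rplus_0_r; ring|].
rewrite S_INR, <- Rplus_assoc, Gamma_succ, IH.
- simpl; ring.
- rewrite INR_IZR_INZ; apply non_integer_shift, Hx.
Qed.

(** Passing from n to n + 1 multiplies both sides by (a + n)/(1 - a + n). *)
Lemma Gamma_quotient_even (a : R) (n : nat) : non_integer a ->
  Gamma (a + INR n) / Gamma (1 - a + INR n) = Gamma (a - INR n) / Gamma (1 - a - INR n).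
Proof.
intros Ha; pose proof (non_integer_reflect a Ha) as Hb.
assert (Sh : forall x m, non_integer x -> non_integer (x + INR m)).
{ intros x m Hx; rewrite INR_IZR_INZ; apply non_integer_shift, Hx. }
assert (Shm : forall x m, non_integer x -> non_integer (x - INR m)).
{ intros x m Hx; unfold Rminus; rewrite INR_IZR_INZ, <- opp_IZR; apply non_integer_shift, Hx. }
induction n as [|n IH]; [simpl; rewrite !Rplus_0_r, !Rminus_0_r; reflexivity|].
pose proof (Gamma_succ (a + INR n) (Sh _ _ Ha)) as E1.
pose proof (Gamma_succ (1 - a + INR n) (Sh _ _ Hb)) as E2.
pose proof (Gamma_succ (a - INR (S n)) (Shm _ _ Ha)) as E3.
pose proof (Gamma_succ (1 - a - INR (S n)) (Shm _ _ Hb)) as E4.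
rewrite !S_INR in *.
replace (a + INR n + 1) with (a + (INR n + 1)) in E1 by ring.
replace (1 - a + INR n + 1) with (1 - a + (INR n + 1)) in E2 by ring.
replace (a - (INR n + 1) + 1) with (a - INR n) in E3 by ring.
replace (1 - a - (INR n + 1) + 1) with (1 - a - INR n) in E4 by ring.
rewrite E1, E2.
assert (N1 : a - (INR n + 1) <> 0).
{ rewrite <- S_INR; apply non_integer_neq_0, Shm, Ha. }
assert (N2 : 1 - a + INR n <> 0) by (apply non_integer_neq_0, Sh, Hb).
pose proof (Gamma_neq_0 _ (Sh _ n Hb)) as N3.
pose proof (Gamma_neq_0 _ (Shm _ (S n) Hb)) as N4; rewrite S_INR in N4.
rewrite E3, E4 in IH.
assert (N5 : 1 - a - (INR n + 1) <> 0) by (rewrite <- S_INR; apply non_integer_neq_0, Shm, Hb).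
transitivity (Gamma (a + INR n) / Gamma (1 - a + INR n) * ((a + INR n) / (1 - a + INR n))); [field; auto|].
rewrite IH.
replace (1 - a - (INR n + 1)) with (- (a + INR n)) in * by ring.
replace (1 - a + INR n) with (- (a - (INR n + 1))) in * by ring.
field; repeat split; auto.
intros E; apply N5; lra.
Qed.

Lemma Gamma_quotient_abs (a : R) (l : Z) : non_integer a ->
  Gamma (a + Rabs (IZR l)) / Gamma (1 - a + Rabs (IZR l)) = Gamma (a + IZR l) / Gamma (1 - a + IZR l).
Proof.
intros Ha; destruct (Z_le_gt_dec 0 l) as [Hl|Hl].
- rewrite Rabs_pos_eq by (apply IZR_le, Hl); reflexivity.
- rewrite Rabs_left1 by (apply IZR_le; lia).
  pose proof (Gamma_quotient_even a (Z.to_nat (- l)) Ha) as H.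
  rewrite INR_IZR_INZ, Z2Nat.id, opp_IZR in H by lia.
  replace (a - - IZR l) with (a + IZR l) in H by ring.
  replace (1 - a - - IZR l) with (1 - a + IZR l) in H by ring. exact H.
Qed.

Lemma binomial_sum_plus (n : nat) (f g : nat -> C) :
  binomial_sum n (fun j => f j + g j)%C = (binomial_sum n f + binomial_sum n g)%C.
Proof.
revert f g; induction n as [|n IH]; intros f g; simpl; [reflexivity|].
rewrite IH, (IH (fun j => f (S j)) (fun j => g (S j))); ring.
Qed.

(** The absorption identity j C(n+1, j) = (n+1) C(n, j-1). *)
Lemma binomial_sum_weight (n : nat) (f : nat -> C) :
  binomial_sum (S n) (fun j => RtoC (INR j) * f j)%C =
  (RtoC (INR (S n)) * binomial_sum n (fun j => f (S j)))%C.
Proof.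
revert f; induction n as [|n IH]; intros f; [simpl; ring|].
change (binomial_sum (S (S n)) (fun j => RtoC (INR j) * f j)%C) with
  (binomial_sum (S n) (fun j => RtoC (INR j) * f j) + binomial_sum (S n) (fun j => RtoC (INR (S j)) * f (S j)))%C.
rewrite IH.
rewrite (binomial_sum_ext (S n) (fun j => RtoC (INR (S j)) * f (S j))%C
  (fun j => RtoC (INR j) * f (S j) + f (S j))%C).
2:{ intros j; rewrite S_INR, RtoC_plus; ring. }
rewrite binomial_sum_plus, (IH (fun j => f (S j))), (S_INR (S n)), RtoC_plus.
change (binomial_sum (S n) (fun j => f (S j))) with
  (binomial_sum n (fun j => f (S j)) + binomial_sum n (fun j => f (S (S j))))%C.
ring.
Qed.

Definition vandermonde_term (a c : R) (j : nat) : R := (-1) ^ j * (rising a j / rising c j).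

Lemma vandermonde_term_succ (a c : R) (j : nat) : non_integer c ->
  vandermonde_term a c (S j) = - (a / c) * vandermonde_term (a + 1) (c + 1) j.
Proof.
intros Hc; unfold vandermonde_term; rewrite !rising_shift; simpl pow; field; split.
- apply rising_neq_0, (non_integer_shift c 1), Hc.
- apply non_integer_neq_0, Hc.
Qed.

(** Chu-Vandermonde: Pascal's rule reads
    V_(n+1)(a, c) = V_n(a, c) - (a/c) V_n(a+1, c+1). *)
Lemma vandermonde (n : nat) (a c : R) : non_integer c ->
  binomial_sum n (fun j => RtoC (vandermonde_term a c j)) = RtoC (rising (c - a) n / rising c n).
Proof.
revert a c; induction n as [|n IH]; intros a c Hc.
- unfold vandermonde_term; simpl; f_equal; field.
- simpl binomial_sum.
  assert (Hc1 : non_integer (c + 1)) by (apply (non_integer_shift c 1), Hc).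
  rewrite (binomial_sum_ext n (fun j => RtoC (vandermonde_term a c (S j)))
    (fun j => RtoC (- (a / c)) * RtoC (vandermonde_term (a + 1) (c + 1) j))%C).
  2:{ intros j; rewrite vandermonde_term_succ, RtoC_mult by assumption; reflexivity. }
  rewrite binomial_sum_Cmult, !IH by assumption.
  rewrite <- RtoC_mult, <- RtoC_plus; f_equal.
  replace (c + 1 - (a + 1)) with (c - a) by ring.
  pose proof (non_integer_neq_0 c Hc) as N1; pose proof (non_integer_nat c n Hc) as N2.
  pose proof (rising_neq_0 c n Hc) as N3.
  assert (E : rising (c + 1) n = rising c n * (c + INR n) / c).
  { rewrite <- rising_succ_shift; field; exact N1. }
  rewrite E; simpl rising; field; auto.
Qed.

(** By absorption, the part with weight j is a Vandermonde sum with n lowered by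
    one and a, c raised by one. *)
Lemma vandermonde_weighted (n : nat) (a c : R) : non_integer c -> non_integer (c - a) ->
  binomial_sum n (fun j => RtoC (INR j + 2) * RtoC (vandermonde_term a c j))%C =
  RtoC (rising (c - a) n / rising c n * ((2 * (c - a + INR n - 1) - INR n * a) / (c - a + INR n - 1))).
Proof.
intros Hc Hd.
assert (Hd1 : c - a + INR n - 1 <> 0).
{ replace (c - a + INR n - 1) with (c - a + IZR (Z.of_nat n - 1)); [apply Hd|].
  rewrite minus_IZR, <- INR_IZR_INZ; ring. }
rewrite (binomial_sum_ext n _ (fun j => RtoC (INR j) * RtoC (vandermonde_term a c j) + RtoC 2 * RtoC (vandermonde_term a c j))%C).
2:{ intros j; rewrite RtoC_plus; ring. }
rewrite binomial_sum_plus, binomial_sum_Cmult, vandermonde by assumption.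
destruct n as [|n].
- simpl in *; unfold vandermonde_term; simpl; rewrite Cmult_0_l, Cplus_0_l, <- RtoC_mult; f_equal; field; lra.
- rewrite binomial_sum_weight.
  assert (Hc1 : non_integer (c + 1)) by (apply (non_integer_shift c 1), Hc).
  rewrite (binomial_sum_ext n (fun j => RtoC (vandermonde_term a c (S j)))
    (fun j => RtoC (- (a / c)) * RtoC (vandermonde_term (a + 1) (c + 1) j))%C).
  2:{ intros j; rewrite vandermonde_term_succ, RtoC_mult by assumption; reflexivity. }
  rewrite binomial_sum_Cmult, vandermonde by assumption.
  rewrite <- !RtoC_mult, <- RtoC_plus; f_equal.
  replace (c + 1 - (a + 1)) with (c - a) by ring.
  pose proof (non_integer_neq_0 c Hc) as N1; pose proof (rising_neq_0 (c + 1) n Hc1) as N2.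
  rewrite (rising_shift c); simpl rising; rewrite S_INR in *.
  replace (c - a + (INR n + 1) - 1) with (c - a + INR n) in * by ring.
  field; auto.
Qed.

Lemma admissible_non_integer (alpha : R) (l : Z) : admissible alpha ->
  non_integer (node alpha l) /\ non_integer (node alpha l - alpha).
Proof.
intros [Ha Ha1]; unfold node; split; intros m E.
- assert (E1 : (alpha - 1) / 2 = IZR (l - m)) by (rewrite minus_IZR; lra).
  assert (IZR (-1) < IZR (l - m) < IZR 1) by (simpl IZR at 1 3; lra).
  assert (l - m = 0)%Z as E2 by (destruct H as [H H']; apply lt_IZR in H; apply lt_IZR in H'; lia).
  rewrite E2 in E1; apply Ha1; lra.
- assert (E1 : (- alpha - 1) / 2 = IZR (l - m)) by (rewrite minus_IZR; lra).
  assert (IZR (-2) < IZR (l - m) < IZR 0) by (simpl IZR at 1 3; lra).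
  assert (l - m = -1)%Z as E2 by (destruct H as [H H']; apply lt_IZR in H; apply lt_IZR in H'; lia).
  rewrite E2 in E1; apply Ha1; simpl in E1; lra.
Qed.

Definition S_coef (alpha : R) (k l : Z) : R :=
  ((1 - alpha) * IZR k ^ 2 - 2 * IZR k * IZR l) *
         ((Gamma ((-1 + alpha) / 2 + Rabs (IZR l)) *
           Gamma ((-1 - alpha) / 2 + Rabs (IZR (k - l)))) /
          (Gamma ((3 - alpha) / 2 + Rabs (IZR l)) *
           Gamma ((3 + alpha) / 2 + Rabs (IZR (k - l))))).

(** Evenness is used with opposite orientations for l and for k - l; the four
    arguments are then y, y + 2 - alpha, y - alpha + k and y + k + 2, which pair up
    with integer differences. *)
Lemma S_coef_rational (alpha : R) (m : nat) (l : Z) : admissible alpha ->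
  let k := Z.of_nat (S m) in let y := node alpha l in
  S_coef alpha k l = ((1 - alpha) * IZR k ^ 2 - 2 * IZR k * IZR l) *
    (rising (y + 1 - alpha) m / ((y + 1 - alpha) * rising y (m + 3))).
Proof.
intros Ha k y; unfold S_coef; f_equal.
destruct (admissible_non_integer alpha l Ha) as [Ny Nz]; fold y in Ny, Nz.
assert (Hk : IZR k = INR m + 1) by (unfold k; rewrite <- INR_IZR_INZ, S_INR; reflexivity).
set (a := (-1 + alpha) / 2); set (b := (-1 - alpha) / 2).
assert (Na : non_integer a).
{ replace a with (y + IZR l) by (unfold a, y, node; field); apply non_integer_shift, Ny. }
assert (Nb : non_integer b).
{ replace b with (y - alpha + IZR l) by (unfold b, y, node; field); apply non_integer_shift, Nz. }
replace ((3 - alpha) / 2) with (1 - a) by (unfold a; field).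
replace ((3 + alpha) / 2) with (1 - b) by (unfold b; field).
pose proof (Gamma_quotient_abs a (- l) Na) as E1.
pose proof (Gamma_quotient_abs b (k - l) Nb) as E2.
rewrite opp_IZR, Rabs_Ropp in E1.
assert (Nyp : forall i, non_integer (y + IZR i)) by (intros; apply non_integer_shift, Ny).
assert (Nzp : forall i, non_integer (y - alpha + IZR i)) by (intros; apply non_integer_shift, Nz).
set (GA := Gamma (a + Rabs (IZR l))) in *; set (GA' := Gamma (1 - a + Rabs (IZR l))) in *.
set (GB := Gamma (b + Rabs (IZR (k - l)))) in *; set (GB' := Gamma (1 - b + Rabs (IZR (k - l)))) in *.
transitivity (GA / GA' * (GB / GB')).
{ unfold Rdiv; rewrite Rinv_mult; ring. }
rewrite E1, E2, minus_IZR.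
replace (a + - IZR l) with y by (unfold a, y, node; field).
replace (1 - a + - IZR l) with (y + 1 - alpha + 1) by (unfold a, y, node; field).
replace (b + (IZR k - IZR l)) with (y + 1 - alpha + INR m) by (rewrite Hk; unfold b, y, node; field).
replace (1 - b + (IZR k - IZR l)) with (y + INR (m + 3)) by (rewrite Hk, plus_INR; unfold b, y, node; simpl; field).
assert (Nz1 : non_integer (y + 1 - alpha)).
{ replace (y + 1 - alpha) with (y - alpha + IZR 1) by ring; apply Nzp. }
rewrite !Gamma_rising, Gamma_succ by assumption.
pose proof (Gamma_neq_0 _ Ny); pose proof (Gamma_neq_0 _ Nz1); pose proof (non_integer_neq_0 _ Nz1).
pose proof (rising_neq_0 y (m + 3) Ny).
field; repeat split; assumption.
Qed.

(** Chosen so that the term j of [Dfrac_closed] corresponds to the Fourier sum of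
    level j + 2: the factorial cancels the one in [fourier_sum_closed]. *)
Definition fourier_weight (alpha : R) (j : nat) : R :=
  higgins_coef alpha j * INR (fact (S j)) * (-1) ^ j.

(** The weight j (j+1) is used up in two steps: j by absorption, which leaves the
    weight j + 2 of [vandermonde_weighted].  The factor (1 - alpha) k - 2l is the
    numerator that the latter produces. *)
Lemma S_coef_binomial (alpha : R) (m : nat) (l : Z) : admissible alpha ->
  binomial_sum (S m) (fun j => RtoC (fourier_weight alpha j)
     * RtoC (/ rising (node alpha l) (j + 2)))%C =
  RtoC (- alpha * S_coef alpha (Z.of_nat (S m)) l).
Proof.
intros Ha; rewrite S_coef_rational by assumption.
set (y := node alpha l).
destruct (admissible_non_integer alpha l Ha) as [Ny Nz]; fold y in Ny, Nz.
assert (Hr3 : forall j, rising y (j + 3) = y * (y + 1) * (y + 2) * rising (y + 3) j).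
{ intros j; replace (j + 3)%nat with (S (S (S j))) by lia; rewrite !rising_shift.
  replace (y + 1 + 1) with (y + 2) by ring; replace (y + 2 + 1) with (y + 3) by ring; ring. }
assert (N0 : y <> 0) by (apply non_integer_neq_0, Ny).
assert (N1 : y + 1 <> 0) by (apply (Ny 1%Z)).
assert (N2 : y + 2 <> 0) by (apply (Ny 2%Z)).
assert (Ny3 : non_integer (y + 3)) by (apply (non_integer_shift y 3), Ny).
assert (Nd : non_integer (y + 3 - (alpha + 1))).
{ replace (y + 3 - (alpha + 1)) with (y - alpha + IZR 2) by ring; apply non_integer_shift, Nz. }
rewrite (binomial_sum_ext (S m) _ (fun j => RtoC (INR j) * RtoC ((INR j + 1) * rising alpha j * (-1) ^ j / rising y (j + 2)))%C).
2:{ intros j; rewrite <- !RtoC_mult; f_equal; unfold fourier_weight, higgins_coef; rewrite fact_simpl, mult_INR, S_INR.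
    field; split; [apply rising_neq_0, Ny|apply INR_fact_neq_0]. }
rewrite (binomial_sum_weight m (fun j => RtoC ((INR j + 1) * rising alpha j * (-1) ^ j / rising y (j + 2)))).
rewrite (binomial_sum_ext m _ (fun j => RtoC (- alpha / (y * (y + 1) * (y + 2))) *
   (RtoC (INR j + 2) * RtoC (vandermonde_term (alpha + 1) (y + 3) j)))%C).
2:{ intros j; rewrite <- !RtoC_mult; f_equal; unfold vandermonde_term.
    replace (S j + 2)%nat with (j + 3)%nat by lia; rewrite Hr3, rising_shift, S_INR; simpl pow.
    field; repeat split; auto. apply rising_neq_0, Ny3. }
rewrite binomial_sum_Cmult, vandermonde_weighted by assumption.
rewrite <- !RtoC_mult; f_equal; rewrite Hr3.
replace (y + 3 - (alpha + 1)) with (y + 1 - alpha + 1) in * by ring.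
set (d := y + 1 - alpha) in *.
assert (Ndd : non_integer d).
{ replace d with (y - alpha + IZR 1) by (unfold d; ring); apply non_integer_shift, Nz. }
assert (Nd0 : d <> 0) by (apply non_integer_neq_0, Ndd).
assert (Ndm : d + INR m <> 0) by (apply non_integer_nat, Ndd).
assert (E : rising (d + 1) m = rising d m * (d + INR m) / d).
{ rewrite <- rising_succ_shift; field; exact Nd0. }
rewrite E, <- INR_IZR_INZ, S_INR.
replace (d + 1 + INR m - 1) with (d + INR m) by ring.
assert (El : IZR l = (alpha - 1) / 2 - y) by (unfold y, node; ring).
rewrite El; pose proof (rising_neq_0 (y + 3) m Ny3).
replace (2 * (d + INR m) - INR m * (alpha + 1)) with
  ((1 - alpha) * (INR m + 1) - 2 * ((alpha - 1) / 2 - y)) by (unfold d; field).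
field; repeat split; auto.
Qed.

Lemma is_Zseries_binomial_sum (n : nat) (F : nat -> Z -> C) (T : nat -> C) :
  (forall j, is_Zseries (F j) (T j)) ->
  is_Zseries (fun l => binomial_sum n (fun j => F j l)) (binomial_sum n T).
Proof.
revert F T; induction n as [|n IH]; intros F T H; simpl; [apply H|].
apply (is_Zseries_plus (fun l => binomial_sum n (fun j => F j l)) (fun l => binomial_sum n (fun j => F (S j) l)));
  apply IH; intros j; apply H.
Qed.

Lemma is_Zseries_S_term (alpha s : R) (m : nat) : admissible alpha ->
  is_Zseries (S_term alpha (Z.of_nat (S m)) s)
   (RtoC (- / alpha) * fourier_sum alpha 2 s *
     binomial_sum (S m) (fun j => RtoC (higgins_coef alpha j) * Cpow (expi (2 * s) - 1) j))%C.
Proof.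
intros Ha; assert (Ha0 : alpha <> 0) by (destruct Ha; lra).
assert (H := is_Zseries_binomial_sum (S m)
  (fun j l => RtoC (fourier_weight alpha j) * fourier_term alpha (j + 2) s l)%C
  _ (fun j => is_Zseries_Cmult _ (RtoC (fourier_weight alpha j)) _
       (is_Zseries_fourier alpha (j + 2) s Ha ltac:(lia)))).
apply (is_Zseries_Cmult _ (RtoC (- / alpha))) in H.
rewrite <- Cmult_assoc, <- binomial_sum_Cmult.
rewrite (binomial_sum_ext (S m) (fun j => fourier_sum alpha 2 s * (RtoC (higgins_coef alpha j) * Cpow (expi (2 * s) - 1) j))%C
  (fun j => RtoC (fourier_weight alpha j) * fourier_sum alpha (j + 2) s)%C).
2:{ intros j; unfold fourier_weight; rewrite fourier_sum_closed by assumption.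
    replace (1 - expi (2 * s))%C with (RtoC (-1) * (expi (2 * s) - 1))%C by C_components.
    rewrite Cpow_mult_l, <- RtoC_pow.
    transitivity (RtoC (higgins_coef alpha j * INR (fact (S j)) * (-1) ^ j * / INR (fact (S j)) * (-1) ^ j) *
       (Cpow (expi (2 * s) - 1) j * fourier_sum alpha 2 s))%C.
    - replace (higgins_coef alpha j * INR (fact (S j)) * (-1) ^ j * / INR (fact (S j)) * (-1) ^ j)
        with (higgins_coef alpha j); [ring|].
      replace (higgins_coef alpha j * INR (fact (S j)) * (-1) ^ j * / INR (fact (S j)) * (-1) ^ j)
        with (higgins_coef alpha j * ((-1) ^ j * (-1) ^ j)) by (field; apply INR_fact_neq_0).
      rewrite <- Rpow_mult_distr; replace (-1 * -1) with 1 by ring; rewrite pow1; ring.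
    - rewrite !(RtoC_mult _ ((-1) ^ j)), !RtoC_mult; ring. }
apply (is_Zseries_ext _ _ _) with (2 := H); intros l.
unfold fourier_term.
rewrite (binomial_sum_ext (S m) _ (fun j => expi (2 * IZR l * s) * (RtoC (fourier_weight alpha j)
     * RtoC (/ rising (node alpha l) (j + 2))))%C).
2:{ intros j; ring. }
rewrite binomial_sum_Cmult, S_coef_binomial by assumption.
unfold S_term; fold (S_coef alpha (Z.of_nat (S m)) l).
rewrite RtoC_mult.
transitivity (RtoC (- / alpha * - alpha) * (expi (2 * IZR l * s) * RtoC (S_coef alpha (Z.of_nat (S m)) l)))%C.
- rewrite RtoC_mult; ring.
- replace (- / alpha * - alpha) with 1 by (field; exact Ha0); ring.
Qed.
(** * Comparison of the two sides for k > 0 *)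

Lemma admissible_trig (alpha : R) : admissible alpha ->
  sin (alpha * (PI / 2)) <> 0 /\ cos (alpha * (PI / 2)) <> 0.
Proof.
intros [Ha Ha1]; pose proof PI_RGT_0 as HPI; split.
- apply Rgt_not_eq, sin_gt_0; nra.
- destruct (Rlt_dec alpha 1) as [H|H].
  + apply Rgt_not_eq, cos_gt_0; nra.
  + apply Rlt_not_eq, cos_lt_0; nra.
Qed.

Lemma S_sum_prefactor (alpha s : R) : admissible alpha -> 0 < s < PI ->
  c_const alpha * Rpower (sin s) (alpha - 1) / (2 * tan (alpha * (PI / 2))) * (- / alpha) *
  - (2 * PI * sin s / cos (alpha * (PI / 2))) = Gamma_integral alpha * Rpower (sin s) alpha.
Proof.
intros Ha Hs; destruct (admissible_trig alpha Ha) as [Hsin Hcos]; destruct Ha as [Ha Ha1].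
rewrite c_const_closed by assumption; pose proof PI_RGT_0 as HPI.
assert (Hss : 0 < sin s) by (apply sin_gt_0; lra).
rewrite Rpower_pred by assumption; unfold tan; field; repeat split; lra.
Qed.

Lemma Dfrac_closed_S_sum (alpha s : R) (m : nat) : admissible alpha -> 0 < s < PI ->
  Dfrac_closed alpha (S m) (cot s) =
  (expi (- (alpha * (PI / 2))) * S_sum alpha (Z.of_nat (S m)) s)%C.
Proof.
intros Ha Hs; rewrite Dfrac_closed_cot by assumption; unfold S_sum.
rewrite (proj2 (is_Zseries_unique _ _ (is_Zseries_S_term alpha s m Ha))).
rewrite fourier_sum_2 by assumption.
rewrite <- (S_sum_prefactor alpha s Ha Hs).
set (B := binomial_sum _ _).
replace (- (alpha * (PI - s))) with (- (alpha * (PI / 2)) + alpha * (s - PI / 2)) by field.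
set (A := c_const alpha * Rpower (sin s) (alpha - 1) / (2 * tan (alpha * (PI / 2)))).
set (q := 2 * PI * sin s / cos (alpha * (PI / 2))); set (r := - / alpha).
rewrite expi_plus, !RtoC_mult, (RtoC_opp q); ring.
Qed.

(** * Negative k and the reflected operator *)

(** A quotient conj(w)/w has its conjugate as inverse, and x -> -x replaces w by
    -conj(w): both k -> -k and x -> -x act by conjugation. *)
Lemma higgins_ratio_conj (x : R) :
  ((Ci * RtoC x - RtoC 1) / (Ci * RtoC x + RtoC 1))%C = (Cconj (upper_point x) / upper_point x)%C.
Proof.
rewrite higgins_ratio.
replace (Cconj (upper_point x)) with (upper_point x + minus_2i)%C by C_components.
field; apply upper_point_neq_0.
Qed.

Lemma Cconj_neq_0 (z : C) : z <> 0%C -> Cconj z <> 0%C.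
Proof. intros Hz E; apply Hz; rewrite <- (Cconj_conj z), E; apply injective_projections; simpl; ring. Qed.

Lemma Cconj_higgins_pos (p : positive) (x : R) : Cconj (higgins (Zpos p) x) = higgins (Zneg p) x.
Proof.
unfold higgins, Cpowz; rewrite higgins_ratio_conj, Cpow_conj.
pose proof (upper_point_neq_0 x) as H; pose proof (Cconj_neq_0 _ H) as H'.
assert (Hi : (/ upper_point x)%C <> 0%C).
{ apply Cmod_gt_0; rewrite Cmod_inv by exact H; apply Rinv_0_lt_compat, Cmod_gt_0, H. }
rewrite <- Cpow_inv by (apply Cmult_neq_0; assumption).
f_equal; rewrite Cdiv_conj, Cconj_conj by assumption; field; auto.
Qed.

Lemma higgins_opp (k : Z) (x : R) : higgins k (- x) = Cconj (higgins k x).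
Proof.
assert (H : forall p, higgins (Zpos p) (- x) = Cconj (higgins (Zpos p) x)).
{ intros p; unfold higgins, Cpowz; rewrite !higgins_ratio_conj, Cpow_conj; f_equal.
  pose proof (upper_point_neq_0 x) as H; pose proof (Cconj_neq_0 _ H) as H'.
  rewrite Cdiv_conj, Cconj_conj by assumption.
  replace (upper_point (- x)) with (- Cconj (upper_point x))%C by C_components.
  rewrite Copp_conj, Cconj_conj; field; auto. }
destruct k as [|p|p].
- apply injective_projections; simpl; ring.
- apply H.
- rewrite <- !Cconj_higgins_pos, H; reflexivity.
Qed.

Lemma is_derive_Cconj (f : R -> C) (x : R) (l : C) :
  is_Cderive f x l ->
  is_Cderive (fun t => Cconj (f t)) x (Cconj l).
Proof.
intros H; apply is_derive_C_pair; simpl; [apply is_derive_Re, H|].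
apply (is_derive_opp (V := R_NormedModule)), is_derive_Im, H.
Qed.

Lemma is_derive_C_opp_arg (f : R -> C) (x : R) (l : C) :
  is_Cderive f (- x) l ->
  is_Cderive (fun t => f (- t)) x (- l)%C.
Proof.
intros H.
assert (Ho : is_derive (fun t : R => - t) x (-1)) by (auto_derive; auto; ring).
pose proof (is_derive_comp (V := CR) f (fun t => - t) x l (-1) H Ho) as HC.
rewrite scal_R_Cmult in HC.
replace (- l)%C with (RtoC (-1) * l)%C by C_components.
exact HC.
Qed.

Lemma is_derive_higgins (k : Z) (x : R) :
  is_Cderive (higgins k) x (RC_derive (higgins k) x).
Proof.
assert (Hex : exists l, is_Cderive (higgins k) x l).
{ assert (Hp : forall p, exists l, is_Cderive (higgins (Zpos p)) x l).
  { intros p; eexists.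
    apply (is_derive_ext (V := CR) (fun t => Cpow (1 + minus_2i * / upper_point t) (Pos.to_nat p))).
    { intros t; rewrite <- higgins_ratio; reflexivity. }
    apply is_derive_Cpow, (is_derive_plus (V := CR) (fun _ => RtoC 1)).
    - apply is_Cderive_const.
    - apply (is_derive_Cmult (fun _ => minus_2i)); [apply is_Cderive_const|].
      apply is_derive_inv_upper_point. }
  destruct k as [|p|p].
  - eexists; apply is_Cderive_const.
  - apply Hp.
  - destruct (Hp p) as [l Hl]; exists (Cconj l).
    apply (is_derive_ext (V := CR) (fun t => Cconj (higgins (Zpos p) t))); [apply Cconj_higgins_pos|].
    apply is_derive_Cconj, Hl. }
destruct Hex as [l Hl]; rewrite (is_RC_derive_unique _ _ _ Hl); exact Hl.
Qed.

Lemma RC_derive_higgins_neg (p : positive) (x : R) :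
  RC_derive (higgins (Zneg p)) x = Cconj (RC_derive (higgins (Zpos p)) x).
Proof.
apply is_RC_derive_unique, (is_derive_ext (V := CR) (fun t => Cconj (higgins (Zpos p) t))).
- apply Cconj_higgins_pos.
- apply is_derive_Cconj, is_derive_higgins.
Qed.

Lemma RC_derive_higgins_opp (k : Z) (x : R) :
  RC_derive (higgins k) x = (- Cconj (RC_derive (higgins k) (- x)))%C.
Proof.
apply is_RC_derive_unique, (is_derive_ext (V := CR) (fun t => Cconj (higgins k (- t)))).
- intros t; rewrite higgins_opp, Cconj_conj; reflexivity.
- rewrite <- Copp_conj; apply (is_derive_Cconj (fun t => higgins k (- t))), is_derive_C_opp_arg, is_derive_higgins.
Qed.

Lemma RC_derive_higgins_0 (x : R) : RC_derive (higgins 0) x = RtoC 0.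
Proof. apply is_RC_derive_unique, (is_derive_const (K := R_AbsRing) (V := CR)). Qed.

Definition Dfrac_value (a : R) (k : Z) (x : R) : C :=
  match k with
  | Z0 => RtoC 0
  | Zpos p => Dfrac_closed a (Pos.to_nat p) x
  | Zneg p => Cconj (Dfrac_closed a (Pos.to_nat p) x)
  end.

Lemma Cconj_RtoC (r : R) : Cconj (RtoC r) = RtoC r.
Proof. apply injective_projections; simpl; ring. Qed.

Lemma Cconj_div_Rpower (u : C) (z b : R) :
  Cconj (u / RtoC (Rpower z b)) = (Cconj u / RtoC (Rpower z b))%C.
Proof.
rewrite Cdiv_conj, Cconj_RtoC by (apply RtoC_neq_0, Rgt_not_eq, Rpower_pos); reflexivity.
Qed.

Lemma integral_Dfrac_higgins (b x : R) (k : Z) : 0 < b < 1 ->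
  Cintegral (Dfrac_integrand b (higgins k) x)
    (RtoC (Gamma_integral (1 - b)) * Dfrac_value b k x)%C.
Proof.
intros Hb; destruct k as [|p|p]; simpl Dfrac_value.
- pose proof (integral_Cmult _ (RtoC 0) _ (integral_Dfrac_higgins_pos b x 1 Hb)) as H.
  rewrite Cmult_0_r; rewrite Cmult_0_l in H.
  apply (integral_ext (V := CR)) with (2 := H); intros z Hz.
  unfold Dfrac_integrand; rewrite RC_derive_higgins_0; unfold Cdiv.
  C_ring.
- apply integral_Dfrac_higgins_pos, Hb.
- rewrite <- (Cconj_RtoC (Gamma_integral (1 - b))), <- Cmult_conj.
  apply (integral_ext (V := CR)) with (2 := integral_Cconj _ _ (integral_Dfrac_higgins_pos b x p Hb)).
  intros z Hz; unfold Dfrac_integrand; rewrite RC_derive_higgins_neg, Cconj_div_Rpower; reflexivity.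
Qed.

Lemma integral_Dfrac_bar_higgins (b x : R) (k : Z) : 0 < b < 1 ->
  Cintegral (Dfrac_bar_integrand b (higgins k) x)
    (RtoC (Gamma_integral (1 - b)) * - Cconj (Dfrac_value b k (- x)))%C.
Proof.
intros Hb.
pose proof (integral_Cmult _ (RtoC (-1)) _ (integral_Cconj _ _ (integral_Dfrac_higgins b (- x) k Hb))) as H.
rewrite Cmult_conj, Cconj_RtoC in H.
replace (RtoC (Gamma_integral (1 - b)) * - Cconj (Dfrac_value b k (- x)))%C with
  (RtoC (-1) * (RtoC (Gamma_integral (1 - b)) * Cconj (Dfrac_value b k (- x))))%C
  by C_components.
apply (integral_ext (V := CR)) with (2 := H); intros z Hz.
unfold Dfrac_bar_integrand, Dfrac_integrand; rewrite Cconj_div_Rpower, (RC_derive_higgins_opp k (x + z)).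
replace (- (x + z)) with (- x - z) by ring.
replace (- Cconj (RC_derive (higgins k) (- x - z)))%C with (RtoC (-1) * Cconj (RC_derive (higgins k) (- x - z)))%C
  by C_components.
unfold Cdiv; C_ring.
Qed.

Lemma Gamma_cancel (b : R) (z : C) : 0 < b < 1 ->
  (RtoC (/ Gamma (1 - b)) * (RtoC (Gamma_integral (1 - b)) * z))%C = z.
Proof.
intros Hb; rewrite Gamma_pos by lra; pose proof (Gamma_integral_positive (1 - b) ltac:(lra)).
rewrite Cmult_assoc, <- RtoC_mult, Rinv_l by lra; ring.
Qed.

Lemma Dfrac_higgins (b x : R) (k : Z) : 0 < b < 1 ->
  ex_Dfrac b (higgins k) x /\ Dfrac b (higgins k) x = Dfrac_value b k x.
Proof.
intros Hb; pose proof (integral_Dfrac_higgins b x k Hb) as H; split; [eexists; exact H|].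
unfold Dfrac; rewrite (is_RInt_gen_unique (V := C_R_CompleteNormedModule) _ _ H).
apply Gamma_cancel, Hb.
Qed.

Lemma Dfrac_bar_higgins (b x : R) (k : Z) : 0 < b < 1 ->
  ex_Dfrac_bar b (higgins k) x /\ Dfrac_bar b (higgins k) x = (- Cconj (Dfrac_value b k (- x)))%C.
Proof.
intros Hb; pose proof (integral_Dfrac_bar_higgins b x k Hb) as H; split; [eexists; exact H|].
unfold Dfrac_bar; rewrite (is_RInt_gen_unique (V := C_R_CompleteNormedModule) _ _ H).
apply Gamma_cancel, Hb.
Qed.

Lemma is_derive_Dfrac_value (b x : R) (k : Z) : 0 < b ->
  is_Cderive (Dfrac_value b k) x (Dfrac_value (b + 1) k x).
Proof.
intros Hb; destruct k as [|p|p]; simpl.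
- apply is_Cderive_const.
- apply is_derive_Dfrac_closed, Hb.
- apply is_derive_Cconj, is_derive_Dfrac_closed, Hb.
Qed.

Lemma S_term_neg (alpha s : R) (p : positive) (l : Z) :
  S_term alpha (Zneg p) s l = Cconj (S_term alpha (Zpos p) s (- l)).
Proof.
unfold S_term; rewrite Cmult_conj, Cconj_RtoC, Cconj_expi.
change (Zneg p) with (- Zpos p)%Z.
replace (- Zpos p - l)%Z with (- (Zpos p - - l))%Z by lia.
rewrite !opp_IZR, !Rabs_Ropp; f_equal; f_equal; ring.
Qed.

Lemma is_Zseries_S_term_0 (alpha s : R) : is_Zseries (S_term alpha 0 s) (RtoC 0).
Proof.
apply (is_Zseries_ext (fun l => if Z.eq_dec l 0 then RtoC 0 else RtoC 0)); [|apply is_Zseries_delta].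
intros l; unfold S_term.
replace ((1 - alpha) * 0 ^ 2 - 2 * 0 * IZR l) with 0 by ring.
rewrite Rmult_0_l, Cmult_0_r; destruct Z.eq_dec; reflexivity.
Qed.

Lemma ex_is_Zseries_S_term (alpha s : R) (k : Z) : admissible alpha ->
  exists S, is_Zseries (S_term alpha k s) S.
Proof.
intros Ha.
assert (Hp : forall p, exists S, is_Zseries (S_term alpha (Zpos p) s) S).
{ intros p; pose proof (is_Zseries_S_term alpha s (pred (Pos.to_nat p)) Ha) as H.
  rewrite Nat.succ_pred, positive_nat_Z in H by (pose proof (Pos2Nat.is_pos p); lia).
  eexists; exact H. }
destruct k as [|p|p].
- eexists; apply is_Zseries_S_term_0.
- apply Hp.
- destruct (Hp p) as [S HS]; exists (Cconj S).
  apply (is_Zseries_ext (fun l => Cconj (S_term alpha (Zpos p) s (- l)))).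
  + intros l; symmetry; apply S_term_neg.
  + apply (is_Zseries_Cconj (fun l => S_term alpha (Zpos p) s (- l))), is_Zseries_opp_index, HS.
Qed.

Lemma S_sum_0 (alpha s : R) : S_sum alpha 0 s = RtoC 0.
Proof.
unfold S_sum; rewrite (proj2 (is_Zseries_unique _ _ (is_Zseries_S_term_0 alpha s))); ring.
Qed.

Lemma S_sum_neg (alpha s : R) (p : positive) : admissible alpha ->
  S_sum alpha (Zneg p) s = Cconj (S_sum alpha (Zpos p) s).
Proof.
intros Ha; destruct (ex_is_Zseries_S_term alpha s (Zpos p) Ha) as [S HS].
assert (H : is_Zseries (S_term alpha (Zneg p) s) (Cconj S)).
{ apply (is_Zseries_ext (fun l => Cconj (S_term alpha (Zpos p) s (- l)))).
  - intros l; symmetry; apply S_term_neg.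
  - apply (is_Zseries_Cconj (fun l => S_term alpha (Zpos p) s (- l))), is_Zseries_opp_index, HS. }
unfold S_sum; rewrite (proj2 (is_Zseries_unique _ _ H)), (proj2 (is_Zseries_unique _ _ HS)).
rewrite Cmult_conj, Cconj_RtoC; reflexivity.
Qed.

(** The substitution s -> pi - s conjugates e^(2ils) and preserves sin s. *)
Lemma S_sum_reflect (alpha s : R) (k : Z) : admissible alpha ->
  Cconj (S_sum alpha k (PI - s)) = S_sum alpha k s.
Proof.
intros Ha; destruct (ex_is_Zseries_S_term alpha (PI - s) k Ha) as [S HS].
assert (H : is_Zseries (S_term alpha k s) (Cconj S)).
{ apply (is_Zseries_ext (fun l => Cconj (S_term alpha k (PI - s) l))); [|apply is_Zseries_Cconj, HS].
  intros l; unfold S_term; rewrite Cmult_conj, Cconj_RtoC, Cconj_expi; f_equal.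
  replace (- (2 * IZR l * (PI - s))) with (2 * IZR (- l) * PI + 2 * IZR l * s) by (rewrite opp_IZR; ring).
  rewrite expi_plus, expi_2PI; ring. }
unfold S_sum; rewrite (proj2 (is_Zseries_unique _ _ H)), (proj2 (is_Zseries_unique _ _ HS)).
rewrite Cmult_conj, Cconj_RtoC, sin_PI_x; reflexivity.
Qed.

Lemma Dfrac_value_S_sum (alpha s : R) (k : Z) : admissible alpha -> 0 < s < PI ->
  Dfrac_value alpha k (cot s) = (expi (- IZR (Z.sgn k) * alpha * (PI / 2)) * S_sum alpha k s)%C.
Proof.
intros Ha Hs.
assert (Hp : forall p, Dfrac_closed alpha (Pos.to_nat p) (cot s) =
   (expi (- (alpha * (PI / 2))) * S_sum alpha (Zpos p) s)%C).
{ intros p; pose proof (Dfrac_closed_S_sum alpha s (pred (Pos.to_nat p)) Ha Hs) as H.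
  rewrite Nat.succ_pred, positive_nat_Z in H by (pose proof (Pos2Nat.is_pos p); lia). exact H. }
destruct k as [|p|p]; simpl Dfrac_value.
- rewrite S_sum_0; ring.
- rewrite Hp; do 2 f_equal; simpl; ring.
- rewrite Hp, Cmult_conj, Cconj_expi, S_sum_neg by assumption; do 2 f_equal; simpl; ring.
Qed.

Lemma Dfrac_value_reflect_S_sum (alpha s : R) (k : Z) : admissible alpha -> 0 < s < PI ->
  Cconj (Dfrac_value alpha k (- cot s)) = (expi (IZR (Z.sgn k) * alpha * (PI / 2)) * S_sum alpha k s)%C.
Proof.
intros Ha Hs.
replace (- cot s) with (cot (PI - s)).
2:{ unfold cot; rewrite sin_PI_x, cos_minus, cos_PI, sin_PI; field.
    apply Rgt_not_eq, sin_gt_0; lra. }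
rewrite Dfrac_value_S_sum, Cmult_conj, S_sum_reflect, Cconj_expi by (auto; lra).
do 2 f_equal; ring.
Qed.

Theorem corollary2p2 (k : Z) (s : R) (hs : 0 < s < PI) :
  (forall alpha : R, 0 < alpha < 1 ->
     ex_Zseries (S_term alpha k s) /\
     ex_Dfrac alpha (higgins k) (cot s) /\
     ex_Dfrac_bar alpha (higgins k) (cot s) /\
     Dfrac alpha (higgins k) (cot s) =
       (expi (- IZR (Z.sgn k) * alpha * (PI / 2)) * S_sum alpha k s)%C /\
     Dfrac_bar alpha (higgins k) (cot s) =
       (- (expi (IZR (Z.sgn k) * alpha * (PI / 2)) * S_sum alpha k s))%C) /\
  (forall alpha : R, 1 < alpha < 2 ->
     ex_Zseries (S_term alpha k s) /\
     (forall x : R, ex_Dfrac (alpha - 1) (higgins k) x) /\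
     (forall x : R, ex_Dfrac_bar (alpha - 1) (higgins k) x) /\
     is_derive (K := R_AbsRing) (V := C_R_NormedModule)
       (Dfrac (alpha - 1) (higgins k)) (cot s)
       (expi (- IZR (Z.sgn k) * alpha * (PI / 2)) * S_sum alpha k s)%C /\
     is_derive (K := R_AbsRing) (V := C_R_NormedModule)
       (Dfrac_bar (alpha - 1) (higgins k)) (cot s)
       (expi (IZR (Z.sgn k) * alpha * (PI / 2)) * S_sum alpha k s)%C).
Proof.
split; intros alpha Halpha.
- assert (Ha : admissible alpha) by (split; lra).
  destruct (Dfrac_higgins alpha (cot s) k Halpha) as [HD ED].
  destruct (Dfrac_bar_higgins alpha (cot s) k Halpha) as [HB EB].
  destruct (ex_is_Zseries_S_term alpha s k Ha) as [S HS].
  split; [apply (is_Zseries_unique _ _ HS)|]; split; [exact HD|]; split; [exact HB|]; split.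
  + rewrite ED; apply Dfrac_value_S_sum; assumption.
  + rewrite EB, Dfrac_value_reflect_S_sum by assumption; reflexivity.
- assert (Ha : admissible alpha) by (split; lra).
  assert (Hb : 0 < alpha - 1 < 1) by lra.
  destruct (ex_is_Zseries_S_term alpha s k Ha) as [S HS].
  split; [apply (is_Zseries_unique _ _ HS)|].
  split; [intros x; apply Dfrac_higgins, Hb|].
  split; [intros x; apply Dfrac_bar_higgins, Hb|].
  assert (Hd : forall x, is_Cderive (Dfrac_value (alpha - 1) k) x (Dfrac_value alpha k x)).
  { intros x; replace (Dfrac_value alpha k x) with (Dfrac_value (alpha - 1 + 1) k x) by (f_equal; ring).
    apply is_derive_Dfrac_value; lra. }
  split.
  + rewrite <- Dfrac_value_S_sum by assumption.
    apply (is_derive_ext (V := CR) (Dfrac_value (alpha - 1) k)); [|apply Hd].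
    intros x; symmetry; apply Dfrac_higgins, Hb.
  + rewrite <- Dfrac_value_reflect_S_sum by assumption.
    apply (is_derive_ext (V := CR) (fun x => - Cconj (Dfrac_value (alpha - 1) k (- x)))%C).
    { intros x; symmetry; apply Dfrac_bar_higgins, Hb. }
    replace (Cconj (Dfrac_value alpha k (- cot s))) with (- Cconj (- Dfrac_value alpha k (- cot s)))%C
      by (rewrite Copp_conj; ring).
    apply (is_derive_opp (V := CR) (fun x => Cconj (Dfrac_value (alpha - 1) k (- x)))).
    apply (is_derive_Cconj (fun x => Dfrac_value (alpha - 1) k (- x))), is_derive_C_opp_arg, Hd.
Qed.
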